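(* Let $\{t_n\}_{n=1}^\infty$ be a sequence of distinct nonzero complex numbers with $|t_n|\to\infty$ and with finite convergence exponent, i.e. $\sum_n |t_n|^{-L}<\infty$ for some $L>0$. Let $\{c_n\}_{n=1}^\infty$ be a sequence of nonzero complex numbers such that $\sum_{n=1}^\infty |c_n|<\infty$ and $\sum_{n=1}^\infty c_n\neq 0$, and let $f$ be the meromorphic function on $\mathbb{C}$ given by $$f(z)=\sum_{n=1}^\infty \frac{c_n}{(z-t_n)^2}.$$ Then $\delta(0,f)=0$, and the orders of $N(r,1/f)$, $N(r,f)$ and $T(r,f)$ coincide, that is, $$\limsup_{r\to\infty}\frac{\log N(r,1/f)}{\log r}=\limsup_{r\to\infty}\frac{\log N(r,f)}{\log r}=\limsup_{r\to\infty}\frac{\log T(r,f)}{\log r}.$$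
   Context: Nevanlinna notation: for a meromorphic function $f$ on $\mathbb{C}$, $n(r,f)$ is the number of poles of $f$ in $\{|z|\le r\}$ counted with multiplicity, and $$N(r,f)=\int_0^r\frac{n(t,f)-n(0,f)}{t}\,dt+n(0,f)\log r,\qquad m(r,f)=\frac1{2\pi}\int_0^{2\pi}\log^+|f(re^{it})|\,dt,$$ where $\log^+x=\max(\log x,0)$, and $T(r,f)=N(r,f)+m(r,f)$. The defect of the value $0$ is $$\delta(0,f)=\liminf_{r\to\infty}\frac{m(r,1/f)}{T(r,f)}=1-\limsup_{r\to\infty}\frac{N(r,1/f)}{T(r,f)}.$$ *)

(* Defs.v *)
From HB Require Import structures.
From mathcomp Require Import all_boot all_order all_algebra.
From mathcomp Require Import all_classical all_reals all_analysis.
From mathcomp Require Import complex.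

Set Implicit Arguments.
Unset Strict Implicit.
Unset Printing Implicit Defensive.

Import Order.TTheory GRing.Theory Num.Theory.
Import numFieldNormedType.Exports.
Import ComplexField.Normc.

Local Open Scope ring_scope.
Local Open Scope complex_scope.
Local Open Scope classical_set_scope.

Section Nevanlinna.
Variable R : realType.
(* As in the library, the normed space structure (over itself) of a field is
   carried by ^o; [derivable g z 1] is then complex differentiability at z. *)
Local Notation C := R[i]^o.
Local Notation leb := (@lebesgue_measure R).
Implicit Types (f : C -> C) (r : R) (a : C).

(* Meromorphic functions are represented by total functions; the values taken
   at the (isolated) poles are irrelevant to every notion below. *)

Definition holomorphic_at (g : C -> C) a : Prop :=
  \forall z \near a, derivable g z 1.

(* f has a pole of multiplicity k at a; k = 0 says that f extends
   holomorphically across a with a nonzero value. *)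
Definition has_pole_order f a (k : nat) : Prop :=
  exists g : C -> C,
    [/\ holomorphic_at g a, g a != 0
      & \forall z \near a^', f z = g z / (z - a) ^+ k].

(* At a zero of f no k : nat qualifies, and the default 0 is returned. *)
Definition pole_mult f a : nat := xget 0%N [set k | has_pole_order f a k].

(* The sum runs over the support, finite when f is meromorphic. *)
Definition pole_count r f : R :=
  \sum_(z \in [set z : C | normc z <= r]) ((pole_mult f z)%:R : R).

Definition integrated_count r f : R :=
  \int[leb]_(t in `[0, r]) ((pole_count t f - pole_count 0 f) / t)
    + pole_count 0 f * ln r.

(* [ln 0 = 0] is harmless, as the maximum with 0 is taken. *)
Definition logp (x : R) : R := Num.max (ln x) 0.

Definition proximity r f : R :=
  (2 * pi)^-1 *
    \int[leb]_(t in `[0, 2 * pi]) logp (normc (f (r * cos t +i* (r * sin t)))).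

Definition characteristic r f : R := integrated_count r f + proximity r f.

Definition recip f : C -> C := fun z => (f z)^-1.

Definition defect0 f : \bar R :=
  limf_einf (fun r => (proximity r (recip f) / characteristic r f)%:E)
    (pinfty_nbhs R).

Definition growth_order (h : R -> R) : \bar R :=
  limf_esup (fun r => (ln (h r) / ln r)%:E) (pinfty_nbhs R).

End Nevanlinna.

(* Main.v *)
Require Import Defs.
From HB Require Import structures.
From mathcomp Require Import all_boot all_order all_algebra.
From mathcomp Require Import all_classical all_reals all_analysis measurable_realfun.
From mathcomp Require Import complex.
From mathcomp Require Import ring lra zify.

Set Implicit Arguments.
Unset Strict Implicit.
Unset Printing Implicit Defensive.

Import Order.TTheory GRing.Theory Num.Theory.
Import numFieldNormedType.Exports.
Import ComplexField.Normc.

Local Open Scope ring_scope.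
Local Open Scope complex_scope.
Local Open Scope classical_set_scope.

Local Notation Rp := complex.Re.
Local Notation Ip := complex.Im.

(** The argument follows the logarithm of the modulus of f. On a disc of radius
    R1 the series is Z(z) G(z) / T(z), where T is the product over the double
    poles, Z the product over the zeros in a disc of radius R0 at most R1/4, and
    G has no zero in that smaller disc. Averaging over circles gives the Jensen
    formula (jensen): up to a constant,
    N(r,1/f) - N(r,f) = m(r,f) - m(r,1/f). The theorem then amounts to two facts:
    m(r,1/f) is o(N(88 r,f)), and N(88 r,f) is at most a constant times N(r,f)
    for suitable arbitrarily large r.

    The second fact is where the finite convergence exponent enters: N(r,f) is
    bounded by a power of r (finite_order), so it cannot be multiplied by a huge
    factor at every dilation (regular_scale, regular_radius).

    The first fact needs a point near each point of the circle at which |f| is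
    not small. On an arc of angle comparable to 1/K of a circle |z| = rho near
    |z| = r, compare F(z) = sum c_n / (z - t_n), whose derivative is -f, with its
    leading term s/z, where s = sum c_n is nonzero. The modulus of the difference
    sum c_n t_n / (z (z - t_n)) has mean o(1/r) over the circle when rho is well
    chosen; so F varies by at least a constant times 1/r along the arc, and |f|
    is at least a constant times r^-2 somewhere on it (arc_partial,
    arc_lower_bound). The radius rho is found by averaging
    (good_radius), which also keeps it away from the moduli of the poles.

    From the good point z one returns to any z0 on |z| = r with |z - z0| at most
    40 r/K. The three factors of f cost, respectively, sum ln(1 + D/|z0 - a|) over
    the zeros, a similar weighted sum over the poles, and, by the Harnack
    inequality for the harmonic function ln |G|, a term of order 1/K
    (ln_recip_le). The means over z0 of these terms are O(K^(-1/2)) times the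
    number of zeros and poles involved (cmean_ln1D), and these numbers are O(N)
    by the Jensen formula and the maximum principle (controlled_factorization).
    Finally ln r = o(N(r,f)), there being infinitely many poles
    (integrated_count_log), and K is arbitrary: this is proximity_recip_small.

    Holomorphic functions enter as uniform limits of polynomials on closed discs
    (poly_approx), and harmonic functions as uniform limits of real parts of
    polynomials (re_approx). The maximum principle, the Harnack inequality and
    the mean value property are proved for polynomials, by averaging over roots
    of unity, and pass to the limit. *)

(** * Modulus, unit circle and roots of unity *)

Section Modulus.
Variable R : realType.
Implicit Types (x y z w : R[i]) (a b : R).

Lemma nm_ge0 z : 0 <= normc z.
Proof. by case: z => a b; rewrite /normc sqrtr_ge0. Qed.

Lemma nm_eq0 z : (normc z == 0) = (z == 0).
Proof.
by apply/idP/eqP => [/eqP/eq0_normc//|->]; rewrite normc0.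
Qed.

Lemma nm_gt0 z : (0 < normc z) = (z != 0).
Proof. by rewrite lt_def nm_eq0 nm_ge0 andbT. Qed.

Lemma nmB z w : normc (z - w) = normc (w - z).
Proof. by rewrite -normcN opprB. Qed.

Lemma nm_leB z w : normc z - normc w <= normc (z - w).
Proof. by rewrite lerBlDr; apply: le_trans (le_normcD _ _); rewrite subrK. Qed.

Lemma nm_leB2 z w : normc (z - w) <= normc z + normc w.
Proof. by rewrite -(normcN w); exact: le_normcD. Qed.

Lemma nm_dist z w : `|normc z - normc w| <= normc (z - w).
Proof. by rewrite ler_norml nm_leB andbT lerNl opprB nmB nm_leB. Qed.

Lemma nmX z n : normc (z ^+ n) = normc z ^+ n.
Proof. by elim: n => [|n IH]; rewrite ?expr0 ?normc1// !exprS normcM IH. Qed.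

Lemma nm_div z w : normc (z / w) = normc z / normc w.
Proof. by rewrite normcM normcV. Qed.

Lemma nm_real a : normc a%:C = `|a|.
Proof. by rewrite /normc /= expr0n /= addr0 sqrtr_sqr. Qed.

Lemma nm_nat n : normc n%:R = n%:R :> R.
Proof. by rewrite -[n%:R](rmorph_nat (real_complex R)) nm_real ger0_norm. Qed.

Lemma nm_sum I (r : seq I) (P : pred I) (F : I -> R[i]) :
  normc (\sum_(i <- r | P i) F i) <= \sum_(i <- r | P i) normc (F i).
Proof.
elim/big_rec2: _ => [|i y x _ IH]; first by rewrite normc0.
by apply: le_trans (le_normcD _ _) _; rewrite lerD2l.
Qed.

Lemma nm_prod I (r : seq I) (P : pred I) (F : I -> R[i]) :
  normc (\prod_(i <- r | P i) F i) = \prod_(i <- r | P i) normc (F i).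
Proof.
by elim/big_rec2: _ => [|i y x _ IH]; rewrite ?normc1// normcM IH.
Qed.

Lemma nm_sqr z : normc z ^+ 2 = Rp z ^+ 2 + Ip z ^+ 2.
Proof. by case: z => a b /=; rewrite sqr_sqrtr// addr_ge0 ?sqr_ge0. Qed.

Lemma nm_conj z : normc (conjc z) = normc z.
Proof. by case: z => a b /=; rewrite sqrrN. Qed.

Lemma Re_le_nm z : `|Rp z| <= normc z.
Proof.
by case: z => a b /=; rewrite -sqrtr_sqr ler_wsqrtr// lerDl sqr_ge0.
Qed.

Lemma Im_le_nm z : `|Ip z| <= normc z.
Proof.
by case: z => a b /=; rewrite -sqrtr_sqr ler_wsqrtr// lerDr sqr_ge0.
Qed.

Lemma nm_le_ReIm z : normc z <= `|Rp z| + `|Ip z|.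
Proof.
rewrite -[leRHS]ger0_norm ?addr_ge0// -sqrtr_sqr.
case: z => a b /=; apply: ler_wsqrtr.
by rewrite sqrrD !real_normK ?num_real// addrAC lerDl mulrn_wge0 ?mulr_ge0.
Qed.

Definition cis a : R[i] := cos a +i* sin a.

Lemma cis0 : cis 0 = 1.
Proof. by rewrite /cis cos0 sin0. Qed.

Lemma cisD a b : cis (a + b) = cis a * cis b.
Proof.
rewrite /cis cosD sinD; apply/eqP; rewrite eq_complex /= eqxx andTb.
by apply/eqP; ring.
Qed.

Lemma cisX a n : cis a ^+ n = cis (a * n%:R).
Proof.
elim: n => [|n IH]; first by rewrite mulr0 cis0 expr0.
by rewrite exprSr IH -cisD -[in RHS]natr1 mulrDr mulr1.
Qed.

Lemma nm_cis a : normc (cis a) = 1.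
Proof. by rewrite /= cos2Dsin2 sqrtr1. Qed.

Lemma cis_neq0 a : cis a != 0.
Proof. by rewrite -nm_gt0 nm_cis. Qed.

Lemma conj_cis a : conjc (cis a) = cis (- a).
Proof. by rewrite /cis cosN sinN. Qed.

Lemma polarE a t : (a * cos t +i* (a * sin t)) = a%:C * cis t.
Proof. by apply/eqP; rewrite eq_complex /= !mul0r subr0 addr0 !eqxx. Qed.

Lemma nm_cisB1 a : normc (cis a - 1) = 2 * `|sin (a / 2)|.
Proof.
apply/eqP; rewrite -(@eqrXn2 _ 2) ?nm_ge0 ?mulr_ge0// nm_sqr /= exprMn.
rewrite real_normK ?num_real//; apply/eqP.
have -> : a = (a / 2) *+ 2 by rewrite mulr2n; field.
have -> : a / 2 *+ 2 / 2 = a / 2 by rewrite mulr2n; field.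
rewrite sin_mulr2n cos_mulr2n oppr0 addr0 !mulr2n.
have := cos2Dsin2 (a / 2); move: (cos _) (sin _) => u v h.
have hu : u ^+ 2 = 1 - v ^+ 2 by rewrite -h addrK.
transitivity (4 * (u ^+ 2 - 1) ^+ 2 + 4 * u ^+ 2 * v ^+ 2); first by ring.
by rewrite hu; ring.
Qed.

Lemma sin_le_id a : 0 <= a -> sin a <= a.
Proof.
rewrite le_eqVlt => /orP[/eqP<-|a0]; first by rewrite sin0.
have dS (x : R) : x \in `]0, a[%R -> is_derive x 1 sin (cos x) by move=> _; exact: is_derive_sin.
have cS : {within `[0, a], continuous (@sin R)}.
  by apply: continuous_subspaceT => x; exact: continuous_sin.
have [c _] := MVT a0 dS cS.
rewrite sin0 !subr0 => ->.
by rewrite ler_piMl ?cos_le1// ltW.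
Qed.

Lemma nm_cisB1_le a : 0 <= a -> normc (cis a - 1) <= a.
Proof.
move=> a0; rewrite nm_cisB1.
have b0 : 0 <= a / 2 by rewrite divr_ge0.
suff h : `|sin (a / 2)| <= a / 2 by lra.
rewrite ler_norml sin_le_id// andbT.
have [api|] := leP (a / 2) pi.
  by apply: le_trans (sin_ge0_pi _); rewrite ?b0// lerNl oppr0.
by move=> h; have := pi_ge2 R; have := sin_geN1 (a / 2); lra.
Qed.
End Modulus.

Section RootsOfUnity.
Variable R : realType.
Implicit Types (p L : {poly R[i]}) (z w : R[i]) (r M : R).

Definition unity (Q : nat) : R[i] := cis (2 * pi / Q%:R).

Lemma unityX Q n : unity Q ^+ n = cis (2 * pi / Q%:R * n%:R).
Proof. exact: cisX. Qed.

Lemma unity_prim Q : (0 < Q)%N -> Q.-primitive_root (unity Q).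
Proof.
move=> Q0; have Qr : Q%:R != 0 :> R by rewrite pnatr_eq0 -lt0n.
rewrite /primitive_root_of_unity Q0; apply/forallP => i.
rewrite unity_rootE unityX; apply/eqP.
case: (eqVneq i.+1 Q) => [->|iQ].
  apply/eqP; rewrite divfK// /cis (_ : 2 * pi = pi *+ 2); last by rewrite -[RHS]mulr_natl.
  by rewrite cos2pi sin2pi.
apply/negbTE; rewrite -subr_eq0 -nm_gt0 nm_cisB1 mulr_gt0// normr_gt0.
rewrite gt_eqF// sin_gt0_pi//.
have iltQ : (i.+1 < Q)%N by rewrite ltn_neqAle iQ ltn_ord.
have -> : 2 * pi / Q%:R * i.+1%:R / 2 = pi * (i.+1%:R / Q%:R) :> R by field.
have p0 := pi_gt0 R.
rewrite mulr_gt0 ?divr_gt0 ?ltr0n//= gtr_pMr// ltr_pdivrMr ?ltr0n//.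
by rewrite mul1r ltr_nat.
Qed.

Lemma nm_unity Q : normc (unity Q) = 1.
Proof. exact: nm_cis. Qed.

Lemma unity_sum Q k : (0 < Q)%N ->
  \sum_(j < Q) (unity Q ^+ j) ^+ k = if (Q %| k)%N then Q%:R else 0.
Proof.
move=> Q0; have pw := unity_prim Q0.
under eq_bigr do rewrite -exprM mulnC exprM.
rewrite (prim_order_dvd pw); case: eqP => [->|/eqP w1].
  under eq_bigr do rewrite expr1n.
  by rewrite sumr_const card_ord.
have h := subrX1 (unity Q ^+ k) Q.
have e1 : unity Q ^+ k ^+ Q = 1 by rewrite -exprM mulnC exprM (prim_expr_order pw) expr1n.
move: h; rewrite e1 subrr => /esym/eqP.
by rewrite mulf_eq0 subr_eq0 (negbTE w1) => /eqP.
Qed.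

(** Only the k-th coefficient survives when a polynomial is averaged over the
    Q-th roots of unity against the (Q - k)-th power. *)
Lemma unity_coef Q p k z : (size p <= Q)%N -> (k < Q)%N ->
  \sum_(j < Q) p.[z * unity Q ^+ j] * (unity Q ^+ j) ^+ (Q - k)
    = Q%:R * (p`_k * z ^+ k).
Proof.
move=> sp kQ; have Q0 : (0 < Q)%N by apply: leq_ltn_trans kQ.
have E j : p.[z * unity Q ^+ j] * (unity Q ^+ j) ^+ (Q - k) =
    \sum_(i < Q) p`_i * z ^+ i * (unity Q ^+ j) ^+ (i + (Q - k)).
  rewrite (horner_coef_wide _ sp) mulr_suml; apply: eq_bigr => i _.
  by rewrite exprMn exprD; ring.
under eq_bigr do rewrite E.
rewrite exchange_big /= (bigD1 (Ordinal kQ)) //= [X in _ + X]big1 ?addr0 => [|i iQ].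
  by rewrite -mulr_sumr unity_sum// subnKC ?(ltnW kQ)// dvdnn mulrC.
rewrite -mulr_sumr unity_sum// ifF ?mulr0//.
apply/negbTE/negP => /dvdnP[c hc].
have ik : nat_of_ord i != k by apply: contraNneq iQ => h; apply/eqP/val_inj.
have iQ' := ltn_ord i; case: c hc => [|[|c]] hc; move: hc ik; nia.
Qed.

(** Conjugation turns the power i of a root of unity into the power -i, and
    -i - k is not divisible by Q, as 0 < i + k < Q. *)
Lemma unity_coef_conj Q p k z : ((size p).*2 <= Q)%N ->
  (0 < k)%N -> (k.*2 < Q)%N ->
  \sum_(j < Q) conjc p.[z * unity Q ^+ j] * (unity Q ^+ j) ^+ (Q - k) = 0.
Proof.
move=> sp k0 kQ; have Q0 : (0 < Q)%N by apply: leq_ltn_trans kQ.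
have cu j : conjc (unity Q ^+ j) = unity Q ^+ j ^+ Q.-1.
  have e : unity Q ^+ j * unity Q ^+ j ^+ Q.-1 = 1.
    by rewrite -exprS prednK// -exprM mulnC exprM (prim_expr_order (unity_prim Q0)) expr1n.
  have e' : unity Q ^+ j * conjc (unity Q ^+ j) = 1.
    by rewrite unityX [X in _ * X](conj_cis (2 * pi / Q%:R * j%:R)) -cisD subrr cis0.
  have u0 : unity Q ^+ j != 0 by rewrite expf_neq0// cis_neq0.
  by apply: (mulfI u0); rewrite e e'.
have E j : conjc p.[z * unity Q ^+ j] * (unity Q ^+ j) ^+ (Q - k) =
    \sum_(i < size p) conjc (p`_i * z ^+ i) * (unity Q ^+ j) ^+ (Q.-1 * i + (Q - k)).
  rewrite horner_coef rmorph_sum mulr_suml; apply: eq_bigr => i _.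
  rewrite -[LHS]/(conjc (p`_i * (z * unity Q ^+ j) ^+ i) * _).
  have cu' : conjc (unity Q) ^+ j = unity Q ^+ j ^+ Q.-1 by rewrite -cu rmorphXn.
  by rewrite !(rmorphM, rmorphXn) /= cu' [in LHS]exprMn exprD exprM; ring.
under eq_bigr do rewrite E.
rewrite exchange_big /= big1// => i _; rewrite -mulr_sumr unity_sum// ifF ?mulr0//.
apply/negbTE/negP => /dvdnP[c hc].
have ip := ltn_ord i.
have h : (Q * i + Q = c * Q + (i + k))%N by move: hc; case: (Q) Q0 kQ => //= q; nia.
have h2 : (Q %| i + k)%N.
  by rewrite -(@dvdn_addr (c * Q) Q) ?dvdn_mull// -h dvdn_add// dvdn_mulr.
have := dvdn_leq _ h2; rewrite addn_gt0 k0 orbT => /(_ isT).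
have ip2 : (i.*2 < Q)%N by apply: leq_trans sp; rewrite ltn_double.
by rewrite leqNgt -ltn_double doubleD -[Q.*2]addnn -addSn leq_add// ltnW.
Qed.

Lemma Cauchy_estimate p r M k : 0 <= r ->
  (forall z, normc z = r -> normc p.[z] <= M) -> normc p`_k * r ^+ k <= M.
Proof.
move=> r0 hM; set Q := (maxn (size p) k.+1).
have kQ : (k < Q)%N by rewrite leq_max ltnSn orbT.
have Q0 : (0 < Q)%N by apply: leq_ltn_trans kQ.
have := @unity_coef Q p k r%:C (leq_maxl _ _) kQ.
move/(congr1 (@normc R)); rewrite normcM nm_nat normcM nmX nm_real ger0_norm// => h.
rewrite -(@ler_pM2l _ Q%:R) ?ltr0n// -h.
apply: le_trans (nm_sum _ _ _) _.
rewrite mulr_natl -[Q in M *+ Q]card_ord -sumr_const; apply: ler_sum => j _.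
rewrite normcM !nmX nm_unity !expr1n mulr1 hM//.
by rewrite normcM nmX nm_unity expr1n mulr1 nm_real ger0_norm.
Qed.

(** If x exceeded M, the quotient (x / M)^n would grow at least quadratically in n. *)
Lemma bounded_powers (x M d : R) : 0 <= x -> 0 < M ->
  (forall n : nat, x ^+ n <= M ^+ n * (n%:R * d + 1)) -> x <= M.
Proof.
move=> x0 M0 h; rewrite leNgt; apply/negP => Mx.
pose e := x / M - 1.
have e0 : 0 < e by rewrite subr_gt0 ltr_pdivlMr// mul1r.
have hn n : (1 + e) ^+ n <= n%:R * d + 1.
  by rewrite /e addrC subrK expr_div_n ler_pdivrMr ?exprn_gt0// mulrC.
have quad n : 1 + n%:R * e + (n * n.-1)%:R / 2 * e ^+ 2 <= (1 + e) ^+ n.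
  elim: n => [|n IH]; first by rewrite !mul0r !addr0 expr0.
  rewrite [leRHS]exprS; apply: le_trans (_ : (1 + e) * (1 + n%:R * e + (n * n.-1)%:R / 2 * e ^+ 2) <= _); last first.
    by rewrite ler_wpM2l// addr_ge0// ltW.
  have -> : (n.+1 * n.+1.-1)%:R = (n * n.-1)%:R + 2 * n%:R :> R.
    by rewrite -natrM -natrD; congr _%:R; case: (n) => //=; nia.
  have : 0 <= (n * n.-1)%:R * e ^+ 3 :> R by rewrite mulr_ge0 ?ler0n ?exprn_ge0 ?ltW.
  by rewrite -(natr1 n); nra.
have [n hn1] : exists n : nat, 2 * `|d| / e ^+ 2 + 1 < n%:R :> R.
  have d0 : 0 <= 2 * `|d| / e ^+ 2 + 1.
    by rewrite addr_ge0 ?mulr_ge0 ?invr_ge0 ?exprn_ge0 ?normr_ge0 ?(ltW e0).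
  by exists (Num.bound (2 * `|d| / e ^+ 2 + 1)); exact: archi_boundP.
have n0 : (0 < n)%N.
  rewrite -(@ltr0n R); apply: lt_trans hn1; apply: ltr_pwDr => //.
  by rewrite mulr_ge0 ?invr_ge0 ?exprn_ge0 ?mulr_ge0 ?normr_ge0 ?(ltW e0).
have := le_trans (quad n) (hn n).
have -> : (n * n.-1)%:R = n%:R * (n%:R - 1) :> R.
  by rewrite natrM -subn1 natrB.
have h3 : 2 * `|d| < (n%:R - 1) * e ^+ 2.
  by move: hn1; rewrite -ltrBrDr ltr_pdivrMr ?exprn_gt0.
have h4 := ler_norm d.
have n0' : 0 < n%:R :> R by rewrite ltr0n.
have : n%:R * d < n%:R * ((n%:R - 1) * e ^+ 2 / 2) by rewrite ltr_pM2l//; lra.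
have := mulr_gt0 n0' e0.
by nra.
Qed.

(** The Cauchy estimate bounds p up to the factor 1 + deg p; applied to all the
    powers of p, it loses this factor. *)
Lemma max_principle p r M z : (forall w, normc w = r -> normc p.[w] <= M) ->
  normc z <= r -> normc p.[z] <= M.
Proof.
move=> hM zr; have r0 : 0 <= r by apply: le_trans zr; exact: nm_ge0.
have M0 : 0 <= M.
  by apply: le_trans (hM r%:C _); rewrite ?nm_ge0// nm_real ger0_norm.
apply/ler_addgt0Pr => e e0; apply: (@bounded_powers _ _ (size p).-1%:R).
- exact: nm_ge0.
- by rewrite ltr_wpDl.
move=> n; rewrite -nmX -horner_exp.
have hMe w : normc w = r -> normc (p ^+ n).[w] <= (M + e) ^+ n.
  move=> /hM wM; rewrite horner_exp nmX lerXn2r ?nnegrE ?nm_ge0//.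
    by rewrite addr_ge0// ltW.
  by apply: le_trans wM _; rewrite lerDl ltW.
have hc k := Cauchy_estimate k r0 hMe.
rewrite horner_coef; apply: le_trans (nm_sum _ _ _) _.
apply: le_trans (_ : \sum_(i < size (p ^+ n)) (M + e) ^+ n <= _).
  apply: ler_sum => i _; rewrite normcM nmX; apply: le_trans (hc i).
  by rewrite ler_wpM2l ?nm_ge0// lerXn2r ?nnegrE ?nm_ge0.
rewrite sumr_const card_ord -[leLHS]mulr_natr; apply: ler_wpM2l.
  by rewrite exprn_ge0// addr_ge0// ltW.
rewrite -natrM natr1 ler_nat.
by apply: leq_trans (size_poly_exp_leq _ _) _; rewrite mulnC.
Qed.
End RootsOfUnity.

Section Harnack.
Variable R : realType.
Implicit Types (L : {poly R[i]}) (z w : R[i]) (r M : R).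

(** Averaging M - Re L, which is nonnegative on the circle, against a root of
    unity isolates one coefficient of L; the average with weight 1 is the value
    at the centre. *)
Lemma Caratheodory L r M k : 0 <= r -> (0 < k)%N ->
  (forall z, normc z = r -> Rp L.[z] <= M) ->
  normc L`_k * r ^+ k <= 2 * (M - Rp L`_0).
Proof.
move=> r0 k0 hM; set Q := (maxn (size L) k.+1).*2.
have kQ : (k.*2 < Q)%N by rewrite /Q -!muln2 ltn_pmul2r// leq_max ltnSn orbT.
have sQ : ((size L).*2 <= Q)%N by rewrite /Q -!muln2 leq_pmul2r// leq_maxl.
have Q0 : (0 < Q)%N by apply: leq_ltn_trans kQ.
have kQ' : (k < Q)%N by apply: leq_ltn_trans kQ; rewrite -addnn leq_addr.
have sQ' : (size L <= Q)%N by apply: leq_trans sQ; rewrite -addnn leq_addr.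
pose zj (j : 'I_Q) := r%:C * unity R Q ^+ j.
have nz j : normc (zj j) = r.
  by rewrite normcM nmX nm_unity expr1n mulr1 nm_real ger0_norm.
pose u (j : 'I_Q) := M - Rp L.[zj j].
have u0 j : 0 <= u j by rewrite subr_ge0 hM.
(* 2 u = 2 M - L - conj L, and only the term in L contributes to the k-th
   coefficient. *)
have Eu j : 2 * (u j)%:C = 2 * M%:C - (L.[zj j] + conjc L.[zj j]).
  by rewrite addcJ /u rmorphB /=; ring.
have E0 : \sum_j (u j)%:C = (Q%:R * (M - Rp L`_0))%:C.
  have h := @unity_coef R Q L 0 r%:C sQ' Q0.
  move: h; rewrite expr0 mulr1.
  under eq_bigr do rewrite subn0 -exprM mulnC exprM (prim_expr_order (unity_prim R Q0)) expr1n mulr1.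
  move=> h; rewrite -(rmorph_sum (real_complex R)) /=; congr (_%:C).
  rewrite sumrB sumr_const card_ord mulrBr mulr_natl; congr (_ - _).
  have /(congr1 (@complex.Re R)) := h.
  rewrite (raddf_sum (@complex.Re R)) => ->.
  by rewrite -(rmorph_nat (real_complex R)); case: (L`_0) => a b /=; rewrite mul0r subr0.
have Ek : \sum_j (u j)%:C * (unity R Q ^+ j) ^+ (Q - k) = - (Q%:R * (L`_k * r%:C ^+ k)) / 2.
  have h := @unity_coef R Q L k r%:C sQ' kQ'.
  have h' := @unity_coef_conj R Q L k r%:C sQ k0 kQ.
  have s0 : \sum_(j < Q) (unity R Q ^+ j) ^+ (Q - k) = 0.
    rewrite unity_sum// ifF//; apply/negbTE/negP => /dvdn_leq.
    by rewrite subn_gt0 kQ' => /(_ isT); move: k0 kQ'; lia.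
  have n2 : 2 != 0 :> R[i] by rewrite pnatr_eq0.
  apply: (mulfI n2); rewrite mulr_sumr.
  transitivity (\sum_(j < Q) (2 * M%:C * (unity R Q ^+ j) ^+ (Q - k)
    - (L.[zj j] * (unity R Q ^+ j) ^+ (Q - k)
       + conjc L.[zj j] * (unity R Q ^+ j) ^+ (Q - k)))).
    by apply: eq_bigr => j _; rewrite mulrA Eu; ring.
  rewrite sumrB -mulr_sumr s0 mulr0 big_split /= h h' addr0 sub0r.
  by field.
have nE : \sum_j u j = Q%:R * (M - Rp L`_0).
  by apply: (@complexI R); rewrite (rmorph_sum (real_complex R)).
have : normc (\sum_j (u j)%:C * (unity R Q ^+ j) ^+ (Q - k)) <= \sum_j u j.
  apply: le_trans (nm_sum _ _ _) _; apply: ler_sum => j _.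
  by rewrite normcM !nmX nm_unity !expr1n mulr1 nm_real ger0_norm.
rewrite Ek nE nm_div normcN !normcM nmX nm_real (ger0_norm r0) !nm_nat.
rewrite -mulrA ler_pM2l ?ltr0n//.
by rewrite ler_pdivrMr ?ltr0n// [leRHS]mulrC.
Qed.

Lemma nm_subX z w (b : R) k : normc z <= b -> normc w <= b ->
  normc (z ^+ k.+1 - w ^+ k.+1) <= k.+1%:R * b ^+ k * normc (z - w).
Proof.
move=> zb wb; have b0 : 0 <= b by apply: le_trans zb; exact: nm_ge0.
rewrite subrXX normcM mulrC ler_wpM2r ?nm_ge0//.
apply: le_trans (nm_sum _ _ _) _.
apply: le_trans (_ : \sum_(i < k.+1) b ^+ k <= _); last first.
  by rewrite sumr_const card_ord mulr_natl.
apply: ler_sum => i _; rewrite normcM !nmX /=.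
rewrite -[in leRHS](subnK (leq_ord i)) exprD.
by rewrite ler_pM ?exprn_ge0 ?nm_ge0// lerXn2r ?nnegrE ?nm_ge0.
Qed.

Lemma sum_half_weights n : \sum_(k < n) k.+1%:R * (2^-1) ^+ k <= 4 :> R.
Proof.
suff h : \sum_(k < n) k.+1%:R * (2^-1) ^+ k + (2 * n%:R + 4) * (2^-1) ^+ n = 4 :> R.
  rewrite -[leRHS]h lerDl mulr_ge0//.
elim: n => [|n IH]; first by rewrite big_ord0 expr0; ring.
by rewrite big_ord_recr /= -[RHS]IH exprS -natr1; field.
Qed.

(** On the disc of half the radius the increments of the powers are summable
    against the coefficient bounds, with total weight at most 4. *)
Lemma Harnack_poly L r M z w : 0 < r ->
  (forall v, normc v = r -> Rp L.[v] <= M) ->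
  normc z <= r / 2 -> normc w <= r / 2 ->
  `|Rp L.[z] - Rp L.[w]| <= 8 * (M - Rp L.[0]) * normc (z - w) / r.
Proof.
move=> r0 hM zr wr; set U := M - _.
have -> : Rp L.[z] - Rp L.[w] = Rp (L.[z] - L.[w]) by case: (L.[z]) (L.[w]) => ? ? [].
apply: le_trans (Re_le_nm _) _.
case E : (size L) => [|n].
  have L0 : L = 0 by apply/eqP; rewrite -size_poly_eq0 E.
  rewrite /U; rewrite L0 in hM *.
  rewrite !horner0 subrr normc0; rewrite !mulr_ge0 ?invr_ge0 ?nm_ge0// ?(ltW r0)//.
  by rewrite subr_ge0; have := hM r%:C; rewrite horner0; apply; rewrite nm_real gtr0_norm.
rewrite !horner_coef E -sumrB big_ord_recl /= !expr0 subrr add0r.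
apply: le_trans (nm_sum _ _ _) _.
have hU : Rp L`_0 = Rp L.[0] by rewrite horner_coef0.
apply: le_trans (_ : \sum_(k < n) 2 * U * normc (z - w) / r * (k.+1%:R * (2^-1) ^+ k) <= _).
  apply: ler_sum => k _; rewrite -mulrBr normcM.
  have h1 := Caratheodory (ltW r0) (ltn0Sn k) hM; rewrite hU -/U in h1.
  have h2 := nm_subX k zr wr.
  apply: le_trans (_ : normc L`_k.+1 * (k.+1%:R * (r / 2) ^+ k * normc (z - w)) <= _).
    by rewrite ler_wpM2l ?nm_ge0// /bump /= add1n.
  have -> : normc L`_k.+1 * (k.+1%:R * (r / 2) ^+ k * normc (z - w)) =
     (normc L`_k.+1 * r ^+ k.+1) * (normc (z - w) / r * (k.+1%:R * (2^-1) ^+ k)).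
    by rewrite exprMn exprS; field; rewrite gt_eqF.
  apply: le_trans (ler_wpM2r _ h1) _; last by rewrite le_eqVlt; apply/orP; left; apply/eqP; ring.
  by rewrite !mulr_ge0 ?invr_ge0 ?exprn_ge0 ?nm_ge0 ?ltW.
rewrite -mulr_sumr.
have U0 : 0 <= U.
  have := Caratheodory (ltW r0) (ltn0Sn 0) hM; rewrite hU -/U.
  by have := mulr_ge0 (nm_ge0 L`_1) (exprn_ge0 1 (ltW r0)); lra.
apply: le_trans (ler_wpM2l _ (sum_half_weights n)) _.
  by rewrite !mulr_ge0 ?invr_ge0 ?nm_ge0 ?(ltW r0).
by rewrite le_eqVlt; apply/orP; left; apply/eqP; ring.
Qed.
End Harnack.

(** * Uniform limits of polynomials on a disc *)

Section Approx.
Variable R : realType.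
Implicit Types (p q : {poly R[i]}) (G H : R[i] -> R[i]) (z w t : R[i]) (r e : R).

Lemma nm_cauchy (u : nat -> R[i]) :
  (forall e, 0 < e -> exists N, forall n m, (N <= n)%N -> (N <= m)%N ->
     normc (u n - u m) <= e) ->
  exists l, forall e, 0 < e -> exists N, forall n, (N <= n)%N -> normc (u n - l) <= e.
Proof.
move=> hu.
have real_case (v : nat -> R) :
    (forall e, 0 < e -> exists N, forall n m, (N <= n)%N -> (N <= m)%N -> `|v n - v m| <= e) ->
    exists l, forall e, 0 < e -> exists N, forall n, (N <= n)%N -> `|v n - l| <= e.
  move=> hv; have cv : cvgn v.
    apply/cauchy_cvgP/cauchy_exP => e e0.
    have e2 : 0 < e / 2 by rewrite divr_gt0.
    have [N hN] := hv _ e2.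
    exists (v N); exists N => // n hn; apply: le_lt_trans (hN _ _ (leqnn _) hn) _.
    by rewrite ltr_pdivrMr// ltr_pMr// ltr1n.
  exists (limn v) => e e0; have /cvgrPdist_le/(_ e e0) [N _ hN] := cv.
  by exists N => n /hN; rewrite distrC.
have [e e0|a ha] := real_case (fun n => Rp (u n)).
  have [N hN] := hu e e0; exists N => n m hn hm; apply: le_trans (hN _ _ hn hm).
  by rewrite -raddfB; exact: Re_le_nm.
have [e e0|b hb] := real_case (fun n => Ip (u n)).
  have [N hN] := hu e e0; exists N => n m hn hm; apply: le_trans (hN _ _ hn hm).
  by rewrite -raddfB; exact: Im_le_nm.
exists (a +i* b) => e e0.
have e2 : 0 < e / 2 by rewrite divr_gt0.
have [N hN] := ha _ e2; have [N' hN'] := hb _ e2.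
exists (maxn N N') => n; rewrite geq_max => /andP[/hN h1 /hN' h2].
apply: le_trans (nm_le_ReIm _) _; rewrite [e]splitr.
by move: h1 h2; case: (u n) => x y /= h1 h2; rewrite lerD.
Qed.

(** Uniform limits of polynomials on a closed disc: on the open disc these are
    exactly the holomorphic functions that extend continuously to the circle,
    and the maximum principle for polynomials is all that is used of them. *)
Definition poly_approx r G := forall e, 0 < e ->
  exists p, forall z, normc z <= r -> normc (p.[z] - G z) <= e.

Lemma poly_approx_horner r p : poly_approx r (horner p).
Proof. by move=> e e0; exists p => z _; rewrite subrr normc0 ltW. Qed.

Lemma eq_poly_approx r G H : (forall z, normc z <= r -> G z = H z) ->
  poly_approx r G -> poly_approx r H.
Proof.
by move=> GH hG e /hG[p hp]; exists p => z zr; rewrite -GH// hp.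
Qed.

Lemma poly_approx_cst r (c : R[i]) : poly_approx r (fun=> c).
Proof.
by apply: eq_poly_approx (poly_approx_horner r c%:P) => z _; rewrite hornerC.
Qed.

Lemma poly_bounded r p : exists2 M, 0 < M & forall z, normc z <= r -> normc p.[z] <= M.
Proof.
exists (\sum_(i < size p) normc p`_i * `|r| ^+ i + 1).
  by rewrite ltr_wpDl// sumr_ge0// => i _; rewrite mulr_ge0 ?nm_ge0// exprn_ge0.
move=> z zr; rewrite horner_coef; apply: le_trans (nm_sum _ _ _) _.
rewrite -[leLHS]addr0 lerD//; apply: ler_sum => i _.
rewrite normcM nmX ler_wpM2l ?nm_ge0// lerXn2r ?nnegrE ?nm_ge0//.
by apply: le_trans zr _; exact: ler_norm.
Qed.

Lemma poly_approx_bounded r G : poly_approx r G ->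
  exists2 M, 0 < M & forall z, normc z <= r -> normc (G z) <= M.
Proof.
move=> /(_ 1 ltr01)[p hp]; have [M M0 hM] := poly_bounded r p.
exists (M + 1); first by rewrite addr_gt0.
move=> z zr; have -> : G z = p.[z] - (p.[z] - G z) by rewrite subKr.
by apply: le_trans (nm_leB2 _ _) _; rewrite lerD ?hM ?hp.
Qed.

Lemma poly_approxD r G H : poly_approx r G -> poly_approx r H ->
  poly_approx r (fun z => G z + H z).
Proof.
move=> hG hH e e0; have e2 : 0 < e / 2 by rewrite divr_gt0.
have [p hp] := hG _ e2; have [q hq] := hH _ e2.
exists (p + q) => z zr; rewrite hornerD opprD addrACA.
by apply: le_trans (le_normcD _ _) _; rewrite [e]splitr lerD ?hp ?hq.
Qed.

Lemma poly_approxM r G H : poly_approx r G -> poly_approx r H ->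
  poly_approx r (fun z => G z * H z).
Proof.
move=> hG hH e e0; have [M M0 hM] := poly_approx_bounded hH.
have e1 : 0 < e / (2 * M) by rewrite divr_gt0// mulr_gt0.
have [p hp] := hG _ e1; have [M' M'0 hM'] := poly_bounded r p.
have e2 : 0 < e / (2 * M') by rewrite divr_gt0// mulr_gt0.
have [q hq] := hH _ e2.
exists (p * q) => z zr; rewrite hornerM.
have -> : p.[z] * q.[z] - G z * H z = p.[z] * (q.[z] - H z) + (p.[z] - G z) * H z.
  by ring.
apply: le_trans (le_normcD _ _) _; rewrite !normcM.
have -> : e = M' * (e / (2 * M')) + e / (2 * M) * M.
  by field; rewrite !gt_eqF.
by rewrite lerD// ler_pM ?nm_ge0// ?hM' ?hq ?hp ?hM.
Qed.

Lemma poly_approx_sum r (I : Type) (s : seq I) (F : I -> R[i] -> R[i]) :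
  (forall i, poly_approx r (F i)) -> poly_approx r (fun z => \sum_(i <- s) F i z).
Proof.
move=> hF; elim: s => [|i s IH].
  by apply: eq_poly_approx (poly_approx_cst r 0) => z _; rewrite big_nil.
by apply: eq_poly_approx (poly_approxD (hF i) IH) => z _; rewrite big_cons.
Qed.

Lemma poly_approx_lim r G : (forall e, 0 < e -> exists2 H, poly_approx r H &
    forall z, normc z <= r -> normc (H z - G z) <= e) -> poly_approx r G.
Proof.
move=> h e e0; have e2 : 0 < e / 2 by rewrite divr_gt0.
have [H hH HG] := h _ e2; have [p hp] := hH _ e2.
exists p => z zr; rewrite -[p.[z]](subrK (H z)) -addrA.
by apply: le_trans (le_normcD _ _) _; rewrite [e]splitr lerD ?hp ?HG.
Qed.

Lemma small_power (x e : R) : 0 <= x < 1 -> 0 < e -> exists n, x ^+ n <= e.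
Proof.
move=> /andP[x0 x1] e0.
have /cvgrPdist_le/(_ e e0)[N _ hN] : x ^+ n @[n --> \oo] --> 0.
  by apply: cvg_expr; rewrite ger0_norm.
exists N; have := hN N (leqnn _); rewrite sub0r normrN; apply: le_trans; exact: ler_norm.
Qed.

(** Partial sums of the geometric series in z / t. *)
Lemma poly_approx_inv r t : r < normc t -> poly_approx r (fun z => (z - t)^-1).
Proof.
move=> rt e e0.
have [r0|r0] := ltP r 0.
  by exists 0 => z zr; have := nm_ge0 z; rewrite leNgt (le_lt_trans zr r0).
have t0 : t != 0 by rewrite -nm_gt0 (le_lt_trans r0).
have t0' : 0 < normc t by rewrite nm_gt0.
have q1 : 0 <= r / normc t < 1.
  by rewrite divr_ge0 ?nm_ge0//= ltr_pdivrMr// mul1r.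
have d0 : 0 < normc t - r by rewrite subr_gt0.
have [n hn] := small_power q1 (mulr_gt0 e0 d0).
exists (\poly_(k < n) (- t ^- k.+1)) => z zr.
have zt : z - t != 0.
  by rewrite subr_eq0; apply: contraTneq rt => <-; rewrite -leNgt.
rewrite horner_poly.
have -> : \sum_(k < n) - t ^- k.+1 * z ^+ k - (z - t)^-1 = - (z / t) ^+ n / (z - t).
  have h := subrX1 (z / t) n.
  have -> : \sum_(k < n) - t ^- k.+1 * z ^+ k = - t^-1 * \sum_(k < n) (z / t) ^+ k.
    rewrite mulr_sumr; apply: eq_bigr => k _.
    by rewrite exprMn exprSr exprVn invfM; ring.
  apply: (mulIf zt); rewrite mulrBl mulVf// divfK//.
  have -> : - t^-1 * (\sum_(k < n) (z / t) ^+ k) * (z - t) =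
     - ((z / t - 1) * \sum_(k < n) (z / t) ^+ k) by field.
  by rewrite -h; ring.
rewrite nm_div normcN nmX nm_div ler_pdivrMr; last by rewrite nm_gt0.
have h1 : normc t - r <= normc (z - t).
  by rewrite nmB; apply: le_trans (nm_leB _ _); rewrite lerB.
apply: le_trans (ler_wpM2l (ltW e0) h1); apply: le_trans hn.
by rewrite lerXn2r ?nnegrE ?divr_ge0 ?nm_ge0// ler_wpM2r ?invr_ge0 ?nm_ge0.
Qed.

Lemma poly_approx_max r G M z : poly_approx r G ->
  (forall w, normc w = r -> normc (G w) <= M) -> normc z <= r -> normc (G z) <= M.
Proof.
move=> hG hM zr; apply/ler_addgt0Pr => e e0.
have e2 : 0 < e / 2 by rewrite divr_gt0.
have [p hp] := hG _ e2.
have h : normc p.[z] <= M + e / 2.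
  apply: (@max_principle R p r) => // w wr.
  rewrite -[p.[w]](subrK (G w)) addrC; apply: le_trans (le_normcD _ _) _.
  by rewrite lerD ?hM ?hp// wr.
have -> : G z = p.[z] - (p.[z] - G z) by rewrite subKr.
apply: le_trans (nm_leB2 _ _) _; apply: le_trans (lerD h (hp _ zr)) _.
by rewrite -addrA -splitr.
Qed.

(** A zero can be divided out. The quotients of the approximating polynomials
    converge uniformly on the circle, hence on the disc by the maximum
    principle. *)
Lemma poly_approx_div r G w : poly_approx r G -> normc w < r -> G w = 0 ->
  exists2 H, poly_approx r H & forall z, normc z <= r -> G z = (z - w) * H z.
Proof.
move=> hG wr Gw; have d0 : 0 < r - normc w by rewrite subr_gt0.
pose a (n : nat) : R := n.+1%:R^-1.
have a0 n : 0 < a n by rewrite invr_gt0 ltr0Sn.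
have ale e : 0 < e -> exists N, forall n, (N <= n)%N -> a n <= e.
  move=> e0; exists (Num.bound e^-1) => n hn.
  rewrite invf_ple ?posrE ?ltr0Sn//; apply: le_trans (ltW (archi_boundP _)) _.
    by rewrite invr_ge0 ltW.
  by rewrite ler_nat ltnW.
have /choice[p hp] : forall n, exists p, forall z, normc z <= r -> normc (p.[z] - G z) <= a n.
  by move=> n; exact: hG.
have /choice[q hq] : forall n, exists q, p n - (p n).[w]%:P = q * ('X - w%:P).
  move=> n; have /factor_theorem : root (p n - (p n).[w]%:P) w.
    by rewrite rootE hornerD hornerN hornerC subrr.
  by case=> q ->; exists q.
have pq n z : (p n).[z] - (p n).[w] = (q n).[z] * (z - w).
  have /(congr1 (horner^~ z)) := hq n.
  by rewrite hornerM hornerXsubC hornerD hornerN hornerC.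
have pz n z : normc z <= r -> normc ((p n).[z] - (p n).[w] - G z) <= 2 * a n.
  move=> zr; rewrite addrAC mulr2n mulrDl !mul1r; apply: le_trans (nm_leB2 _ _) _.
  by rewrite lerD ?hp//; have := hp n w (ltW wr); rewrite Gw subr0.
have qC n m z : normc z <= r -> normc ((q n).[z] - (q m).[z]) <= 2 * (a n + a m) / (r - normc w).
  move=> zr; rewrite -hornerN -hornerD.
  apply: (@max_principle R _ r) => // v vr; rewrite hornerD hornerN.
  rewrite ler_pdivlMr//.
  apply: le_trans (_ : normc ((q n).[v] - (q m).[v]) * normc (v - w) <= _).
    by rewrite ler_wpM2l ?nm_ge0// -vr nm_leB.
  rewrite -normcM mulrBl -!pq.
  have -> : (p n).[v] - (p n).[w] - ((p m).[v] - (p m).[w]) =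
    ((p n).[v] - (p n).[w] - G v) - ((p m).[v] - (p m).[w] - G v) by ring.
  by apply: le_trans (nm_leB2 _ _) _; rewrite mulrDr lerD// pz// vr.
have small e : 0 < e -> exists N, forall n m, (N <= n)%N -> (N <= m)%N ->
    2 * (a n + a m) / (r - normc w) <= e.
  move=> e0; have e4 : 0 < e * (r - normc w) / 4 by rewrite divr_gt0// mulr_gt0.
  have [N hN] := ale _ e4; exists N => n m /hN h1 /hN h2.
  by rewrite ler_pdivrMr//; lra.
have [l hl] : exists l, forall e, 0 < e -> exists N, forall n, (N <= n)%N -> normc ((q n).[w] - l) <= e.
  apply: nm_cauchy => e /small[N hN]; exists N => n m hn hm.
  by apply: le_trans (hN _ _ hn hm); apply: qC; exact: ltW.
pose H z := if z == w then l else G z / (z - w).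
have qH z : normc z <= r -> forall e, 0 < e -> exists N, forall n, (N <= n)%N -> normc ((q n).[z] - H z) <= e.
  rewrite /H; case: eqVneq => [-> _|zw zr e e0]; first exact: hl.
  have zw' : z - w != 0 by rewrite subr_eq0.
  have zw0 : 0 < normc (z - w) by rewrite nm_gt0.
  have e2 : 0 < e * normc (z - w) / 2 by rewrite divr_gt0// mulr_gt0.
  have [N hN] := ale _ e2; exists N => n /hN h.
  rewrite -(ler_pM2r zw0) -normcM mulrBl divfK// -pq.
  by apply: le_trans (pz _ _ zr) _; lra.
exists H => [e e0|z zr]; last first.
  by rewrite /H; case: eqVneq => [->|zw]; rewrite ?subrr ?mul0r// mulrC divfK// subr_eq0.
have e2 : 0 < e / 2 by rewrite divr_gt0.
have [N hN] := small _ e2; exists (q N) => z zr; apply/ler_addgt0Pr => d dd0.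
have [N' hN'] := qH z zr d dd0.
pose m := maxn N N'.
rewrite -[(q N).[z]](subrK (q m).[z]) -addrA; apply: le_trans (le_normcD _ _) _.
apply: lerD; last by rewrite hN'// leq_maxr.
apply: le_trans (qC _ _ _ zr) _; apply: le_trans (hN _ _ (leqnn _) (leq_maxl _ _)) _.
by rewrite ler_pdivrMr// ler_pMr// ler1n.
Qed.

Lemma poly_approxN r G (c : R[i]) : poly_approx r G -> poly_approx r (fun z => G z - c).
Proof. by move=> hG; apply: poly_approxD hG _; exact: poly_approx_cst. Qed.

(** Dividing G - G w by z - w leaves a bounded function. *)
Lemma poly_approx_lip r G w : poly_approx r G -> normc w < r ->
  exists2 K, 0 < K & forall z, normc z <= r -> normc (G z - G w) <= K * normc (z - w).
Proof.
move=> hG wr; have [H hH E] := poly_approx_div (poly_approxN (G w) hG) wr (subrr _).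
have [K K0 hK] := poly_approx_bounded hH.
by exists K => // z zr; rewrite E// normcM mulrC ler_wpM2r ?nm_ge0 ?hK.
Qed.
End Approx.

Section ZeroExtraction.
Variable R : realType.
Implicit Types (H G : R[i] -> R[i]) (Z : seq R[i]).

Lemma nm_prod_ge Z z (d : R) : 0 <= d -> (forall a, a \in Z -> d <= normc (z - a)) ->
  d ^+ size Z <= normc (\prod_(a <- Z) (z - a)).
Proof.
move=> d0; elim: Z => [|a Z IH] h; first by rewrite big_nil (@nm_nat R 1).
rewrite big_cons normcM exprS ler_pM ?exprn_ge0 ?h ?mem_head// IH// => b bZ.
by rewrite h// inE bZ orbT.
Qed.

Lemma nm_prod_le Z z (d : R) : (forall a, a \in Z -> normc (z - a) <= d) ->
  normc (\prod_(a <- Z) (z - a)) <= d ^+ size Z.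
Proof.
elim: Z => [|a Z IH] h; first by rewrite big_nil (@nm_nat R 1).
rewrite big_cons normcM exprS ler_pM ?nm_ge0 ?h ?mem_head// IH// => b bZ.
by rewrite h// inE bZ orbT.
Qed.

Lemma extract_zeros_step r0 r1 H m : r0 < r1 -> poly_approx r1 H ->
  exists Z G, [/\ forall a, a \in Z -> normc a <= r0 /\ H a = 0, poly_approx r1 G,
    forall z, normc z <= r1 -> H z = \prod_(a <- Z) (z - a) * G z &
    (forall z, normc z <= r0 -> G z != 0) \/ size Z = m].
Proof.
move=> r01 pH; elim: m => [|m [Z [G [hZ pG E [nz|sz]]]]].
- by exists [::], H; split=> //; [move=> z _; rewrite big_nil mul1r|right].
- by exists Z, G; split=> //; left.
have [[a [ar Ga]]|no] := pselect (exists a, normc a <= r0 /\ G a = 0); last first.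
  exists Z, G; split=> //; left => z zr; apply/negP => /eqP Gz.
  by apply: no; exists z.
have ar1 : normc a < r1 by apply: le_lt_trans r01.
have [G' pG' E'] := poly_approx_div pG ar1 Ga.
exists (a :: Z), G'; split=> //.
- move=> b; rewrite inE => /orP[/eqP ->|/hZ//]; split=> //.
  by rewrite E ?(ltW ar1)// Ga mulr0.
- by move=> z zr; rewrite big_cons E// E'//; ring.
- by right; rewrite /= sz.
Qed.

(** Only finitely many zeros can be extracted: by the maximum principle each one
    divides the value at a fixed point by at least 3/2. *)
Lemma extract_zeros (r0 r1 : R) H w : 0 < r0 -> 4 * r0 <= r1 -> poly_approx r1 H ->
  normc w <= r0 -> H w != 0 ->
  exists Z G, [/\ forall a, a \in Z -> normc a <= r0 /\ H a = 0, poly_approx r1 G,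
    forall z, normc z <= r1 -> H z = \prod_(a <- Z) (z - a) * G z &
    forall z, normc z <= r0 -> G z != 0].
Proof.
move=> r00 r01 pH wr Hw; have r01' : r0 < r1 by lra.
have [M M0 hM] := poly_approx_bounded pH.
have Hw0 : 0 < normc (H w) by rewrite nm_gt0.
have h23 : 0 <= (2 / 3 : R) < 1 by apply/andP; split; lra.
have hwM : 0 < normc (H w) / M / 2 by rewrite !divr_gt0.
(* The distances to the zeros are at least 3 r0 on |z| = r1, and at most 2 r0
   at w. *)
have [m hm] := small_power h23 hwM.
have [Z [G [hZ pG E nz]]] := extract_zeros_step m r01' pH.
exists Z, G; split=> //; case: nz => // sz; exfalso.
have r3 : 0 < 3 * r0 by rewrite mulr_gt0.
have Gb z : normc z = r1 -> normc (G z) <= M / (3 * r0) ^+ m.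
  move=> zr; rewrite ler_pdivlMr ?exprn_gt0// mulrC.
  have := hM z; rewrite zr lexx => /(_ isT); apply: le_trans.
  rewrite E ?zr// normcM ler_wpM2r ?nm_ge0// -sz; apply: nm_prod_ge; first exact: ltW.
  by move=> a /hZ[ar _]; apply: le_trans (nm_leB _ _); rewrite zr; lra.
have wr1 : normc w <= r1 by lra.
have Gw : normc (G w) <= M / (3 * r0) ^+ m by exact: (poly_approx_max pG Gb wr1).
have : normc (H w) <= M * (2 / 3) ^+ m.
  rewrite E// normcM.
  have h1 : normc (\prod_(a <- Z) (w - a)) <= (2 * r0) ^+ m.
    rewrite -sz; apply: nm_prod_le => a /hZ[ar _].
    by apply: le_trans (nm_leB2 _ _) _; lra.
  apply: le_trans (ler_pM (nm_ge0 _) (nm_ge0 _) h1 Gw) _.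
  rewrite !exprMn exprVn le_eqVlt; apply/orP; left; apply/eqP; field.
  by rewrite !expf_neq0 ?gt_eqF.
move: hm; rewrite ler_pdivlMr// ler_pdivlMr// => hm.
by move: hm; rewrite mulrC; lra.
Qed.
End ZeroExtraction.

Section ComplexTopology.
Variable R : realType.
Local Notation C := R[i]^o.
Implicit Types (a z : C) (g : C -> C).

Lemma posC (e : R[i]) : 0 < e -> exists2 d : R, 0 < d & e = d%:C.
Proof.
by case: e => x y; rewrite ltcE /= => /andP[/eqP-> x0]; exists x.
Qed.

Lemma normC_lt z (d : R) : (`|z| < d%:C) = (normc z < d).
Proof. by rewrite normc_def ltcR; case: z. Qed.

Lemma normC_le z (d : R) : (`|z| <= d%:C) = (normc z <= d).
Proof. by rewrite normc_def lecR; case: z. Qed.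

Lemma near_nmP a (P : set C) : (\forall z \near a, P z) <->
  exists2 d : R, 0 < d & forall z, normc (z - a) < d -> P z.
Proof.
split.
  move=> /nbhs_ballP[e /= /posC[d d0 ->] h]; exists d => // z zd.
  by apply: h; rewrite /ball /= normC_lt nmB.
move=> [d d0 h]; apply/nbhs_ballP; exists d%:C; first by rewrite /= ltcR.
by move=> z; rewrite /ball /= normC_lt nmB => /h.
Qed.

Lemma dnear_nmP a (P : set C) : (\forall z \near a^', P z) <->
  exists2 d : R, 0 < d & forall z, z != a -> normc (z - a) < d -> P z.
Proof.
split.
  by move=> /near_nmP[d d0 h]; exists d => // z za zd; apply: h.
by move=> [d d0 h]; apply/near_nmP; exists d => // z zd za; apply: h.
Qed.

Lemma derivable_nm g a (l : C) :
  (forall e : R, 0 < e -> exists2 d : R, 0 < d & forall z, z != a -> normc (z - a) < d ->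
     normc ((g z - g a) / (z - a) - l) <= e) -> derivable g a 1.
Proof.
move=> h; apply/cvg_ex; exists l; apply/cvgrPdist_le => _ /posC[e e0 ->].
have [d d0 hd] := h _ e0.
apply/dnear_nmP; exists d => // x x0; rewrite subr0 => xd.
rewrite normC_le /= nmB; have := hd (x + a); rewrite addrK => /(_ _ xd).
rewrite -subr_eq0 addrK => /(_ x0); congr (normc (_ - _) <= _).
by rewrite mulrC /GRing.scale /= mulr1.
Qed.

Lemma derivable_nm_continuous g a : derivable g a 1 ->
  forall e : R, 0 < e -> exists2 d : R, 0 < d & forall z, normc (z - a) < d ->
    normc (g z - g a) < e.
Proof.
move=> /derivable1_diffP/differentiable_continuous ga e e0.
have /cvgrPdist_lt/(_ e%:C) := ga; rewrite ltcR => /(_ e0)/near_nmP[d d0 h].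
by exists d => // z /h; rewrite normC_lt nmB.
Qed.

(** The quotient of G - G a by z - a is continuous at a. *)
Lemma poly_approx_derivable (G : C -> C) (r : R) a :
  poly_approx r G -> normc a < r -> derivable G a 1.
Proof.
move=> hG ar.
have [H hH E] := poly_approx_div (poly_approxN (G a) hG) ar (subrr _).
have [K K0 hK] := poly_approx_lip hH ar.
apply: (@derivable_nm _ _ (H a)) => e e0.
exists (Num.min (r - normc a) (e / K)).
  by rewrite lt_min subr_gt0 ar divr_gt0.
move=> z za; rewrite lt_min => /andP[h1 h2].
have zr : normc z <= r.
  by rewrite -(subrK a z); apply: le_trans (le_normcD _ _) _; lra.
rewrite E// mulrC mulKf ?subr_eq0//; apply: le_trans (hK _ zr) _.
by rewrite mulrC -ler_pdivlMr// ltW.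
Qed.

Lemma poly_approx_holomorphic (G : C -> C) (r : R) a :
  poly_approx r G -> normc a < r -> holomorphic_at G a.
Proof.
move=> hG ar; apply/near_nmP; exists (r - normc a); first by rewrite subr_gt0.
move=> z zd; apply: poly_approx_derivable hG _.
by rewrite -(subrK a z); apply: le_lt_trans (le_normcD _ _) _; lra.
Qed.
End ComplexTopology.

(** * The logarithm of the modulus *)

Section LogModulus.
Variable R : realType.
Implicit Types (p L : {poly R[i]}) (z w b : R[i]) (r e : R) (h : R[i] -> R).

(** These are the harmonic functions of the open disc that extend continuously
    to the circle. *)
Definition re_approx r h := forall e, 0 < e ->
  exists L : {poly R[i]}, forall z, normc z <= r -> `|Rp L.[z] - h z| <= e.

Lemma eq_re_approx r h h' : (forall z, normc z <= r -> h z = h' z) ->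
  re_approx r h -> re_approx r h'.
Proof. by move=> E hh e /hh[L hL]; exists L => z zr; rewrite -E// hL. Qed.

Lemma re_approx_cst r (c : R) : re_approx r (fun=> c).
Proof.
by move=> e e0; exists (c%:C)%:P => z _; rewrite hornerC /= subrr normr0 ltW.
Qed.

Lemma re_approxD r h h' : re_approx r h -> re_approx r h' ->
  re_approx r (fun z => h z + h' z).
Proof.
move=> hh hh' e e0; have e2 : 0 < e / 2 by rewrite divr_gt0.
have [L hL] := hh _ e2; have [L' hL'] := hh' _ e2; exists (L + L') => z zr.
rewrite hornerD raddfD /= opprD addrACA; apply: le_trans (ler_normD _ _) _.
by rewrite [e]splitr lerD ?hL ?hL'.
Qed.

Lemma re_approx_lim r h : (forall e, 0 < e -> exists2 h', re_approx r h' &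
   forall z, normc z <= r -> `|h' z - h z| <= e) -> re_approx r h.
Proof.
move=> hh e e0; have e2 : 0 < e / 2 by rewrite divr_gt0.
have [h' + hL'] := hh _ e2; move=> /(_ _ e2)[L hL]; exists L => z zr.
rewrite -[Rp _](subrK (h' z)) -addrA; apply: le_trans (ler_normD _ _) _.
by rewrite [e]splitr lerD ?hL ?hL'.
Qed.

Lemma nm1B_sqr w (s : R) :
  normc (1 - s%:C * w) ^+ 2 = 1 - 2 * s * Rp w + s ^+ 2 * normc w ^+ 2.
Proof. by rewrite !nm_sqr; case: w => x y /=; ring. Qed.

Lemma nm1B_gt0 w : normc w < 1 -> 0 < normc (1 - w).
Proof.
by move=> w1; apply: lt_le_trans (nm_leB _ _); rewrite normc1 subr_gt0.
Qed.

(** The difference between a geometric series and its partial sum, in the form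
    of the derivative of the Taylor remainder of ln |1 - s w|. *)
Lemma geometric_re w (s : R) n : normc w < 1 -> 0 <= s <= 1 ->
  - (1 - s%:C * w)^-1 * w + w * \sum_(k < n) (s%:C * w) ^+ k
   = - w * (s%:C * w) ^+ n / (1 - s%:C * w).
Proof.
move=> w1 /andP[s0 s1].
have sw : normc (s%:C * w) < 1.
  rewrite normcM nm_real ger0_norm//; apply: le_lt_trans w1.
  by rewrite ler_piMl ?nm_ge0.
have n0 : 1 - s%:C * w != 0 by rewrite -nm_gt0 nm1B_gt0.
have := subrX1 (s%:C * w) n; move: (s%:C * w) n0 => v n0 E.
apply: (mulIf n0); rewrite mulrDl divfK//.
have -> : - (1 - v)^-1 * w * (1 - v) = - w by field.
have -> : w * (\sum_(k < n) v ^+ k) * (1 - v) = - w * ((v - 1) * \sum_(k < n) v ^+ k).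
  by ring.
by rewrite -E; ring.
Qed.

Lemma Re_scale (a : R) z : Rp (a%:C * z) = a * Rp z.
Proof. by case: z => x y /=; rewrite mul0r subr0. Qed.

Lemma Re_sum (I : Type) (s : seq I) (P : pred I) (F : I -> R[i]) :
  Rp (\sum_(i <- s | P i) F i) = \sum_(i <- s | P i) Rp (F i).
Proof. exact: (raddf_sum (@complex.Re R)). Qed.

Lemma is_derive_monomial (c s : R) k :
  is_derive s 1 (fun x : R => c * x ^+ k.+1) (c * (k.+1%:R * s ^+ k)).
Proof.
have h := is_deriveZ c (is_deriveX k.+1 (is_derive_id s 1)).
rewrite (_ : (fun x => _) = c \*: (id ^+ k.+1)); last first.
  by apply/funext => x /=; rewrite exprfctE.
by apply: is_derive_eq h _; rewrite /GRing.scale /= mulr1.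
Qed.

(** The Taylor polynomials of the logarithm; the remainder is controlled by the
    mean value theorem on the segment from 0 to w. *)
Lemma ln_nm1B_taylor w (q : R) n : normc w <= q -> q < 1 ->
  `|ln (normc (1 - w)) + Rp (\sum_(k < n) k.+1%:R^-1 * w ^+ k.+1)| <= q ^+ n.+1 / (1 - q).
Proof.
move=> wq q1; have w1 : normc w < 1 by apply: le_lt_trans q1.
pose D (s : R) := 1 - 2 * s * Rp w + s ^+ 2 * normc w ^+ 2.
have sw (s : R) : 0 <= s <= 1 -> normc (s%:C * w) <= q.
  move=> /andP[s0 s1]; rewrite normcM nm_real ger0_norm//; apply: le_trans wq.
  by rewrite ler_piMl ?nm_ge0.
have D0 (s : R) : 0 <= s <= 1 -> 0 < D s.
  by move=> hs; rewrite /D -nm1B_sqr exprn_gt0// nm1B_gt0// (le_lt_trans (sw _ hs)).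
pose a k := k.+1%:R^-1 * Rp (w ^+ k.+1).
have aE k : Rp (k.+1%:R^-1 * w ^+ k.+1) = a k.
  by rewrite /a -Re_scale fmorphV rmorph_nat.
pose S (s : R) := \sum_(k < n) a k * s ^+ k.+1.
pose phi (s : R) := 2^-1 * ln (D s) + S s.
pose dphi (s : R) := 2^-1 * ((D s)^-1 * (- 2 * Rp w + 2 * s * normc w ^+ 2))
    + \sum_(k < n) a k * (k.+1%:R * s ^+ k).
have dD (s : R) : is_derive s 1 D (- 2 * Rp w + 2 * s * normc w ^+ 2).
  rewrite /D; apply: is_derive_eq.
  by rewrite !scaler0 !scaler1 /GRing.scale /=; ring.
have dS (s : R) : is_derive s 1 S (\sum_(k < n) a k * (k.+1%:R * s ^+ k)).
  have -> : S = \sum_(k < n) (fun s : R => a k * s ^+ k.+1).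
    by apply/funext => x; rewrite fct_sumE.
  by apply: is_derive_sum => k; exact: is_derive_monomial.
have dphiP (s : R) : 0 <= s <= 1 -> is_derive s 1 phi (dphi s).
  move=> hs; have h1 := is_derive1_comp (is_derive1_ln (D0 _ hs)) (dD s).
  exact: is_deriveD (is_deriveZ 2^-1 h1) (dS s).
have phi0 : phi 0 = 0.
  rewrite /phi /D /S !(mulr0, mul0r) expr0n /= mul0r subr0 addr0 ln1 mulr0 add0r.
  by rewrite big1// => k _; rewrite expr0n /= mulr0.
have phi1 : phi 1 = ln (normc (1 - w)) + Rp (\sum_(k < n) k.+1%:R^-1 * w ^+ k.+1).
  rewrite /phi; congr (_ + _).
    rewrite /D -nm1B_sqr mul1r lnXn ?nm1B_gt0// -[X in _ * X]mulr_natl mulrA mulVf ?pnatr_eq0//.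
    by rewrite mul1r.
  by rewrite /S Re_sum; apply: eq_bigr => k _; rewrite expr1n mulr1 aE.
have dphiE (s : R) : 0 <= s <= 1 -> dphi s = Rp (- w * (s%:C * w) ^+ n / (1 - s%:C * w)).
  move=> hs; rewrite -geometric_re// raddfD; congr (_ + _).
    have h := nm1B_sqr w s.
    have nz : 1 - s%:C * w != 0 by rewrite -nm_gt0 nm1B_gt0// (le_lt_trans (sw _ hs)).
    have := D0 _ hs; rewrite /D nm_sqr.
    case: (w) => x y /=; rewrite !mul0r !subr0 !addr0 !sub0r => hD.
    have E : 1 - 2 * s * x + s ^+ 2 * (x ^+ 2 + y ^+ 2) = (1 - s * x) ^+ 2 + (s * y) ^+ 2.
      by ring.
    by rewrite E sqrrN in hD *; field; rewrite gt_eqF.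
  rewrite mulr_sumr -[RHS]/(Rp _) Re_sum; apply: eq_bigr => k _.
  have -> : w * (s%:C * w) ^+ k = (s ^+ k)%:C * w ^+ k.+1.
    by rewrite exprMn rmorphXn exprS; ring.
  rewrite Re_scale /a.
  by rewrite mulrACA mulVf ?pnatr_eq0// mul1r mulrC.
have cphi : {within `[0, 1], continuous phi}.
  apply: derivable_within_continuous => x; rewrite in_itv /= => hx.
  by have [] := dphiP x hx.
have dphiI (x : R) : x \in `]0, 1[%R -> is_derive x 1 phi (dphi x).
  by rewrite in_itv /= => /andP[/ltW x0 /ltW x1]; apply: dphiP; rewrite x0.
have [s] := MVT ltr01 dphiI cphi.
rewrite in_itv /= => /andP[/ltW s0 /ltW s1].
rewrite phi1 phi0 !subr0 mulr1 dphiE ?s0// => ->.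
apply: le_trans (Re_le_nm _) _.
have hs : 0 <= s <= 1 by rewrite s0.
rewrite nm_div normcM normcN nmX exprS.
have q0 : 0 <= q by apply: le_trans wq; exact: nm_ge0.
apply: ler_pM; rewrite ?mulr_ge0 ?invr_ge0 ?exprn_ge0 ?nm_ge0//.
  by rewrite ler_pM ?exprn_ge0 ?nm_ge0// lerXn2r ?nnegrE ?nm_ge0 ?sw.
rewrite lef_pV2 ?posrE ?subr_gt0//.
  by apply: le_trans (nm_leB _ _); rewrite normc1 lerB// sw.
by rewrite nm1B_gt0// (le_lt_trans (sw _ hs)).
Qed.

Lemma re_approx_ln_factor r b : r < normc b -> re_approx r (fun z => ln (normc (z - b))).
Proof.
move=> rb e e0; have [r0|r0] := ltP r 0.
  by exists 0 => z zr; have := nm_ge0 z; rewrite leNgt (le_lt_trans zr r0).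
have b0 : 0 < normc b by apply: le_lt_trans rb.
have bn0 : b != 0 by rewrite -nm_gt0.
have q1 : r / normc b < 1 by rewrite ltr_pdivrMr// mul1r.
have q0 : 0 <= r / normc b by rewrite divr_ge0// ltW.
have e1 : 0 < e * (1 - r / normc b) by rewrite mulr_gt0// subr_gt0.
have [n hn] : exists n, (r / normc b) ^+ n <= e * (1 - r / normc b).
  by apply: small_power; rewrite ?q0.
exists ((ln (normc b))%:C%:P - \poly_(i < n.+1) (if i is k.+1 then k.+1%:R^-1 * b ^- k.+1 else 0)).
move=> z zr; rewrite hornerD hornerN hornerC horner_poly raddfB /= big_ord_recl /= mul0r add0r.
have zb : normc (z / b) <= r / normc b by rewrite nm_div ler_wpM2r// invr_ge0 ltW.
have zb0 : 0 < normc (1 - z / b) by rewrite nm1B_gt0// (le_lt_trans zb).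
have -> : ln (normc (z - b)) = ln (normc b) + ln (normc (1 - z / b)).
  rewrite -lnM ?posrE// -normcM nmB; congr (ln (normc _)); field; exact: bn0.
have h := ln_nm1B_taylor n zb q1.
have -> : \sum_(i < n) (0 + i)%N.+1%:R^-1 / b ^+ (0 + i)%N.+1 * z ^+ bump 0 i =
    \sum_(k < n) k.+1%:R^-1 * (z / b) ^+ k.+1.
  apply: eq_bigr => k _; rewrite add0n /bump /= add1n exprMn exprVn -!mulrA.
  by congr (_ * _); rewrite mulrC.
rewrite opprD addrACA subrr add0r -opprD normrN addrC.
apply: le_trans h _; rewrite ler_pdivrMr ?subr_gt0//.
apply: le_trans hn; rewrite exprS ler_piMl ?exprn_ge0// ltW//.
Qed.

(** The polynomial is a product of linear factors whose roots lie outside the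
    disc. *)
Lemma re_approx_ln_poly r p : 0 <= r -> (forall z, normc z <= r -> p.[z] != 0) ->
  re_approx r (fun z => ln (normc p.[z])).
Proof.
move=> r0 hp; have p0 : p != 0.
  by apply: contraNneq (hp 0 _) => [->|]; rewrite ?horner0 ?normc0.
have [s ps] := closed_field_poly_normal p.
have sr b : b \in s -> r < normc b.
  move=> bs; rewrite ltNge; apply/negP => /hp; rewrite ps hornerZ.
  have : root (\prod_(z <- s) ('X - z%:P)) b by rewrite root_prod_XsubC.
  by move=> /eqP ->; rewrite mulr0 eqxx.
have l0 : 0 < normc (lead_coef p) by rewrite nm_gt0 lead_coef_eq0.
suff h : re_approx r (fun z => \sum_(b <- s) ln (normc (z - b))).
  apply: eq_re_approx (re_approxD (re_approx_cst r (ln (normc (lead_coef p)))) h) => z zr.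
  rewrite [in RHS]ps hornerZ horner_prod normcM lnM ?posrE//; last first.
    by have := hp z zr; rewrite -nm_gt0 [in normc p.[z]]ps hornerZ horner_prod normcM pmulr_rgt0.
  congr (_ + _); rewrite nm_prod.
  elim: s sr {ps h} => [|b s IH] sr; first by rewrite !big_nil ln1.
  rewrite !big_cons hornerXsubC.
  have zb c : c \in b :: s -> 0 < normc (z - c).
    by move=> /sr h; rewrite nm_gt0 subr_eq0; apply: contraTneq h => <-; rewrite -leNgt.
  rewrite lnM ?posrE ?zb ?mem_head//; last first.
    rewrite big_seq prodr_gt0// => c cs; rewrite hornerXsubC zb// inE cs orbT//.
  by rewrite IH// => c cs; apply: sr; rewrite inE cs orbT.
elim: s sr {ps} => [|b s IH] sr.
  by apply: eq_re_approx (re_approx_cst r 0) => z _; rewrite big_nil.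
have h1 := re_approx_ln_factor (sr b (mem_head _ _)).
have h2 : re_approx r (fun z => \sum_(b <- s) ln (normc (z - b))).
  by apply: IH => c cs; apply: sr; rewrite inE cs orbT.
by apply: eq_re_approx (re_approxD h1 h2) => z _; rewrite big_cons.
Qed.

Lemma ln_le_diff (x y : R) : 0 < x -> 0 < y -> ln x - ln y <= (x - y) / y.
Proof.
move=> x0 y0; rewrite -ln_div ?posrE//.
have -> : (x - y) / y = x / y - 1 by field; rewrite gt_eqF.
by rewrite lerBrDl -[leRHS]lnK ?posrE ?divr_gt0// expR_ge1Dx.
Qed.

Lemma ln_dist (x y d : R) : 0 < d -> d <= x -> d <= y -> `|ln x - ln y| <= `|x - y| / d.
Proof.
move=> d0 dx dy; have x0 := lt_le_trans d0 dx; have y0 := lt_le_trans d0 dy.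
have key u v : d <= v -> 0 < u -> 0 < v -> ln u - ln v <= `|u - v| / d.
  move=> dv u0 v0; apply: le_trans (ln_le_diff u0 v0) _.
  apply: le_trans (_ : `|u - v| / v <= _); first by rewrite ler_wpM2r ?invr_ge0 ?ler_norm ?ltW.
  by rewrite ler_wpM2l ?lef_pV2.
by rewrite ler_norml lerNl opprB distrC key// distrC key.
Qed.
End LogModulus.

Section ZeroFree.
Variable R : realType.
Implicit Types (G : R[i] -> R[i]) (z w : R[i]) (r rho : R) (h : R[i] -> R).

(** Compactness of the disc, as a closed subset of a square. *)
Lemma zero_free_lower G r rho : 0 <= r < rho -> poly_approx rho G ->
  (forall z, normc z <= r -> G z != 0) ->
  exists2 d, 0 < d & forall z, normc z <= r -> d <= normc (G z).
Proof.
move=> /andP[r0 rr] hG G0.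
pose A : set (R * R) := `[- r, r] `*` `[- r, r].
pose B : set (R * R) := [set x | normc (x.1 +i* x.2) <= r].
pose F (x : R * R) : R := normc (G (x.1 +i* x.2)).
have cA : compact A by apply: compact_setX; exact: segment_compact.
have dist (x y : R * R) : normc ((x.1 +i* x.2) - (y.1 +i* y.2)) <= `|x.1 - y.1| + `|x.2 - y.2|.
  by apply: le_trans (nm_le_ReIm _) _.
have near2 (x : R * R) (e : R) : 0 < e ->
    \forall y \near x, normc ((x.1 +i* x.2) - (y.1 +i* y.2)) <= e.
  move=> e0; have e2 : 0 < e / 2 by rewrite divr_gt0.
  apply/nbhs_ballP; exists (e / 2) => //= y [] /=; rewrite /ball /= => h1 h2.
  by apply: le_trans (dist _ _) _; rewrite [e]splitr lerD// ltW.
have cB : closed B.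
  have -> : B = (fun x : R * R => normc (x.1 +i* x.2)) @^-1` [set t | t <= r] by [].
  apply: preimage_closed; last exact: closed_le.
  move=> x _.
  apply/cvgrPdist_le => e e0; have := near2 x e e0; apply: filterS => y.
  by apply: le_trans; exact: nm_dist.
have cK : compact (A `&` B) by apply: compact_closedI.
have zK z : normc z <= r -> (A `&` B) (Rp z, Ip z).
  move=> zr; split; last by rewrite /B /=; case: (z) zr.
  split; rewrite /= in_itv /= -ler_norml; apply: le_trans zr.
    exact: Re_le_nm.
  exact: Im_le_nm.
have K0 : A `&` B !=set0 by exists (0, 0); apply: (zK 0); rewrite normc0.
have cF : {within A `&` B, continuous F}.
  apply: continuous_in_subspaceT => x /set_mem[_ xB].
  have xr : normc (x.1 +i* x.2) < rho by apply: le_lt_trans rr.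
  have [K Kp hK] := poly_approx_lip hG xr.
  apply/cvgrPdist_le => e e0.
  have d0 : 0 < Num.min (e / K) (rho - normc (x.1 +i* x.2)).
    by rewrite lt_min divr_gt0//= subr_gt0.
  have := near2 x _ d0; apply: filterS => y; rewrite le_min => /andP[h1 h2].
  rewrite /F; apply: le_trans (nm_dist _ _) _; rewrite nmB.
  have yr : normc (y.1 +i* y.2) <= rho.
    rewrite -(subrK (x.1 +i* x.2) (y.1 +i* y.2)); apply: le_trans (le_normcD _ _) _.
    by rewrite nmB; lra.
  by apply: le_trans (hK _ yr) _; rewrite nmB mulrC -ler_pdivlMr.
have [c /set_mem[_ cB'] hc] := compact_EVT_min K0 cK cF.
exists (F c); first by rewrite nm_gt0 G0.
move=> z zr; have := hc (Rp z, Ip z); rewrite /F /= => h.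
have -> : z = Rp z +i* Ip z by case: z {zr h}.
by apply: h; apply/mem_set/zK.
Qed.

(** The logarithm of the modulus of a zero-free function is harmonic: a uniform
    limit of real parts of polynomials. *)
Lemma re_approx_ln G r rho : 0 <= r < rho -> poly_approx rho G ->
  (forall z, normc z <= r -> G z != 0) -> re_approx r (fun z => ln (normc (G z))).
Proof.
move=> rr hG G0; have [d d0 hd] := zero_free_lower rr hG G0.
have /andP[r0 rrho] := rr.
apply: re_approx_lim => e e0.
have e1 : 0 < Num.min (d / 2) (e * (d / 2)) by rewrite lt_min divr_gt0//= mulr_gt0// divr_gt0.
have [p hp] := hG _ e1.
have pd z : normc z <= r -> d / 2 <= normc p.[z].
  move=> zr; have := hp z (le_trans zr (ltW rrho)); rewrite le_min => /andP[h _].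
  by have := nm_leB (G z) p.[z]; rewrite nmB; have := hd z zr; lra.
exists (fun z => ln (normc p.[z])).
  apply: re_approx_ln_poly => // z /pd h; rewrite -nm_gt0; apply: lt_le_trans h.
  by rewrite divr_gt0.
move=> z zr; have d2 : 0 < d / 2 by rewrite divr_gt0.
apply: le_trans (ln_dist d2 (pd _ zr) (le_trans _ (hd _ zr))) _.
  by rewrite ler_pdivrMr// ler_pMr// ler1n.
rewrite ler_pdivrMr//; apply: le_trans (nm_dist _ _) _.
by have := hp z (le_trans zr (ltW rrho)); rewrite le_min => /andP[_].
Qed.

Lemma Harnack h r M z w : 0 < r -> re_approx r h ->
  (forall v, normc v <= r -> h v <= M) ->
  normc z <= r / 2 -> normc w <= r / 2 ->
  `|h z - h w| <= 8 * (M - h 0) * normc (z - w) / r.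
Proof.
move=> r0 hh hM zr wr; apply/ler_addgt0Pr => e e0.
have e1 : 0 < e / 18 by rewrite divr_gt0.
have [L hL] := hh _ e1.
have r2 : r / 2 <= r by rewrite ler_pdivrMr// ler_pMr// ler1n.
have LM v : normc v = r -> Rp L.[v] <= M + e / 18.
  move=> vr; have := hL v; rewrite vr => /(_ (lexx _)).
  by rewrite ler_norml => /andP[_]; have := hM v; rewrite vr => /(_ (lexx _)); lra.
have H := Harnack_poly r0 LM zr wr.
have q1 : normc (z - w) / r <= 1.
  by rewrite ler_pdivrMr// mul1r; apply: le_trans (nm_leB2 _ _) _; lra.
have q0 : 0 <= normc (z - w) / r by rewrite divr_ge0 ?nm_ge0// ltW.
have := hL z (le_trans zr r2); have := hL w (le_trans wr r2); have := hL 0.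
rewrite normc0 => /(_ (ltW r0)).
move: H q0 q1; rewrite -!mulrA; move: (normc (z - w) / r) => q.
rewrite !ler_norml => /andP[H1 H2] q0 q1 /andP[a1 a2] /andP[b1 b2] /andP[c1 c2].
by apply/andP; split; nra.
Qed.
End ZeroFree.

(** * Means over circles *)

Section CircleMean.
Variable R : realType.
Local Notation leb := (@lebesgue_measure R).
Implicit Types (v u : R -> R) (r e : R) (a : R[i]).

Definition cmean v : R := (2 * pi)^-1 * \int[leb]_(x in `[0, 2 * pi]) v x.

Let pi0 : 0 < 2 * pi :> R.
Proof. by rewrite mulr_gt0// pi_gt0. Qed.

Lemma continuous_cintegrable v : continuous v ->
  leb.-integrable `[0, 2 * pi] (EFin \o v).
Proof.
move=> cv; apply: continuous_compact_integrable; first exact: segment_compact.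
exact: continuous_subspaceT.
Qed.

Lemma cmeanD v u : continuous v -> continuous u ->
  cmean (fun x => v x + u x) = cmean v + cmean u.
Proof.
move=> cv cu.
by rewrite /cmean (RintegralD _ (continuous_cintegrable cv)
  (continuous_cintegrable cu))// mulrDr.
Qed.

Lemma cmeanZ (k : R) v : continuous v -> cmean (fun x => k * v x) = k * cmean v.
Proof.
move=> cv.
by rewrite /cmean (RintegralZl _ _ (continuous_cintegrable cv))// mulrCA.
Qed.

Lemma cmean_cst (k : R) : cmean (fun=> k) = k.
Proof.
rewrite /cmean Rintegral_cst//= lebesgue_measure_itv /= lte_fin pi0 /= oppr0 addr0.
by rewrite mulrCA mulVf ?gt_eqF// mulr1.
Qed.

Lemma cmean_le v u : continuous v -> continuous u -> (forall x, v x <= u x) ->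
  cmean v <= cmean u.
Proof.
move=> cv cu vu; rewrite /cmean ler_wpM2l ?invr_ge0 ?(ltW pi0)//.
by apply: le_Rintegral => //; exact: continuous_cintegrable.
Qed.

Lemma cmean_ge0 v : (forall x, 0 <= v x) -> 0 <= cmean v.
Proof. by move=> v0; rewrite mulr_ge0 ?invr_ge0 ?(ltW pi0)// Rintegral_ge0. Qed.

Lemma continuousD_fun v u : continuous v -> continuous u -> continuous (fun x => v x + u x).
Proof. by move=> cv cu x; apply: continuousD; [exact: cv|exact: cu]. Qed.

Lemma continuousZ_fun (k : R) v : continuous v -> continuous (fun x => k * v x).
Proof. by move=> cv x; apply: continuousM; [exact: cst_continuous|exact: cv]. Qed.

Lemma continuous_sum_fun (I : eqType) (s : seq I) (F : I -> R -> R) :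
  (forall i, i \in s -> continuous (F i)) -> continuous (fun x => \sum_(i <- s) F i x).
Proof.
elim: s => [_ x|i s IH hF].
  by under eq_fun do rewrite big_nil; exact: cst_continuous.
under eq_fun do rewrite big_cons.
apply: continuousD_fun; first by apply: hF; rewrite mem_head.
by apply: IH => j js; apply: hF; rewrite inE js orbT.
Qed.

Lemma cmean_sum (I : eqType) (s : seq I) (F : I -> R -> R) :
  (forall i, i \in s -> continuous (F i)) ->
  cmean (fun x => \sum_(i <- s) F i x) = \sum_(i <- s) cmean (F i).
Proof.
elim: s => [_|i s IH hF].
  by under eq_fun do rewrite big_nil; rewrite cmean_cst big_nil.
have hi : continuous (F i) by apply: hF; rewrite mem_head.
have hs j : j \in s -> continuous (F j) by move=> js; apply: hF; rewrite inE js orbT.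
under eq_fun do rewrite big_cons.
by rewrite cmeanD ?IH ?big_cons//; exact: continuous_sum_fun.
Qed.

Lemma cmean_near v u e : continuous v -> continuous u ->
  (forall x, `|v x - u x| <= e) -> `|cmean v - cmean u| <= e.
Proof.
move=> cv cu h; have cN : continuous (fun x => -1 * u x) by exact: continuousZ_fun.
have E : cmean v - cmean u = cmean (fun x => v x + -1 * u x).
  by rewrite cmeanD// cmeanZ// mulN1r.
rewrite E ler_norml -[X in X <= _](cmean_cst (- e)) -[X in _ && (_ <= X)](cmean_cst e).
have ce k : continuous (fun _ : R => k : R) by move=> x; exact: cst_continuous.
have cs : continuous (fun x => v x + -1 * u x) by exact: continuousD_fun.
have hx x : - e <= v x + -1 * u x <= e by rewrite mulN1r -ler_norml.
by apply/andP; split; apply: cmean_le => // x; case/andP: (hx x).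
Qed.

Lemma cmean_periodic_derive v (V : R -> R) : continuous v ->
  (forall x : R, is_derive x 1 V (v x)) -> V (2 * pi) = V 0 -> cmean v = 0.
Proof.
move=> cv dV per; rewrite /cmean /Rintegral.
rewrite (@continuous_FTC2 _ v V 0 (2 * pi))//.
- by rewrite per -EFinB subrr mulr0.
- exact: continuous_subspaceT.
- have cV x : {for x, continuous V}.
    by apply: differentiable_continuous; apply/derivable1_diffP; case: (dV x).
  split; first by move=> x _; case: (dV x).
    by apply: cvg_at_right_filter; exact: cV.
  by apply: cvg_at_left_filter; exact: cV.
- by move=> x _; rewrite derive1E; apply: derive_val.
Qed.

Lemma cis2pi n : cis (n%:R * (2 * pi) : R) = 1.
Proof.
have -> : n%:R * (2 * pi) = (pi *+ 2) * n%:R :> R by rewrite -mulr_natr; ring.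
by rewrite -cisX /cis cos2pi sin2pi expr1n.
Qed.

Lemma continuous_Re_monomial (c : R[i]) n : continuous (fun x : R => Rp (c * cis x ^+ n)).
Proof.
have cn (g : R -> R) : continuous g -> continuous (fun x : R => g (x * n%:R)).
  move=> cg x; have := @continuous_comp R R R (fun x => x * n%:R) g x; apply; last exact: cg.
  exact: mulrr_continuous.
rewrite (_ : (fun _ => _) = fun x : R => Rp c * cos (x * n%:R) + (- Ip c) * sin (x * n%:R)).
  apply: continuousD_fun; apply: continuousZ_fun; apply: cn.
    exact: continuous_cos.
  exact: continuous_sin.
by apply/funext => y; rewrite cisX mulNr; case: c.
Qed.

Lemma cmean_Re_monomial (c : R[i]) n : cmean (fun x => Rp (c * cis x ^+ n.+1)) = 0.
Proof.
pose V (x : R) := n.+1%:R^-1 * (Rp c * sin (n.+1%:R * x) + Ip c * cos (n.+1%:R * x)).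
apply: (@cmean_periodic_derive _ V); first exact: continuous_Re_monomial.
  move=> x; rewrite /V; apply: is_derive_eq.
  rewrite cisX {}/V; case: c => a b /=; rewrite /GRing.scale /= !mulr1 [x * _]mulrC.
  by field; rewrite nat1r pnatr_eq0.
rewrite /V; have := cis2pi n.+1; rewrite /cis => -[-> ->].
by rewrite [X in sin X]mulr0 [X in cos X]mulr0 cos0 sin0.
Qed.

Lemma horner_circle (L : {poly R[i]}) r x :
  Rp L.[r%:C * cis x] = \sum_(k < size L) Rp (L`_k * r%:C ^+ k * cis x ^+ k).
Proof.
by rewrite horner_coef Re_sum; apply: eq_bigr => k _; rewrite exprMn mulrA.
Qed.

Lemma continuous_Re_circle (L : {poly R[i]}) r : continuous (fun x => Rp L.[r%:C * cis x]).
Proof.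
under eq_fun do rewrite horner_circle.
have := @continuous_sum_fun _ (index_enum 'I_(size L)) (fun (k : 'I_(size L)) x => Rp (L`_k * r%:C ^+ k * cis x ^+ k)).
by apply=> k _; exact: continuous_Re_monomial.
Qed.

Lemma cmean_Re_circle (L : {poly R[i]}) r : cmean (fun x => Rp L.[r%:C * cis x]) = Rp L.[0].
Proof.
under eq_fun do rewrite horner_circle.
rewrite (@cmean_sum _ _ (fun (k : 'I_(size L)) x => Rp (L`_k * r%:C ^+ k * cis x ^+ k))); last first.
  by move=> k _; exact: continuous_Re_monomial.
rewrite horner_coef0; case E : (size L) => [|n].
  by rewrite big_ord0; move/eqP: E; rewrite size_poly_eq0 => /eqP ->; rewrite coef0.
rewrite big_ord_recl big1 ?addr0 => [|k _]; last first.
  by rewrite /= /bump /= add1n; exact: cmean_Re_monomial.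
by rewrite /=; under eq_fun do rewrite !expr0 !mulr1; rewrite cmean_cst.
Qed.

Lemma nm_circle r x : 0 <= r -> normc (r%:C * cis x) = r.
Proof. by move=> r0; rewrite normcM nm_real nm_cis mulr1 ger0_norm. Qed.

(** The mean value property holds for real parts of polynomials, whose
    nonconstant monomials have mean 0, and passes to uniform limits. *)
Lemma re_approx_circle (h : R[i] -> R) r rho : 0 <= r <= rho -> re_approx rho h ->
  continuous (fun x => h (r%:C * cis x)) /\ cmean (fun x => h (r%:C * cis x)) = h 0.
Proof.
move=> /andP[r0 rr] hh.
have z_in x : normc (r%:C * cis x) <= rho by rewrite nm_circle.
have ch : continuous (fun x => h (r%:C * cis x)).
  move=> x; apply/cvgrPdist_le => e e0.
  have e3 : 0 < e / 3 by rewrite divr_gt0.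
  have [L hL] := hh _ e3.
  have /cvgrPdist_le/(_ _ e3) := @continuous_Re_circle L r x.
  apply: filterS => y; have := hL _ (z_in x); have := hL _ (z_in y).
  rewrite !ler_norml => /andP[a1 a2] /andP[b1 b2] /andP[c1 c2]; lra.
split=> //; apply/eqP; rewrite -subr_eq0 -normr_le0; apply/ler_addgt0Pr => e e0.
have e2 : 0 < e / 2 by rewrite divr_gt0.
have [L hL] := hh _ e2; rewrite add0r.
have h1 : `|cmean (fun x => Rp L.[r%:C * cis x]) - cmean (fun x => h (r%:C * cis x))| <= e / 2.
  by apply: cmean_near => //; [exact: continuous_Re_circle|move=> x; exact: hL].
have h2 := hL 0; rewrite normc0 in h2; have {h2} := h2 (le_trans r0 rr).
by move: h1; rewrite cmean_Re_circle !ler_norml => /andP[a1 a2] /andP[b1 b2]; lra.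
Qed.

Lemma max_cases r a : normc a != r ->
  (normc a < r /\ Num.max r (normc a) = r) \/ (r < normc a /\ Num.max r (normc a) = normc a).
Proof. by rewrite neq_lt => /orP[h|h]; [left|right]; split=> //; [rewrite max_l// ltW|rewrite max_r// ltW]. Qed.

(** The mean over a circle of the logarithmic kernel. Off the circle the kernel
    is harmonic up to an inversion: |z - a| = |r - conj(a) z / r| for |z| = r. *)
Lemma cmean_ln_factor r a : 0 < r -> normc a != r ->
  continuous (fun x => ln (normc (r%:C * cis x - a))) /\
  cmean (fun x => ln (normc (r%:C * cis x - a))) = ln (Num.max r (normc a)).
Proof.
move=> r0 ar; have rC0 : r%:C != 0 :> R[i] by rewrite -nm_gt0 nm_real gtr0_norm.
have [[h ->]|[h ->]] := max_cases ar; last first.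
  have rr : 0 <= r <= r by rewrite lexx ltW.
  have [c m] := re_approx_circle rr (re_approx_ln_factor h).
  by split=> //; rewrite m sub0r normcN.
have [->|a0] := eqVneq a 0.
  have E x : ln (normc (r%:C * cis x - 0)) = ln r by rewrite subr0 nm_circle// ltW.
  split; last by under eq_fun do rewrite E; rewrite cmean_cst.
  by under eq_fun do rewrite E; move=> x; exact: cst_continuous.
set ca := conjc a; have ca0 : ca != 0 by rewrite -nm_gt0 nm_conj nm_gt0.
pose b := r%:C ^+ 2 / ca.
have na0 : 0 < normc a by rewrite nm_gt0.
have nb : normc b = r ^+ 2 / normc a by rewrite nm_div nmX nm_real nm_conj gtr0_norm.
have rb : r < normc b.
  by rewrite nb ltr_pdivlMr// expr2 ltr_pM2l.
have E x : ln (normc (r%:C * cis x - a)) = ln (normc (r%:C * cis x - b)) + (ln (normc a) - ln r).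
  have -> : normc (r%:C * cis x - a) = normc (r%:C * cis x - b) * (normc a / r).
    have -> : normc (r%:C * cis x - a) = normc (r%:C * cis (- x) - ca).
      rewrite -nm_conj rmorphB rmorphM /= -conj_cis.
      by rewrite /conjc /= oppr0.
    have -> : r%:C * cis (- x) - ca = - (r%:C * cis x - b) * (ca / r%:C * cis (- x)).
      have e1 : cis x * cis (- x) = 1 by rewrite -cisD subrr cis0.
      rewrite /b mulNr mulrBl opprB; congr (_ - _).
        by field; rewrite rC0 ca0.
      rewrite (_ : r%:C * cis x * (ca / r%:C * cis (- x)) = ca * (cis x * cis (- x))).
        by rewrite e1 mulr1.
      by field.
    by rewrite normcM normcN [X in _ * X]normcM nm_cis mulr1 nm_div nm_conj nm_real gtr0_norm.
  have zb : 0 < normc (r%:C * cis x - b).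
    by rewrite nmB; apply: lt_le_trans (nm_leB _ _); rewrite nm_circle ?subr_gt0// ltW.
  by rewrite lnM ?posrE ?divr_gt0// ln_div ?posrE.
have rr : 0 <= r <= r by rewrite lexx ltW.
have [c m] := re_approx_circle rr (re_approx_ln_factor rb).
have cc : continuous (fun _ : R => ln (normc a) - ln r) by move=> x; exact: cst_continuous.
split.
  by under eq_fun do rewrite E; exact: continuousD_fun.
under eq_fun do rewrite E.
rewrite cmeanD// m cmean_cst sub0r normcN nb ln_div ?posrE ?exprn_gt0//.
by rewrite lnXn// mulr2n; ring.
Qed.
End CircleMean.

Section SmoothedKernel.
Variable R : realType.
Local Notation leb := (@lebesgue_measure R).
Implicit Types (v u : R -> R) (r e k : R) (a b : R[i]).

Lemma continuous_ln_pos v : continuous v -> (forall x, 0 < v x) -> continuous (fun x => ln (v x)).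
Proof.
move=> cv v0 x; have := @continuous_comp R R R v (@ln R) x.
by apply; [exact: cv|exact: continuous_ln (v0 x)].
Qed.

Lemma continuous_expR_fun v : continuous v -> continuous (fun x => expR (v x)).
Proof.
move=> cv x; have := @continuous_comp R R R v expR x.
by apply; [exact: cv|exact: continuous_expR].
Qed.

Lemma nm_circleB_gt0 r a x : 0 < r -> normc a != r -> 0 < normc (r%:C * cis x - a).
Proof.
move=> r0 ar; rewrite nm_gt0 subr_eq0; apply: contraNneq ar => <-.
by rewrite nm_circle ?ltW.
Qed.

Lemma continuous_nm_circleB r a : 0 < r -> normc a != r ->
  continuous (fun x => normc (r%:C * cis x - a)).
Proof.
move=> r0 ar.
under eq_fun => x do rewrite -[normc _]lnK ?posrE ?nm_circleB_gt0//.
by apply: continuous_expR_fun; case: (cmean_ln_factor r0 ar).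
Qed.

Lemma nm_subC_sqr (z w : R[i]) : normc (z - w) ^+ 2 =
  normc z ^+ 2 + normc w ^+ 2 - 2 * Rp (conjc w * z).
Proof. by rewrite !nm_sqr; case: z w => x y [x' y'] /=; ring. Qed.

(** |z - a|^2 + (k r)^2 is again, on the circle |z| = r, the squared distance
    to a point, for a circle of slightly larger radius al that this point lies
    strictly inside of; hence its logarithmic mean is 2 ln al. *)
Lemma smoothed_kernel r a k : 0 < r -> 0 < k -> exists al (b : R[i]),
  [/\ Num.max r (normc a) <= al, al <= Num.max r (normc a) + k * r, normc b < al &
      forall x, normc (r%:C * cis x - a) ^+ 2 + (k * r) ^+ 2 = normc (al%:C * cis x - b) ^+ 2].
Proof.
move=> r0 k0; set n := normc a; have n0 : 0 <= n := nm_ge0 a.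
have kr : 0 < k * r by rewrite mulr_gt0.
(* The identity amounts to al^2 + |b|^2 = S and al |b| = r n, so that A = al^2
   is the larger root of A^2 - S A + (r n)^2. *)
pose S := r ^+ 2 + n ^+ 2 + (k * r) ^+ 2.
have Sn : 2 * r * n < S.
  have : 0 <= (r - n) ^+ 2 by rewrite sqr_ge0.
  by have := exprn_gt0 2 kr; rewrite /S; nra.
have S0 : 0 < S by apply: le_lt_trans Sn; rewrite !mulr_ge0// ltW.
pose D := S ^+ 2 - 4 * r ^+ 2 * n ^+ 2.
have D0 : 0 <= D.
  have -> : D = (S - 2 * r * n) * (S + 2 * r * n) by rewrite /D; ring.
  have rn0 : 0 <= 2 * r * n by rewrite !mulr_ge0// ltW.
  by apply: mulr_ge0; lra.
pose A := (S + Num.sqrt D) / 2.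
have hsq := sqr_sqrtr D0.
have A0 : 0 < A by rewrite divr_gt0// ltr_pwDl// sqrtr_ge0.
have An : r * n < A by have := sqrtr_ge0 D; rewrite /A; lra.
have AE : A ^+ 2 + r ^+ 2 * n ^+ 2 = S * A.
  by rewrite /A; move: hsq; set q := Num.sqrt D; rewrite /D; nra.
pose al := Num.sqrt A; have al0 : 0 < al by rewrite sqrtr_gt0.
have al2 : al ^+ 2 = A by rewrite sqr_sqrtr ?ltW.
pose be := r * n / al.
have be0 : 0 <= be by rewrite divr_ge0 ?mulr_ge0 ?(ltW r0) ?(ltW al0).
have beal : be < al by rewrite ltr_pdivrMr// -expr2 al2.
have albe : al * be = r * n by rewrite /be mulrCA divff ?mulr1// gt_eqF.
have sumE : al ^+ 2 + be ^+ 2 = S.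
  rewrite /be expr_div_n al2; apply: (mulIf (lt0r_neq0 A0)).
  by rewrite mulrDl divfK ?gt_eqF// -AE exprMn expr2.
have mx : r <= Num.max r n /\ n <= Num.max r n by rewrite !le_max !lexx orbT.
have mxc : Num.max r n = r \/ Num.max r n = n by case: leP; [right|left].
exists al, ((r / al)%:C * a); split.
- case: mx => h1 h2; rewrite leNgt; apply/negP => h.
  have : (al - be) ^+ 2 >= (r - n) ^+ 2.
    have -> : (al - be) ^+ 2 = S - 2 * (r * n) by rewrite -sumE -albe; ring.
    by rewrite /S; have := sqr_ge0 (k * r); nra.
  have : (al + be) ^+ 2 >= (r + n) ^+ 2.
    have -> : (al + be) ^+ 2 = S + 2 * (r * n) by rewrite -sumE -albe; ring.
    by rewrite /S; have := sqr_ge0 (k * r); nra.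
  rewrite (@ler_sqr R) ?nnegrE ?(addr_ge0 (ltW r0) n0) ?(addr_ge0 (ltW al0) be0)// => h3.
  have h4 : (al - be) ^+ 2 < `|r - n| ^+ 2.
    rewrite (@ltr_sqr R) ?nnegrE ?subr_ge0 ?(ltW beal)//.
    case: mxc h => -> h; [apply: lt_le_trans (ler_norm _)|rewrite distrC; apply: lt_le_trans (ler_norm _)]; lra.
  by rewrite real_normK ?num_real// in h4; rewrite leNgt h4.
- have h1 : al + be <= r + n + k * r.
    rewrite -(@ler_sqr R) ?nnegrE ?addr_ge0 ?(ltW al0) ?(ltW r0) ?(ltW kr)//.
    have -> : (al + be) ^+ 2 = S + 2 * (r * n) by rewrite -sumE -albe; ring.
    rewrite /S; have : 0 <= (r + n) * (k * r) by apply: mulr_ge0; lra.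
    nra.
  have h2 : al - be <= `|r - n| + k * r.
    rewrite -(@ler_sqr R) ?nnegrE ?subr_ge0 ?addr_ge0 ?(ltW beal) ?(ltW kr)//.
    have -> : (al - be) ^+ 2 = S - 2 * (r * n) by rewrite -sumE -albe; ring.
    rewrite sqrrD real_normK ?num_real// /S.
    have : 0 <= `|r - n| * (k * r) by rewrite mulr_ge0// ltW.
    by rewrite mulr2n; nra.
  have : r + n + `|r - n| = 2 * Num.max r n.
    by case: (leP r n) => h; [rewrite ler0_norm ?subr_le0//|rewrite gtr0_norm ?subr_gt0//]; ring.
  by lra.
- by rewrite normcM nm_real ger0_norm ?divr_ge0 ?ltW// -mulrAC.
move=> x; rewrite !nm_subC_sqr !nm_circle ?(ltW r0) ?(ltW al0)//.
rewrite normcM nm_real ger0_norm ?divr_ge0 ?ltW//.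
have -> : (r / al * n) ^+ 2 = be ^+ 2 by rewrite /be; congr (_ ^+ 2); ring.
have -> : conjc ((r / al)%:C * a) * (al%:C * cis x) = conjc a * (r%:C * cis x).
  have -> : conjc ((r / al)%:C * a) = (r / al)%:C * conjc a.
    by case: (a) => p q /=; rewrite /conjc /=; congr (_ +i* _); ring.
  have -> : r%:C = (r / al)%:C * al%:C :> R[i].
    by rewrite -rmorphM divfK// gt_eqF.
  by ring.
by rewrite sumE /S /n; ring.
Qed.

Lemma cmean_smoothed r a k : 0 < r -> 0 < k ->
  let v x := ln (normc (r%:C * cis x - a) ^+ 2 + (k * r) ^+ 2) in
  [/\ continuous v, 2 * ln (Num.max r (normc a)) <= cmean v &
      cmean v <= 2 * ln (Num.max r (normc a) + k * r)].
Proof.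
move=> r0 k0; have [al [b [h1 h2 h3 h4]]] := smoothed_kernel a r0 k0.
have m0 : 0 < Num.max r (normc a) by rewrite lt_max r0.
have al0 : 0 < al by apply: lt_le_trans h1.
have bal : normc b != al by rewrite lt_eqF.
have [c m] := cmean_ln_factor al0 bal.
have E x : ln (normc (r%:C * cis x - a) ^+ 2 + (k * r) ^+ 2) = 2 * ln (normc (al%:C * cis x - b)).
  by rewrite h4 lnXn ?nm_circleB_gt0// mulr_natl.
move=> v; rewrite /v.
have cE : cmean v = 2 * ln al.
  rewrite /v; under eq_fun do rewrite E.
  by rewrite cmeanZ// m max_l// ltW.
rewrite -/v cE; split.
- by rewrite /v; under eq_fun do rewrite E; exact: continuousZ_fun.
- by rewrite ler_pM2l// ler_ln ?posrE.
- by rewrite ler_pM2l// ler_ln ?posrE// addr_gt0// mulr_gt0.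
Qed.

Lemma ln1D_ge (y : R) : 0 <= y -> y / (1 + y) <= ln (1 + y).
Proof.
move=> y0; have y1 : 0 < 1 + y by rewrite ltr_pwDl.
have := @ln_le_diff R 1 (1 + y) ltr01 y1; rewrite ln1 sub0r => h.
by rewrite lerNl in h; apply: le_trans h; rewrite -mulNr opprB addrAC subrr add0r.
Qed.

(** For y at most ta the first term suffices; beyond, ln (1 + y^2) is at least
    of order ta y. This replaces the kernel by one whose mean is known exactly. *)
Lemma ln1D_split (y ta : R) : 0 <= y -> 0 < ta -> ta <= 1 ->
  ln (1 + y) <= ta + 2 / ta * ln (1 + y ^+ 2).
Proof.
move=> y0 t0 t1; have l0 : 0 <= ln (1 + y ^+ 2) by rewrite ln_ge0// lerDl sqr_ge0.
have q0 : 0 <= 2 / ta * ln (1 + y ^+ 2) by rewrite mulr_ge0// divr_ge0// ltW.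
have ly : ln (1 + y) <= y by apply: le_ln1Dx; lra.
have [yt|ty] := leP y ta; first by lra.
have [y1|y1] := leP y 1.
  suff : y <= 2 / ta * ln (1 + y ^+ 2) by lra.
  have h := ln1D_ge (sqr_ge0 y).
  have h2 : y ^+ 2 / 2 <= ln (1 + y ^+ 2).
    apply: le_trans h; rewrite ler_wpM2l ?sqr_ge0// lef_pV2 ?posrE ?ltr_pwDl ?sqr_ge0//.
    by have : y ^+ 2 <= 1; [rewrite expr_le1|lra].
  apply: le_trans (_ : 2 / ta * (y ^+ 2 / 2) <= _); last by rewrite ler_pM2l// divr_gt0.
  have -> : 2 / ta * (y ^+ 2 / 2) = y ^+ 2 / ta by field; rewrite gt_eqF.
  by rewrite ler_pdivlMr// expr2 ler_wpM2l// ltW.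
have h3 : ln (1 + y) <= ln (1 + y ^+ 2).
  rewrite ler_ln ?posrE ?ltr_pwDl ?sqr_ge0// lerD2l expr2 ler_peMl// ltW//.
have : 1 * ln (1 + y ^+ 2) <= 2 / ta * ln (1 + y ^+ 2).
  by rewrite ler_wpM2r// ler_pdivlMr// mul1r; lra.
by lra.
Qed.

(** Moving a point of the circle by k r changes its logarithmic distance to a
    by at most this mean, which is small with k uniformly in a. *)
Lemma cmean_ln1D r a k : 0 < r -> 0 < k -> k <= 1 -> normc a != r ->
  continuous (fun x => ln (1 + k * r / normc (r%:C * cis x - a))) /\
  cmean (fun x => ln (1 + k * r / normc (r%:C * cis x - a))) <= 5 * Num.sqrt k.
Proof.
move=> r0 k0 k1 ar; have d0 x := nm_circleB_gt0 x r0 ar.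
have kr : 0 < k * r by rewrite mulr_gt0.
have cd := continuous_nm_circleB r0 ar.
have [cl ml] := cmean_ln_factor r0 ar.
have [cs _ ms] := cmean_smoothed a r0 k0.
set M := Num.max r (normc a) in ml ms *.
have m0 : 0 < M by rewrite lt_max r0.
have rM : r <= M by rewrite le_max lexx.
have E1 x : ln (1 + k * r / normc (r%:C * cis x - a)) =
  ln (normc (r%:C * cis x - a) + k * r) + -1 * ln (normc (r%:C * cis x - a)).
  rewrite mulN1r -ln_div ?posrE ?addr_gt0//; congr ln.
  by field; rewrite gt_eqF.
have c1 : continuous (fun x => ln (1 + k * r / normc (r%:C * cis x - a))).
  under eq_fun do rewrite E1; apply: continuousD_fun; last exact: continuousZ_fun.
  apply: continuous_ln_pos; last by move=> x; rewrite addr_gt0.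
  by apply: continuousD_fun => // x; exact: cst_continuous.
split=> //.
set ta := Num.sqrt k; have t0 : 0 < ta by rewrite sqrtr_gt0.
have t1 : ta <= 1 by rewrite -sqrtr1 ler_wsqrtr.
have tk : ta ^+ 2 = k by rewrite sqr_sqrtr// ltW.
pose w x := ln (normc (r%:C * cis x - a) ^+ 2 + (k * r) ^+ 2) + (-2) * ln (normc (r%:C * cis x - a)).
have cw : continuous w by apply: continuousD_fun => //; exact: continuousZ_fun.
have E2 x : ln (1 + (k * r / normc (r%:C * cis x - a)) ^+ 2) = w x.
  rewrite /w mulNr; have -> : 2 * ln (normc (r%:C * cis x - a)) = ln (normc (r%:C * cis x - a) ^+ 2).
    by rewrite lnXn// mulr_natl.
  rewrite -ln_div ?posrE ?addr_gt0 ?exprn_gt0//; congr ln.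
  by field; rewrite gt_eqF.
have cc : continuous (fun _ : R => ta) by move=> x; exact: cst_continuous.
apply: le_trans (_ : cmean (fun x => ta + 2 / ta * w x) <= _).
  apply: cmean_le => //; first by apply: continuousD_fun => //; exact: continuousZ_fun.
  by move=> x; rewrite -E2; apply: ln1D_split => //; rewrite divr_ge0 ?ltW.
rewrite cmeanD ?cmeanZ ?cmean_cst//; last exact: continuousZ_fun.
rewrite {1}/w cmeanD ?cmeanZ ?ml//; last exact: continuousZ_fun.
have h : ln (M + k * r) - ln M <= k.
  apply: le_trans (ln_le_diff _ m0) _; first by rewrite addr_gt0.
  by rewrite [M + _]addrC addrK ler_pdivrMr// ler_pM2l.
set X := cmean _ in ms *.
have h2 : X + - 2 * ln M <= 2 * k by lra.
have : 2 / ta * (X + - 2 * ln M) <= 2 / ta * (2 * k) by rewrite ler_pM2l// divr_gt0.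
have -> : 2 / ta * (2 * k) = 4 * ta by rewrite -tk; field; rewrite gt_eqF.
by lra.
Qed.
End SmoothedKernel.

Import HBNNSimple.

Section LogarithmicPoles.
Variable R : realType.
Local Notation leb := (@lebesgue_measure R).
Implicit Types (r e k A K B : R) (a : R[i]) (s : seq R[i]).

(** The smoothed kernels exceed any bound near the points of s, and are close to
    the kernels away from them. *)
Lemma smoothed_dominates r A K e B s :
  0 < r -> 0 <= A -> 0 < e -> (forall a, a \in s -> 2 * r + normc a <= K) ->
  exists k, [/\ 0 < k, k <= 1 & forall x y, y <= B ->
    ((forall a, a \in s -> r%:C * cis x != a) ->
       y <= A + \sum_(a <- s) ln (K / normc (r%:C * cis x - a))) ->
    y <= A + \sum_(a <- s)
       (ln K + (- 2^-1) * ln (normc (r%:C * cis x - a) ^+ 2 + (k * r) ^+ 2)) + e].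
Proof.
move=> r0 A0 e0 sK.
have [s0|sn0] := eqVneq s [::].
  exists 1; split=> // x y _; rewrite s0 !big_nil !addr0 => h.
  by apply: le_trans (h _) _ => //; rewrite lerDl ltW.
have K0 : 0 < K.
  case: s sn0 sK => // a s _ /(_ a (mem_head _ _)); apply: lt_le_trans.
  by rewrite ltr_wpDr ?nm_ge0// mulr_gt0.
(* Within de of a point of s the smoothed kernel exceeds B. *)
pose de := K * expR (- B) / 2.
have de0 : 0 < de by rewrite divr_gt0// mulr_gt0// expR_gt0.
have sz0 : 0 < (size s)%:R :> R by rewrite ltr0n; case: (s) sn0.
pose k := Num.min 1 (Num.min (de / r) (de * (e / (size s)%:R) / r)).
have kp1 : 0 < de / r by exact: divr_gt0.
have kp2 : 0 < de * (e / (size s)%:R) / r by apply: divr_gt0 => //; apply: mulr_gt0 => //; exact: divr_gt0.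
have k0 : 0 < k by rewrite !lt_min ltr01 kp1.
have k1 : k <= 1 by rewrite ge_min lexx.
have kde : k * r <= de by rewrite -ler_pdivlMr// !ge_min lexx !orbT.
have kde2 : k * r / de <= e / (size s)%:R.
  by rewrite ler_pdivrMr// [leRHS]mulrC -ler_pdivlMr// !ge_min lexx !orbT.
have kr0 : 0 < k * r by rewrite mulr_gt0.
exists k; split=> // x y yB hy.
pose d a := normc (r%:C * cis x - a).
pose ta a := ln K + (- 2^-1) * ln (d a ^+ 2 + (k * r) ^+ 2).
rewrite -/(\sum_(a <- s) ta a).
have d0 a : 0 <= d a by exact: nm_ge0.
have dK a : a \in s -> d a + k * r <= K.
  move=> /sK; have : d a <= r + normc a.
    by apply: le_trans (nm_leB2 _ _) _; rewrite nm_circle// ltW.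
  have : k * r <= r by rewrite ler_piMl// ltW.
  by lra.
have sq0 a : 0 < d a ^+ 2 + (k * r) ^+ 2 by rewrite ltr_wpDl ?sqr_ge0// exprn_gt0.
have ta0 a : a \in s -> 0 <= ta a.
  move=> /dK aK; suff : ln (d a ^+ 2 + (k * r) ^+ 2) <= 2 * ln K by rewrite /ta; lra.
  have -> : 2 * ln K = ln (K ^+ 2) by rewrite lnXn// mulr_natl.
  rewrite ler_ln ?posrE ?exprn_gt0//.
  have : (d a + k * r) ^+ 2 <= K ^+ 2.
    by rewrite ler_sqr ?nnegrE ?addr_ge0 ?(ltW kr0) ?(ltW K0).
  by have : 0 <= d a * (k * r) by [rewrite mulr_ge0// ltW]; nra.
have [/hasP[a sa aclose]|/hasPn far] := boolP (has (fun a => d a <= de) s).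
  have h1 : B <= ta a.
    suff : ln (d a ^+ 2 + (k * r) ^+ 2) <= 2 * (ln K - B) by rewrite /ta; lra.
    have -> : 2 * (ln K - B) = ln ((K * expR (- B)) ^+ 2).
      by rewrite lnXn ?mulr_gt0 ?expR_gt0// lnM ?posrE ?expR_gt0// expRK mulr_natl.
    rewrite ler_ln ?posrE ?exprn_gt0 ?mulr_gt0 ?expR_gt0//.
    have -> : K * expR (- B) = 2 * de by rewrite /de; field.
    have h1 : d a ^+ 2 <= de ^+ 2 by rewrite ler_sqr ?nnegrE// ltW.
    have h2 : (k * r) ^+ 2 <= de ^+ 2 by rewrite ler_sqr ?nnegrE// ltW.
    have := sqr_ge0 de; have -> : (2 * de) ^+ 2 = 4 * de ^+ 2 by ring.
    by lra.
  have h2 : ta a <= \sum_(a <- s) ta a.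
    rewrite (big_rem a)//= lerDl big_seq sumr_ge0// => b bs.
    by rewrite ta0// (mem_rem bs).
  by lra.
have dde a : a \in s -> de < d a by move=> /far; rewrite -ltNge.
have {}hy : y <= A + \sum_(a <- s) ln (K / d a).
  apply: hy => a sa; rewrite -subr_eq0 -nm_gt0; apply: lt_trans (dde a sa).
  exact: de0.
have term a : a \in s -> ln (K / d a) <= ta a + e / (size s)%:R.
  move=> sa; have dpos := lt_trans de0 (dde a sa).
  have h2 : ln (d a ^+ 2 + (k * r) ^+ 2) - ln (d a ^+ 2) <= (k * r / de) ^+ 2.
    have p2 := exprn_gt0 2 dpos.
    apply: le_trans (ln_le_diff (sq0 a) p2) _.
    have q1 : 0 <= k * r / d a by apply: divr_ge0; exact: ltW.
    have q2 : 0 <= k * r / de by apply: divr_ge0; exact: ltW.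
    rewrite addrAC subrr add0r -expr_div_n ler_sqr ?nnegrE//.
    by rewrite ler_wpM2l ?(ltW kr0)// lef_pV2 ?posrE// ltW// dde.
  have h3 : (k * r / de) ^+ 2 <= k * r / de.
    have q0 : 0 <= k * r / de by apply: divr_ge0; exact: ltW.
    have q1 : k * r / de <= 1 by rewrite ler_pdivrMr ?mul1r//; exact: de0.
    by rewrite expr2 ler_piMl.
  rewrite ln_div ?posrE// /ta; move: h2; rewrite (lnXn 2 dpos) mulr2n.
  have : 0 <= e / (size s)%:R by rewrite divr_ge0 ?ltW.
  by lra.
apply: le_trans hy _; rewrite -addrA lerD2l.
apply: le_trans (_ : \sum_(a <- s) (ta a + e / (size s)%:R) <= _).
  by rewrite big_seq [leRHS]big_seq; apply: ler_sum.
rewrite big_split /= lerD2l big_const_seq count_predT iter_addr_0.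
by rewrite -[_ *+ size s]mulr_natr divfK// gt_eqF.
Qed.

(** A nonnegative function on a circle dominated, off finitely many points, by
    logarithmic kernels. The points may lie on the circle: every simple function
    below u is bounded, hence dominated by the smoothed kernels up to any
    positive constant. *)
Lemma cmean_le_log (u : R -> R) r A K s :
  0 < r -> 0 <= A -> (forall x, 0 <= u x) ->
  (forall a, a \in s -> 2 * r + normc a <= K) ->
  (forall x, (forall a, a \in s -> r%:C * cis x != a) ->
     u x <= A + \sum_(a <- s) ln (K / normc (r%:C * cis x - a))) ->
  cmean u <= A + \sum_(a <- s) (ln K - ln (Num.max r (normc a))).
Proof.
move=> r0 A0 u0 sK hu; set M := A + _.
pose D : set (measurableTypeR R) := `[0, 2 * pi]%classic.
have mD : measurable D by exact: measurable_itv.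
have pp : 0 < 2 * pi :> R by rewrite mulr_gt0// pi_gt0.
have main (h : {nnsfun (measurableTypeR R) >-> R}) :
    (forall x, ((h x)%:E <= ((EFin \o u) \_ D) x)%E) ->
    (sintegral leb h <= (2 * pi * M)%:E)%E.
  move=> hle; apply/lee_addgt0Pr => e0 e00.
  pose e := e0 / (2 * pi); have eps0 : 0 < e by rewrite divr_gt0.
  have [B hB] : exists B, forall x, h x <= B.
    have [N [_ hN]] := simple_bounded h.
    exists (`|N| + 1); move=> x; apply: le_trans (ler_norm _) _; apply: hN => //.
    by rewrite (le_lt_trans (ler_norm N))// ltrDl.
  have [k [k0 k1 hk]] := smoothed_dominates B r0 A0 eps0 sK.
  pose T a (x : R) := ln (normc (r%:C * cis x - a) ^+ 2 + (k * r) ^+ 2).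
  pose v (x : R) := A + e + \sum_(a <- s) (ln K + (- 2^-1) * T a x).
  have cT a : continuous (T a) by case: (cmean_smoothed a r0 k0).
  have cc (y : R) : continuous (fun _ : R => y) by move=> x; exact: cst_continuous.
  have cv1 a : continuous (fun x => ln K + (- 2^-1) * T a x).
    by apply: continuousD_fun => //; exact: continuousZ_fun.
  have cv : continuous v.
    by apply: continuousD_fun => //; apply: continuous_sum_fun => a _; exact: cv1.
  have hv x : D x -> h x <= v x.
    move=> Dx; have hux : h x <= u x by have := hle x; rewrite patchE mem_set//= lee_fin.
    by rewrite /v addrAC; apply: hk => // /hu; apply: le_trans.
  have hE : sintegral leb h = (\int[leb]_(x in D) (h x)%:E)%E.
    rewrite integral_nnsfun//; congr sintegral; apply/funext => x.
    rewrite patchE; case: ifPn => // xD; apply/eqP; rewrite eq_le fun_ge0 andbT.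
    by have := hle x; rewrite patchE (negbTE xD).
  have mv : cmean v <= M + e.
    rewrite /v cmeanD//; last by apply: continuous_sum_fun => a _; exact: cv1.
    rewrite cmean_cst cmean_sum; last by move=> a _; exact: cv1.
    rewrite /M addrAC lerD2r lerD2l; apply: ler_sum => a _.
    rewrite cmeanD ?cmeanZ ?cmean_cst//; last exact: continuousZ_fun.
    by have [_ + _] := cmean_smoothed a r0 k0; rewrite -/(T a); lra.
  rewrite hE; apply: le_trans (_ : \int[leb]_(x in D) (v x)%:E <= _)%E.
    apply: ge0_le_integral => //.
    - by move=> x _; rewrite lee_fin fun_ge0.
    - by apply/measurable_EFinP; exact: measurable_funTS.
    - by apply/measurable_EFinP; apply: measurable_funTS; exact: continuous_measurable_fun.
  have iv := continuous_cintegrable cv.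
  rewrite -(fineK (integrable_fin_num mD iv)) -EFinD lee_fin.
  have -> : fine (\int[leb]_(x in D) (EFin \o v) x)%E = 2 * pi * cmean v.
    by rewrite /cmean mulrA divff ?mul1r// gt_eqF.
  have -> : e0 = 2 * pi * e by rewrite /e mulrC divfK// gt_eqF.
  by rewrite -mulrDr ler_pM2l.
have int_le : (\int[leb]_(x in D) (u x)%:E <= (2 * pi * M)%:E)%E.
  rewrite ge0_integralE; last by move=> x _; rewrite lee_fin.
  by apply: ge_ereal_sup => _ [h hle <-]; exact: main.
have int_ge : (0 <= \int[leb]_(x in D) (u x)%:E)%E.
  by apply: integral_ge0 => x _; rewrite lee_fin.
rewrite /cmean mulrC ler_pdivrMr// [leRHS]mulrC /Rintegral -lee_fin fineK//.
by rewrite ge0_fin_numE// (le_lt_trans int_le)// ltry.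
Qed.
End LogarithmicPoles.

Section LogOnCircles.
Variable R : realType.
Implicit Types f : R[i] -> R[i].

Lemma ln_nm_prod (s : seq R[i]) z : (forall a, a \in s -> z != a) ->
  ln (normc (\prod_(a <- s) (z - a))) = \sum_(a <- s) ln (normc (z - a)).
Proof.
elim: s => [|a s IH] h; first by rewrite !big_nil (@nm_nat R 1) ln1.
rewrite !big_cons normcM lnM ?posrE ?nm_gt0 ?IH//.
- by move=> b bs; rewrite h// inE bs orbT.
- by rewrite subr_eq0 h ?mem_head.
- rewrite prodf_seq_neq0; apply/allP => b bs; apply/implyP => _.
  by rewrite subr_eq0 h// inE bs orbT.
Qed.

Lemma proximityE r f : proximity r f = cmean (fun x => logp (normc (f (r%:C * cis x)))).
Proof. by rewrite /proximity /cmean; under eq_Rintegral do rewrite polarE. Qed.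

Lemma proximity_ge0 r f : 0 <= proximity r f.
Proof. by rewrite proximityE; apply: cmean_ge0 => x; rewrite /logp le_max lexx orbT. Qed.

Lemma continuous_max0 (u : R -> R) : continuous u -> continuous (fun x => Num.max (u x) 0).
Proof.
move=> cu x; have := @continuous_max R R u (fun=> 0) x (cu x); apply; exact: cst_continuous.
Qed.

(** The function log+ x - log+ (1/x) is ln x. *)
Lemma proximity_diff r f : 0 <= r ->
  continuous (fun x => ln (normc (f (r%:C * cis x)))) ->
  proximity r f - proximity r (recip f) = cmean (fun x => ln (normc (f (r%:C * cis x)))).
Proof.
move=> r0 cu; rewrite !proximityE.
set u := (fun x => ln (normc (f (r%:C * cis x)))) in cu *.
have cNu := @continuousZ_fun _ (-1) _ cu.
have c1 := continuous_max0 cu; have c2 := continuous_max0 cNu.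
have c3 := @continuousZ_fun _ (-1) _ c2.
have -> : (fun x => logp (normc (f (r%:C * cis x)))) = (fun x => Num.max (u x) 0) by [].
have -> : (fun x => logp (normc (recip f (r%:C * cis x)))) = (fun x => Num.max (-1 * u x) 0).
  apply/funext => x; rewrite /logp /recip /u normcV mulN1r.
  have [n0|n0] := ltP 0 (normc (f (r%:C * cis x))); first by rewrite lnV.
  by rewrite [ln _^-1]ln0 ?invr_le0// [ln (normc _)]ln0// oppr0.
rewrite -[X in _ - X = _]mul1r -mulNr -(@cmeanZ _ _ _ c2) -(@cmeanD _ _ _ c1 c3).
congr cmean; apply/funext => x; rewrite mulN1r.
by have [h|h] := leP (u x) 0; [rewrite max_l; lra|rewrite max_r; lra].
Qed.
End LogOnCircles.

(** * Pole orders and the counting function *)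

Section CountingFunction.
Variable R : realType.
Local Notation C := R[i]^o.
Local Notation leb := (@lebesgue_measure R).
Implicit Types (r t : R) (S : seq C) (g : C -> C) (b : C).

Lemma pole_countE g S t r : t <= r ->
  (forall z : C, normc z <= r -> pole_mult g z = count_mem z S) ->
  pole_count t g = \sum_(b <- S) (normc b <= t)%R%:R.
Proof.
move=> tr hS; rewrite /pole_count.
pose s := [seq z <- undup S | normc z <= t].
rewrite (@fsbigE _ _ _ _ _ s); last 3 first.
- by rewrite filter_uniq// undup_uniq.
- by move=> z /=; rewrite mem_filter => /andP[].
- move=> z /= zt; rewrite mem_filter zt mem_undup /= => zS.
  by rewrite hS ?(le_trans zt)// (count_memPn zS).
rewrite big_filter_cond.
transitivity (\sum_(z <- undup S | normc z <= t) iterop (count_mem z S) +%R (1 : R) 0).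
  apply: eq_big => z; first by rewrite mem_setE; case E : (normc z <= t); rewrite ?andbF//=; apply/mem_set.
  by move=> /andP[zt _]; rewrite hS ?(le_trans zt).
rewrite big_undup_iterop_count big_mkcond /=.
by apply: eq_bigr => b _; case: ifP.
Qed.

Lemma integral_inv (a r : R) : 0 < a -> a <= r ->
  \int[leb]_(t in `[a, r]) t^-1 = ln r - ln a /\
  leb.-integrable `[a, r] (EFin \o (fun t : R => t^-1)).
Proof.
move=> a0; rewrite le_eqVlt => /orP[/eqP <-|ar].
  rewrite set_itv1 Rintegral_set1 subrr; split=> //.
  by apply: continuous_compact_integrable;
     [exact: compact_set1|exact: continuous_subspace1].
have cinv : {within `[a, r], continuous (fun t : R => t^-1)}.
  apply: continuous_in_subspaceT => t; rewrite inE /= in_itv /= => /andP[at_ _].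
  by apply: inv_continuous; rewrite gt_eqF// (lt_le_trans a0).
split; last by apply: continuous_compact_integrable => //; exact: segment_compact.
rewrite /Rintegral (@continuous_FTC2 _ (fun t : R => t^-1) (@ln R) a r)//.
- split.
  + move=> x; rewrite in_itv /= => /andP[ax _].
    by have [] := is_derive1_ln (lt_trans a0 ax).
  + by apply: cvg_at_right_filter; exact: continuous_ln.
  + by apply: cvg_at_left_filter; apply: continuous_ln; exact: lt_trans ar.
- move=> x; rewrite in_itv /= => /andP[ax _].
  by rewrite derive1E; apply: derive_val; apply: is_derive1_ln; exact: lt_trans ax.
Qed.

Lemma eq_Rintegral_itv (u v : R -> R) r : (forall t, 0 <= t <= r -> u t = v t) ->
  \int[leb]_(t in `[0, r]) u t = \int[leb]_(t in `[0, r]) v t.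
Proof. by move=> uv; apply: eq_Rintegral => t; rewrite inE /= in_itv /=; exact: uv. Qed.

Lemma eq_integrable_itv (u v : R -> R) r : (forall t, 0 <= t <= r -> u t = v t) ->
  leb.-integrable `[0, r] (EFin \o v) -> leb.-integrable `[0, r] (EFin \o u).
Proof.
move=> uv; apply: eq_integrable; first exact: measurable_itv.
by move=> t; rewrite inE /= in_itv /= => /uv ->.
Qed.

(** The contribution of one point to the integrated counting function. *)
Lemma integral_count_point b r : 0 < r ->
  let phi t := ((normc b <= t)%R%:R - (normc b <= 0)%R%:R) / t in
  leb.-integrable `[0, r] (EFin \o phi) /\
  \int[leb]_(t in `[0, r]) phi t + (normc b <= 0)%R%:R * ln r
    = ln (Num.max r (normc b)) - ln (normc b).
Proof.
move=> r0 phi; have b0 : 0 <= normc b := nm_ge0 b.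
have mD : measurable (`[0, r]%classic : set (measurableTypeR R)) by exact: measurable_itv.
have [nb|nb] := leP (normc b) 0.
  have E (t : R) : 0 <= t <= r -> phi t = 0.
    by move=> /andP[t0 _]; rewrite /phi nb (le_trans nb t0) subrr mul0r.
  have nb0 : normc b = 0 by apply/eqP; rewrite eq_le nb.
  split.
    apply: (eq_integrable_itv E); exact: integrable0.
  rewrite (eq_Rintegral_itv E).
  by rewrite Rintegral_cst// mul0r add0r mul1r nb0 (@ln0 R 0)// subr0 max_l// ltW.
have nb' : (normc b <= 0) = false by rewrite leNgt nb.
pose P : set (measurableTypeR R) := `[normc b, +oo[%classic.
have mP : measurable P by exact: measurable_itv.
have E (t : R) : 0 <= t <= r -> phi t = ((fun t : R => t^-1) \_ P) t.
  move=> _; rewrite /phi patchE nb' subr0.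
  have -> : (t \in P) = (normc b <= t).
    apply/idP/idP => [/set_mem|bt]; first by rewrite /P /= in_itv /= andbT.
    by apply/mem_set; rewrite /P /= in_itv /= andbT.
  by case: ifP; rewrite ?mul1r ?mul0r.
have DP : `[0, r]%classic `&` P = `[normc b, r]%classic.
  rewrite /P eqEsubset; split=> t /=; rewrite !in_itv /= andbT.
    by move=> [/andP[_ ->] ->].
  by move=> /andP[bt ->]; rewrite bt (le_trans b0 bt).
have [br|rb] := leP (normc b) r.
  have [iE ii] := integral_inv nb br.
  split.
    apply: (eq_integrable_itv E).
    rewrite -restrict_EFin; apply: (@integrable_mkcond _ (measurableTypeR R) R leb _ _ mD).2.
    have mI : measurable (`[normc b, r]%classic : set (measurableTypeR R)).
      exact: measurable_itv.
    have := (@integrable_mkcond _ (measurableTypeR R) R leb _ (EFin \o (fun t : R => t^-1)) mI).1 ii.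
    by rewrite -DP patch_setI.
  rewrite (eq_Rintegral_itv E) -Rintegral_mkcondr DP iE.
  by rewrite mul0r addr0.
have E' (t : R) : 0 <= t <= r -> phi t = 0.
  move=> /andP[_ tr]; rewrite /phi nb' subr0.
  by rewrite leNgt (le_lt_trans tr rb) mul0r.
split.
  apply: (eq_integrable_itv E'); exact: integrable0.
rewrite (eq_Rintegral_itv E').
by rewrite Rintegral_cst// !mul0r addr0 subrr.
Qed.

Lemma integrated_countE g S r : 0 < r ->
  (forall z : C, normc z <= r -> pole_mult g z = count_mem z S) ->
  integrated_count r g = \sum_(b <- S) (ln (Num.max r (normc b)) - ln (normc b)).
Proof.
move=> r0 hS; rewrite /integrated_count.
have mD : measurable (`[0, r]%classic : set (measurableTypeR R)) by exact: measurable_itv.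
have E (t : R) : 0 <= t <= r -> (pole_count t g - pole_count 0 g) / t =
    \sum_(b <- S) ((normc b <= t)%R%:R - (normc b <= 0)%R%:R) / t.
  move=> /andP[t0 tr].
  by rewrite (pole_countE tr hS) (pole_countE (ltW r0) hS) -mulr_suml sumrB.
rewrite (eq_Rintegral_itv E) (pole_countE (ltW r0) hS) {E hS}.
suff [_ ->] : leb.-integrable `[0, r] (EFin \o (fun t : R => \sum_(b <- S) ((normc b <= t)%R%:R - (normc b <= 0)%R%:R) / t)) /\
    \int[leb]_(t in `[0, r]) (\sum_(b <- S) ((normc b <= t)%R%:R - (normc b <= 0)%R%:R) / t)
    = \sum_(b <- S) (ln (Num.max r (normc b)) - ln (normc b) - (normc b <= 0)%R%:R * ln r).
  by rewrite sumrB mulr_suml subrK.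
elim: S => [|b S [IH1 IH2]].
  under [X in Rintegral _ _ X]eq_fun do rewrite big_nil.
  rewrite big_nil Rintegral_cst// mul0r; split=> //.
  rewrite (_ : _ \o _ = cst 0%E); first exact: integrable0.
  by apply/funext => t /=; rewrite big_nil.
have [i1 i2] := integral_count_point b r0.
under [X in Rintegral _ _ X]eq_fun do rewrite big_cons.
rewrite (RintegralD mD i1 IH1) IH2 big_cons -i2 addrK; split=> //.
have := integrableD mD i1 IH1; apply: eq_integrable => // t _ /=.
by rewrite big_cons EFinD.
Qed.
End CountingFunction.

Section PoleOrders.
Variable R : realType.
Local Notation C := R[i]^o.
Implicit Types (f g h : C -> C) (a z : C).

Lemma derivable_inv g a : g a != 0 -> derivable g a 1 -> derivable (fun z => (g z)^-1) a 1.
Proof.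
move=> ga0 dg; have /cvg_ex[l hl] := dg.
have c2 : (fun x : C => g (x *: (1 : C) + a)) x @[x --> 0^'] --> g a.
  apply/cvgrPdist_lt => _ /posC[e e0 ->].
  have [d d0 hd] := derivable_nm_continuous dg e0.
  apply/dnear_nmP; exists d => // x _; rewrite subr0 => xd.
  by rewrite normC_lt nmB hd// addrK /GRing.scale /= mulr1.
have c3 : (fun x : C => x^-1 *: ((g \o shift a) (x *: (1 : C)) - g a)
    * (g (x *: (1 : C) + a))^-1 * (- (g a)^-1)) x @[x --> 0^'] --> l * (g a)^-1 * (- (g a)^-1).
  by apply: cvgM; [apply: cvgM; [exact: hl|exact: cvgV ga0 c2]|exact: cvg_cst].
apply/cvg_ex; exists (l * (g a)^-1 * (- (g a)^-1)); apply: cvg_trans c3; apply: near_eq_cvg.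
have ga0' : 0 < normc (g a) by rewrite nm_gt0.
have [d d0 hd] := derivable_nm_continuous dg ga0'.
apply/dnear_nmP; exists d => // x x0; rewrite subr0 => xd.
have gx0 : g (x *: (1 : C) + a) != 0.
  apply/negP => /eqP h; have := hd (x *: (1 : C) + a).
  by rewrite h sub0r normcN ltxx addrK /GRing.scale /= mulr1 => /(_ xd).
rewrite /GRing.scale /= in gx0 *; move: gx0; move: (g (x * 1 + a)) => y y0.
by field; rewrite ga0 y0.
Qed.

Lemma holomorphicM g h a : holomorphic_at g a -> holomorphic_at h a ->
  holomorphic_at (fun z => g z * h z) a.
Proof.
move=> /near_nmP[d d0 hd] /near_nmP[d' d'0 hd']; apply/near_nmP.
exists (Num.min d d'); first by rewrite lt_min d0.
move=> z; rewrite lt_min => /andP[zd zd'].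
exact: (@derivableM _ _ g h z 1 (hd z zd) (hd' z zd')).
Qed.

Lemma holomorphic_continuous g a : holomorphic_at g a ->
  forall e : R, 0 < e -> exists2 d : R, 0 < d & forall z, normc (z - a) < d ->
    normc (g z - g a) < e.
Proof. by move=> /nbhs_singleton; exact: derivable_nm_continuous. Qed.

Lemma holomorphicV g a : g a != 0 -> holomorphic_at g a ->
  holomorphic_at (fun z => (g z)^-1) a.
Proof.
move=> ga0 hg; have ga0' : 0 < normc (g a) by rewrite nm_gt0.
have [d d0 hd] := holomorphic_continuous hg ga0'.
have [d' d'0 hd'] := (near_nmP _ _).1 hg.
apply/near_nmP; exists (Num.min d d'); first by rewrite lt_min d0.
move=> z; rewrite lt_min => /andP[zd zd']; apply: derivable_inv; last exact: hd'.
apply/negP => /eqP gz; have := hd z zd; by rewrite gz sub0r normcN ltxx.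
Qed.

Lemma holomorphic_cst (k : C) a : holomorphic_at (fun=> k) a.
Proof. by apply/near_nmP; exists 1 => // z _; exact: derivable_cst. Qed.

Lemma holomorphic_subr (b : C) a : holomorphic_at (fun z => z - b) a.
Proof.
apply/near_nmP; exists 1 => // z _; exact: derivableB.
Qed.

Lemma holomorphic_prod (s : seq C) (P : pred C) a :
  holomorphic_at (fun z => \prod_(b <- s | P b) (z - b)) a.
Proof.
elim: s => [|b s IH].
  by under eq_fun do rewrite big_nil; exact: holomorphic_cst.
under eq_fun do rewrite big_cons.
case: (P b); last exact IH.
exact: (@holomorphicM (fun z => z - b) _ a (holomorphic_subr b a) IH).
Qed.

(** The order of vanishing is i - j; allowing both exponents treats a function
    and its reciprocal symmetrically. *)
Definition local_form f a (i j : nat) : Prop := exists g, [/\ holomorphic_at g a, g a != 0 &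
  \forall z \near a^', f z = g z * (z - a) ^+ i / (z - a) ^+ j].

(** Otherwise g would be, near a, a multiple of h by a positive power of z - a,
    hence arbitrarily small. *)
Lemma vanishing_order g h a i j : holomorphic_at g a -> holomorphic_at h a ->
  g a != 0 -> (\forall z \near a^', g z * (z - a) ^+ i = h z * (z - a) ^+ j) ->
  (j <= i)%N.
Proof.
move=> hg hh ga0 /dnear_nmP[d d0 hd]; rewrite leqNgt; apply/negP => ij.
have g0 : 0 < normc (g a) / 2 by rewrite divr_gt0 ?nm_gt0.
have [d1 d10 hd1] := holomorphic_continuous hg g0.
have [d2 d20 hd2] := holomorphic_continuous hh ltr01.
pose M := normc (h a) + 1; have M0 : 0 < M by rewrite ltr_wpDl ?nm_ge0.
pose x := Num.min (Num.min d d1) (Num.min d2 (Num.min 1 (normc (g a) / 2 / M))) / 2.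
have x0 : 0 < x by rewrite divr_gt0// !lt_min d0 d10 d20 ltr01 divr_gt0.
have h2 : x < Num.min (Num.min d d1) (Num.min d2 (Num.min 1 (normc (g a) / 2 / M))).
  by rewrite /x ltr_pdivrMr// ltr_pMr ?ltr1n// -(@pmulr_lgt0 _ 2^-1)// invr_gt0.
move: h2; rewrite !lt_min -!andbA => /and5P[xd xd1 xd2 x1 xM].
pose z : C := a + x%:C.
have za : z - a = x%:C by rewrite /z addrAC subrr add0r.
have nx : normc (z - a) = x by rewrite za nm_real gtr0_norm.
have zna : z != a by rewrite -subr_eq0 -nm_gt0 nx.
have E := hd z zna; rewrite nx in E; have {E} := E xd.
have zi0 : (z - a) ^+ i != 0 by rewrite expf_neq0// subr_eq0.
rewrite -(subnKC (ltnW ij)) exprD [h z * _]mulrCA [g z * _]mulrC => /(mulfI zi0) gE.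
have := hd1 z; rewrite nx => /(_ xd1) k1.
have := hd2 z; rewrite nx => /(_ xd2) k2.
have hM : normc (h z) <= M.
  by rewrite -(subrK (h a) (h z)) addrC; apply: le_trans (le_normcD _ _) _; rewrite /M; lra.
have gl : normc (g a) / 2 <= normc (g z).
  by have := nm_leB (g a) (g z); rewrite nmB; lra.
have : normc (g z) <= M * x.
  rewrite gE normcM nmX nx ler_pM ?nm_ge0 ?exprn_ge0 ?(ltW x0)//.
  rewrite -(subnSK ij) exprS ler_piMr ?(ltW x0)// exprn_ile1 ?(ltW x0) ?(ltW x1)//.
move: xM; rewrite ltr_pdivlMr// mulrC; lra.
Qed.

Lemma local_form_recip f a i j : local_form f a i j -> local_form (recip f) a j i.
Proof.
move=> [g [hg ga0 E]]; exists (fun z => (g z)^-1); split.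
- exact: holomorphicV.
- by rewrite invr_neq0.
by apply: filterS E => z; rewrite /recip => ->; rewrite !invfM invrK; ring.
Qed.

Lemma local_form_unique f a i j i' j' : local_form f a i j -> local_form f a i' j' ->
  (i + j' = i' + j)%N.
Proof.
move=> [g [hg ga0 E]] [g' [hg' ga0' E']].
have F : \forall z \near a^', g z * (z - a) ^+ (i + j') = g' z * (z - a) ^+ (i' + j).
  have [d d0 hd] := (dnear_nmP _ _).1 E; have [d' d'0 hd'] := (dnear_nmP _ _).1 E'.
  apply/dnear_nmP; exists (Num.min d d'); first by rewrite lt_min d0.
  move=> z za; rewrite lt_min => /andP[zd zd'].
  have z0 : z - a != 0 by rewrite subr_eq0.
  have := hd z za zd; rewrite (hd' z za zd') => e.
  rewrite !exprD !mulrA; apply/eqP; move/eqP: e.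
  rewrite eqr_div ?expf_neq0// => /eqP ->; apply/eqP; ring.
apply/eqP; rewrite eqn_leq; apply/andP; split.
  by apply: vanishing_order hg' hg ga0' _; apply: filterS F => z ->.
exact: vanishing_order hg hg' ga0 F.
Qed.

Lemma has_pole_orderP f a k : has_pole_order f a k <-> local_form f a 0 k.
Proof.
by split=> -[g [hg ga0 E]]; exists g; split=> //; apply: filterS E => z ->; rewrite mulr1.
Qed.

(** When i > 0 no pole order exists at a, and the default value is 0 = j. *)
Lemma pole_mult_local f a i j : local_form f a i j -> i = 0%N \/ j = 0%N -> pole_mult f a = j.
Proof.
move=> lf; rewrite /pole_mult; have [k|no] := pselect (exists k, has_pole_order f a k); last first.
  case=> [i0|->].
    by exfalso; apply: no; exists j; apply/has_pole_orderP; rewrite i0 in lf.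
  by rewrite xgetPN// => k hk; apply: no; exists k.
have /has_pole_orderP hk := xgetPex 0%N k.
have := local_form_unique lf hk; set m := xget _ _; lia.
Qed.

(** The factors vanishing at a are collected; what remains is holomorphic and
    nonzero there. *)
Lemma local_form_quotient f (Z T : seq C) (G : C -> C) a (d : R) :
  0 < d -> holomorphic_at G a -> G a != 0 ->
  (forall z, z != a -> normc (z - a) < d ->
     f z = \prod_(b <- Z) (z - b) * G z / \prod_(b <- T) (z - b)) ->
  local_form f a (count_mem a Z) (count_mem a T).
Proof.
move=> d0 hG Ga E.
pose u (s : seq C) z := \prod_(b <- s | b != a) (z - b).
have uE s z : \prod_(b <- s) (z - b) = u s z * (z - a) ^+ count_mem a s.
  rewrite /u; elim: s => [|b s IH]; first by rewrite !big_nil mul1r.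
  rewrite !big_cons IH /=; case: (eqVneq b a) => [->|ba] /=; last by rewrite mulrA.
  by rewrite add1n exprS; ring.
have ua s : u s a != 0.
  by rewrite prodf_seq_neq0; apply/allP => b _; apply/implyP; rewrite subr_eq0 eq_sym.
have hu s : holomorphic_at (u s) a := @holomorphic_prod s (fun b => b != a) a.
exists (fun z => u Z z * G z * (u T z)^-1); split.
- apply: (@holomorphicM (fun z => u Z z * G z) (fun z => (u T z)^-1)).
    exact: (@holomorphicM (u Z) G a (hu Z) hG).
  exact: (@holomorphicV (u T) a (ua T) (hu T)).
- by rewrite !mulf_neq0 ?invr_neq0.
apply/dnear_nmP; exists d => // z za zd; rewrite E// !uE invfM; ring.
Qed.
End PoleOrders.

(** * Series, sums and elementary inequalities *)

Section SeriesTails.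
Variable R : realType.

Lemma cvg_series_tail (b : nat -> R) : (forall n, 0 <= b n) -> cvgn (series b) ->
  forall e, 0 < e -> exists N, forall m, \sum_(N <= n < m) b n <= e.
Proof.
move=> b0 cb e e0.
have /cvgrPdist_le/(_ e e0)[N _ hN] := cb.
exists N => m; have [mN|Nm] := leqP m N; first by rewrite big_geq// ltW.
have h1 : series b m <= limn (series b).
  apply: nondecreasing_cvgn_le => // i j ij.
  rewrite /series /= -(subnKC ij) /index_iota !subn0 iotaD big_cat /= lerDl.
  by rewrite sumr_ge0.
have := hN N (leqnn N); rewrite ler_norml => /andP[_ h2].
have : series b m = series b N + \sum_(N <= n < m) b n.
  by rewrite /series /= (@big_cat_nat _ _ _ N)//= ltnW.
by lra.
Qed.

Lemma cvg_series_bound (b : nat -> R) : (forall n, 0 <= b n) -> cvgn (series b) ->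
  exists2 S, 0 < S & forall m, \sum_(0 <= n < m) b n <= S.
Proof.
move=> b0 cb; have [N hN] := cvg_series_tail b0 cb ltr01.
have S0 : 0 <= \sum_(0 <= n < N) b n by rewrite sumr_ge0.
exists (\sum_(0 <= n < N) b n + 1); first by rewrite ltr_pwDr.
move=> m; have [mN|Nm] := leqP m N.
  rewrite (@big_cat_nat _ _ _ m _ N)//=.
  have : 0 <= \sum_(m <= n < N) b n by rewrite sumr_ge0.
  by lra.
by rewrite (@big_cat_nat _ _ _ N)//= ?lerD2l// ltnW.
Qed.

Lemma nm_limn (u : nat -> R[i]^o) (l : R[i]^o) :
  (forall e : R, 0 < e -> exists N, forall n, (N <= n)%N -> normc (u n - l) <= e) ->
  limn u = l.
Proof.
move=> h; apply: cvg_lim; first exact: norm_hausdorff.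
apply/cvgrPdist_le => _ /posC[e e0 ->]; have [N hN] := h e e0.
by exists N => // n /hN; rewrite normC_le nmB.
Qed.

Lemma nm_sum_cond_le (b : nat -> R[i]) (P : pred nat) N m :
  normc (\sum_(N <= n < m | P n) b n) <= \sum_(N <= n < m) normc (b n).
Proof.
apply: le_trans (nm_sum _ _ _) _; rewrite big_mkcond /=.
by apply: ler_sum => n _; case: ifP => // _; exact: nm_ge0.
Qed.

Lemma series_nm_cauchy (b : nat -> R[i]) (P : pred nat) : cvgn (series (fun n => normc (b n))) ->
  exists l, forall e : R, 0 < e -> exists N, forall m, (N <= m)%N ->
    normc (\sum_(0 <= n < m | P n) b n - l) <= e.
Proof.
move=> cb; apply: nm_cauchy => e e0.
have e2 : 0 < e / 2 by rewrite divr_gt0.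
have [N hN] := cvg_series_tail (fun n => nm_ge0 (b n)) cb e2.
exists N; have key m : (N <= m)%N ->
    normc (\sum_(0 <= n < m | P n) b n - \sum_(0 <= n < N | P n) b n) <= e / 2.
  move=> Nm; rewrite (@big_cat_nat _ _ _ N)//= addrAC subrr add0r.
  by apply: le_trans (nm_sum_cond_le _ _ _ _) _.
move=> m m' /key h1 /key h2.
set A := \sum_(0 <= n < N | P n) b n in h1 h2.
set X := \sum_(0 <= n < m | P n) b n in h1 *; set Y := \sum_(0 <= n < m' | P n) b n in h2 *.
have -> : X - Y = (X - A) - (Y - A) by ring.
by apply: le_trans (nm_leB2 _ _) _; rewrite [e]splitr lerD.
Qed.

Lemma series_nm_lim (b : nat -> R[i]^o) : cvgn (series (fun n => normc (b n))) ->
  forall e : R, 0 < e -> exists N, forall m, (N <= m)%N ->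
    normc (\sum_(0 <= n < m) b n - limn (series b)) <= e.
Proof.
move=> cb; have [l hl] := series_nm_cauchy xpredT cb.
by have -> : limn (series b) = l by exact: nm_limn.
Qed.

Lemma nm_limit_unique (u : nat -> R[i]) (l l' : R[i]) :
  (forall e : R, 0 < e -> exists N, forall n, (N <= n)%N -> normc (u n - l) <= e) ->
  (forall e : R, 0 < e -> exists N, forall n, (N <= n)%N -> normc (u n - l') <= e) ->
  l = l'.
Proof. by move=> h h'; rewrite -(@nm_limn u l)// (@nm_limn u l'). Qed.
End SeriesTails.

Lemma sum_ge_size (R : realType) (I : eqType) (s : seq I) (F : I -> R) (k : R) :
  (forall i, i \in s -> k <= F i) -> (size s)%:R * k <= \sum_(i <- s) F i.
Proof.
elim: s => [|i s IH] h; first by rewrite big_nil mul0r.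
rewrite big_cons /= -natr1 mulrDl mul1r addrC lerD ?h ?mem_head// IH// => j js.
by rewrite h// inE js orbT.
Qed.

Lemma sum_cst_size (R : realType) (I : Type) (s : seq I) (k : R) :
  \sum_(i <- s) k = (size s)%:R * k.
Proof. by elim: s => [|i s IH]; rewrite ?big_nil ?mul0r// big_cons IH /= -natr1; ring. Qed.

Lemma sub_sum_le (R : realType) (P P' : seq nat) (F : nat -> R) : uniq P -> uniq P' ->
  {subset P <= P'} -> (forall n, 0 <= F n) -> \sum_(n <- P) F n <= \sum_(n <- P') F n.
Proof.
move=> uP uP' PP' F0; rewrite [leRHS](bigID (mem P)) /=.
have -> : \sum_(n <- P' | n \in P) F n = \sum_(n <- P) F n.
  rewrite -big_filter; apply: perm_big; apply: uniq_perm => //; first exact: filter_uniq.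
  by move=> n; rewrite mem_filter; case nP : (n \in P) => //=; exact: PP'.
by rewrite lerDl sumr_ge0.
Qed.

Lemma tail_sum_le (R : realType) (b : nat -> R) n0 (tau : R) (s : seq nat) : (forall n, 0 <= b n) -> uniq s ->
  (forall m, \sum_(n0 <= n < m) b n <= tau) ->
  \sum_(n <- s) (if (n0 <= n)%N then b n else 0) <= tau.
Proof.
move=> b0 us hb; rewrite -big_mkcond -big_filter.
apply: le_trans (hb (\max_(n <- s) n).+1).
apply: sub_sum_le => //; [exact: filter_uniq|exact: iota_uniq|].
move=> n; rewrite mem_filter mem_index_iota => /andP[-> ns] /=.
by rewrite ltnS (big_rem n ns) /= leq_maxl.
Qed.

Section LogInequalities.
Variable R : realType.

Lemma logp_inv (x : R) : 0 < x -> logp x^-1 = Num.max (- ln x) 0.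
Proof. by move=> x0; rewrite /logp lnV. Qed.

Lemma ln_le_shift (x y D : R) : 0 < x -> 0 < y -> x <= y + D -> ln x <= ln y + ln (1 + D / y).
Proof.
move=> x0 y0 xy; have e : 1 + D / y = (y + D) / y by field; rewrite gt_eqF.
have yD : 0 < y + D by exact: lt_le_trans xy.
by rewrite e ln_div ?posrE// addrC subrK ler_ln ?posrE.
Qed.

Lemma ln1D_le_sqrt (y : R) : 0 <= y -> ln (1 + y) <= 2 * Num.sqrt y.
Proof.
move=> y0; have s0 := sqrtr_ge0 y.
have h : 1 + y <= (1 + Num.sqrt y) ^+ 2.
  by rewrite sqrrD sqr_sqrtr// expr1n mul1r mulr2n; lra.
apply: (@le_trans _ _ (ln ((1 + Num.sqrt y) ^+ 2))).
  by rewrite ler_ln ?posrE ?exprn_gt0//; lra.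
rewrite lnXn; last by lra.
have := ln_le_diff (_ : 0 < 1 + Num.sqrt y) ltr01; rewrite ln1 => /(_ ltac:(lra)).
by rewrite mulr2n; lra.
Qed.

(** Moving the base point costs a factor that depends on how close the pole
    comes to the circle of the new point, and not on its angular position. *)
Lemma ln1D_transfer (D d x e : R) : 0 < D -> 0 < d -> d <= x -> 0 < e -> e <= x + D ->
  ln (1 + D / x) <= (1 + 4 * Num.sqrt (D / d)) * ln (1 + 2 * D / e).
Proof.
move=> D0 d0 dx e0 ex; have x0 : 0 < x by lra.
have q0 := sqrtr_ge0 (D / d).
have De : 0 < 2 * D / e by rewrite divr_gt0// mulr_gt0.
have l0 : 0 <= ln (1 + 2 * D / e) by apply: ln_ge0; lra.
have Dx : 0 < D / x by rewrite divr_gt0.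
have [h|h] := leP (2 * D) e.
  apply: (@le_trans _ _ (ln (1 + 2 * D / e))).
    rewrite ler_ln ?posrE; [|lra|lra]; rewrite lerD2l ler_pdivrMr// mulrAC ler_pdivlMr//.
    have := ler_wpM2l (ltW D0) ex; have := ler_wpM2l (ltW D0) h; lra.
  by rewrite [leRHS]mulrDl mul1r lerDl !mulr_ge0.
have l2 : 1 / 2 <= ln (1 + 2 * D / e).
  have h2 : 2 <= 1 + 2 * D / e.
    have : 1 <= 2 * D / e by rewrite ler_pdivlMr// mul1r ltW.
    by lra.
  apply: (@le_trans _ _ (ln 2)); last by rewrite ler_ln ?posrE//; lra.
  have := @ln_le_diff R 1 2 ltr01 ltac:(lra); rewrite ln1; lra.
have h1 : ln (1 + D / x) <= 2 * Num.sqrt (D / d).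
  apply: le_trans (ln1D_le_sqrt (ltW Dx)) _; rewrite ler_wpM2l// ler_wsqrtr//.
  by rewrite ler_wpM2l ?(ltW D0)// lef_pV2 ?posrE.
have := ler_wpM2l q0 l2; lra.
Qed.

Lemma sum_of_small_terms (C N k xi sz sp sk sk2 : R) : 0 <= C * N -> k <= xi -> sk <= xi -> sk2 <= xi ->
  0 <= sk -> 0 <= sk2 -> 0 <= sz -> 0 <= sp -> sz <= C * N -> sp <= C * N ->
  C * N * k + sz * (5 * sk) + 954 * sp * (5 * sk2) <= (1 + 5 + 954 * 5) * (C * N * xi).
Proof.
move=> CN kx skx sk2x sk0 sk20 sz0 sp0 szC spC.
have h1 := ler_wpM2l CN kx.
have h2 : sz * sk <= C * N * xi by exact: ler_pM.
have h3 : sp * sk2 <= C * N * xi by exact: ler_pM.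
have -> : sz * (5 * sk) = 5 * (sz * sk) by ring.
have -> : 954 * sp * (5 * sk2) = 954 * 5 * (sp * sk2) by ring.
by lra.
Qed.
End LogInequalities.

(** * Radii away from a finite set *)

Section GoodRadii.
Variable R : realType.
Implicit Types (x y d h : R).

(** Since the square root vanishes on negative numbers, this is the odd
    primitive of 1/(2 sqrt |y|). *)
Definition odd_sqrt (y : R) : R := Num.sqrt y - Num.sqrt (- y).

Lemma odd_sqrt_mono x y : x <= y -> odd_sqrt x <= odd_sqrt y.
Proof. by move=> xy; apply: lerB; apply: ler_wsqrtr; rewrite ?lerN2. Qed.

Lemma sqrt_subadd x y : 0 <= x -> 0 <= y -> Num.sqrt (x + y) <= Num.sqrt x + Num.sqrt y.
Proof.
move=> x0 y0; have := sqrtr_ge0 x; have := sqrtr_ge0 y => sy sx.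
rewrite -(ler_pXn2r (n:=2)) ?nnegrE ?sqrtr_ge0 ?addr_ge0//.
rewrite sqr_sqrtr ?addr_ge0// sqrrD !sqr_sqrtr//.
have : 0 <= Num.sqrt x * Num.sqrt y by exact: mulr_ge0.
by rewrite mulr2n; lra.
Qed.

Lemma odd_sqrt_total y h : 0 <= h -> odd_sqrt (y + h) - odd_sqrt y <= 2 * Num.sqrt h.
Proof.
move=> h0; rewrite /odd_sqrt; have sh := sqrtr_ge0 h.
have [y0|y0] := leP 0 y.
  have := sqrt_subadd y0 h0; have : Num.sqrt (- y) = 0 by rewrite ler0_sqrtr ?oppr_le0.
  have : Num.sqrt (- (y + h)) = 0 by rewrite ler0_sqrtr ?oppr_le0 ?addr_ge0.
  by lra.
have sy : Num.sqrt y = 0 by rewrite ler0_sqrtr// ltW.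
have [yh|yh] := leP 0 (y + h).
  have : Num.sqrt (- (y + h)) = 0 by rewrite ler0_sqrtr ?oppr_le0.
  have : Num.sqrt (y + h) <= Num.sqrt h by apply: ler_wsqrtr; lra.
  have : Num.sqrt (- y) <= Num.sqrt h by apply: ler_wsqrtr; lra.
  by lra.
have : Num.sqrt (y + h) = 0 by rewrite ler0_sqrtr// ltW.
have : Num.sqrt (- y) <= Num.sqrt (- (y + h)) + Num.sqrt h.
  have -> : - y = - (y + h) + h by ring.
  by apply: sqrt_subadd => //; lra.
by lra.
Qed.

(** By concavity, the sum of the square roots at y + d/2 and y - d/2 is at most
    twice the one at y. *)
Lemma odd_sqrt_step y d : 0 < d -> d / 2 <= `|y| ->
  d / Num.sqrt `|y| <= 2 * (odd_sqrt (y + d / 2) - odd_sqrt (y - d / 2)).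
Proof.
move=> d0; wlog y0 : y / 0 <= y.
  move=> W; have [/W//|y0 yd] := leP 0 y.
  have := W (- y); rewrite oppr_ge0 normrN => /(_ (ltW y0) yd).
  rewrite /odd_sqrt !opprD !opprK.
  have -> : - y + d / 2 = - (y - d / 2) by lra.
  have -> : - y - d / 2 = - (y + d / 2) by lra.
  have -> : y + - (d / 2) = y - d / 2 by [].
  by lra.
rewrite ger0_norm// => yd; rewrite /odd_sqrt.
have e1 : Num.sqrt (- (y + d / 2)) = 0 by rewrite ler0_sqrtr//; lra.
have e2 : Num.sqrt (- (y - d / 2)) = 0 by rewrite ler0_sqrtr//; lra.
have y1 : 0 < y by lra.
have s0 : 0 < Num.sqrt y by rewrite sqrtr_gt0.
rewrite e1 e2 !subr0 ler_pdivrMr//.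
have := sqrtr_ge0 (y + d / 2); have := sqrtr_ge0 (y - d / 2).
have : Num.sqrt (y + d / 2) ^+ 2 = y + d / 2 by rewrite sqr_sqrtr//; lra.
have : Num.sqrt (y - d / 2) ^+ 2 = y - d / 2 by rewrite sqr_sqrtr//; lra.
have : Num.sqrt y ^+ 2 = y by rewrite sqr_sqrtr.
move: s0; move: (Num.sqrt y) (Num.sqrt (y - d / 2)) (Num.sqrt (y + d / 2)) => s a b.
move=> s0 hs ha hb a0 b0.
have ab : a <= b by rewrite -(ler_pXn2r (n:=2))// ha hb; lra.
have sab : a + b <= 2 * s.
  rewrite -(ler_pXn2r (n:=2)) ?nnegrE//; [|lra|lra].
  by have := sqr_ge0 (a - b); rewrite !exprMn hs !expr2 in ha hb *; lra.
have : (b - a) * (a + b) <= (b - a) * (2 * s) by apply: ler_wpM2l => //; lra.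
by rewrite !expr2 in ha hb; lra.
Qed.

Lemma ord_average_le n (F : 'I_n.+1 -> R) (A : R) :
  \sum_k F k <= n.+1%:R * A -> exists k, F k <= A.
Proof.
move=> hF; apply: contrapT => no.
have : \sum_(k < n.+1) A < \sum_k F k.
  rewrite !big_ord_recl; apply: ltr_leD; last apply: ler_sum => i _.
    by rewrite ltNge; apply/negP => h; apply: no; exists ord0.
  by rewrite leNgt; apply/negP => h; apply: no; exists (lift ord0 i); exact: ltW.
rewrite sumr_const card_ord -[A *+ _]mulr_natl; lra.
Qed.

(** The mean over the interval of sqrt (h / |b - .|) is at most an absolute
    constant. Averaging over a grid of midpoints instead of integrating leaves
    finitely many values to compare; the cell containing b is penalised so that
    it is not selected. *)
Lemma good_radius (I : eqType) (s : seq I) (b v : I -> R) (r h : R) : 0 < h ->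
  (forall i, i \in s -> 0 <= v i) -> exists rho, [/\ r <= rho <= r + h,
    forall i, i \in s -> b i != rho &
    \sum_(i <- s) v i * Num.sqrt (h / `|b i - rho|) <= 8 * \sum_(i <- s) v i + 1].
Proof.
move=> h0 v0; set V := \sum_(i <- s) v i.
have V0 : 0 <= V by rewrite /V big_seq sumr_ge0.
pose n := (2 * size s)%N; pose M : R := n.+1%:R; pose d := h / M.
have M0 : 0 < M by rewrite ltr0n.
have d0 : 0 < d by rewrite divr_gt0.
pose x (k : nat) := r + (k%:R + 2^-1) * d.
pose W := 8 * V + 1.
pose bad i k := `|b i - x k| < d / 2.
pose F i k := if bad i k then W else v i * Num.sqrt (h / `|b i - x k|).
have telescoped i : i \in s -> \sum_(k < n.+1) F i k <= v i * (4 * M) + W.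
  move=> si.
  have hbad : \sum_(k < n.+1) (if bad i k then W else 0) <= W.
    have W0 : 0 <= W by rewrite /W; lra.
    have [[k hk]|no] := pselect (exists k : 'I_n.+1, bad i k); last first.
      by rewrite big1// => k _; case: ifP => // hk; case: no; exists k.
    rewrite (bigD1 k)//= hk big1 ?addr0// => l lk; case: ifP => // hl.
    move: hk hl lk; rewrite /bad !ltr_norml /x => /andP[k1 k2] /andP[l1 l2].
    have : `|(k%:R - l%:R) * d| < d by rewrite ltr_norml; apply/andP; split; lra.
    rewrite normrM [`|d|]gtr0_norm// gtr_pMl// => kl /negP[]; apply/eqP/val_inj/eqP.
    move: kl; rewrite ltr_norml => /andP[kl1 kl2].
    by case: (ltngtP (val l) (val k)) => //; rewrite -(ler_nat R) -natr1; lra.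
  have hgood : \sum_(k < n.+1) (if bad i k then 0 else v i * Num.sqrt (h / `|b i - x k|)) <= v i * (4 * M).
    pose P (k : nat) := odd_sqrt (r + k%:R * d - b i).
    apply: (@le_trans _ _ (\sum_(k < n.+1) v i * (Num.sqrt h * (2 / d) * (P k.+1 - P k)))).
      apply: ler_sum => k _.
      have Pk : 0 <= P k.+1 - P k.
        by rewrite subr_ge0; apply: odd_sqrt_mono; rewrite lerB// lerD2l ler_pM2r// ler_nat.
      case: ifP => [_|/negbT];
        first by apply: mulr_ge0; [exact: v0|apply: mulr_ge0 => //; apply: mulr_ge0; rewrite ?sqrtr_ge0 ?divr_ge0// ltW].
      rewrite /bad -leNgt distrC => hk; apply: ler_wpM2l; first exact: v0.
      have := odd_sqrt_step d0 hk.
      have -> : x k - b i + d / 2 = r + k.+1%:R * d - b i by rewrite /x -natr1; field.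
      have -> : x k - b i - d / 2 = r + k%:R * d - b i by rewrite /x; field.
      rewrite -/(P k) -/(P k.+1) => st.
      rewrite sqrtrM ?(ltW h0)// sqrtrV// -mulrA; apply: ler_wpM2l; first exact: sqrtr_ge0.
      rewrite [leRHS]mulrAC ler_pdivlMr// [leLHS]mulrC; exact: st.
    rewrite -mulr_sumr; apply: ler_wpM2l; first exact: v0.
    rewrite -mulr_sumr -(big_mkord xpredT (fun k => P k.+1 - P k)) telescope_sumr//.
    have tot : P n.+1 - P 0%N <= 2 * Num.sqrt h.
      rewrite /P mul0r addr0; have -> : r + n.+1%:R * d - b i = r - b i + h.
        by rewrite /d -/M; field; rewrite gt_eqF.
      by apply: odd_sqrt_total; exact: ltW.
    apply: (@le_trans _ _ (Num.sqrt h * (2 / d) * (2 * Num.sqrt h))).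
      by apply: ler_wpM2l => //; rewrite mulr_ge0 ?sqrtr_ge0 ?divr_ge0// ltW.
    have e : Num.sqrt h * Num.sqrt h = h by rewrite -expr2 sqr_sqrtr// ltW.
    rewrite [leLHS](_ : _ = 4 * (Num.sqrt h * Num.sqrt h) / d); last by field; rewrite gt_eqF.
    by rewrite e /d le_eqVlt; apply/orP; left; apply/eqP; field; rewrite !gt_eqF.
  apply: le_trans (lerD hgood hbad); rewrite -big_split /=; apply: ler_sum => k _.
  by rewrite /F; case: ifP; rewrite ?add0r ?addr0.
have [|k hk] := @ord_average_le n (fun k => \sum_(i <- s) F i k) (8 * V + 2^-1).
  rewrite exchange_big /=; apply: (@le_trans _ _ (\sum_(i <- s) (v i * (4 * M) + W))).
    by rewrite big_seq [leRHS]big_seq; apply: ler_sum.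
  rewrite big_split /= -mulr_suml -/V big_const_seq count_predT iter_addr addr0 -[W *+ _]mulr_natl -/M.
  have : M = 2 * (size s)%:R + 1 by rewrite /M /n -natr1 natrM.
  by move=> ->; rewrite /W; have : 0 <= (size s)%:R :> R by []; nra.
have F0 i : i \in s -> 0 <= F i k.
  move=> si; rewrite /F; case: ifP => _; first by rewrite /W; lra.
  by rewrite mulr_ge0 ?v0 ?sqrtr_ge0.
have nbad i : i \in s -> bad i k = false.
  move=> si; apply/negP => hb; have : F i k <= \sum_(i <- s) F i k.
    rewrite (big_rem i si) /= lerDl big_seq sumr_ge0// => j /mem_rem; exact: F0.
  by rewrite {1}/F hb; move: hk; rewrite /W; lra.
have kn : k%:R + 1 <= M by rewrite natr1 ler_nat.
have k0 : 0 <= k%:R :> R by [].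
have hd : M * d = h by rewrite /d mulrC divfK// gt_eqF.
exists (x k); split.
- rewrite /x lerDl lerD2l; apply/andP; split; first by apply: mulr_ge0; lra.
  by rewrite -hd ler_pM2r//; lra.
- move=> i si; apply/negP => /eqP bx; have := nbad i si; rewrite /bad bx subrr normr0.
  by rewrite divr_gt0.
apply: (@le_trans _ _ (8 * V + 2^-1)); last by lra.
apply: le_trans hk; rewrite big_seq [leRHS]big_seq; apply: ler_sum => i si.
by rewrite /F nbad.
Qed.
End GoodRadii.

(** * Means over roots of unity *)

Section Arcs.
Variable R : realType.
Implicit Types (z w x tt : R[i]) (rho : R).

Lemma Re_inv_disc w : w != 0 ->
  2 * Rp w^-1 - 1 = (1 - normc (1 - w) ^+ 2) * (normc w ^+ 2)^-1.
Proof.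
case: w => a b; rewrite -nm_gt0 => w0; have {}w0 := exprn_gt0 2 w0.
move: w0; rewrite !nm_sqr /= => w0.
by field; rewrite gt_eqF.
Qed.

Lemma one_sub_neq0 x : normc x < 1 -> 1 - x != 0.
Proof.
by move=> x1; rewrite subr_eq0; apply: contraTneq x1 => <-; rewrite (@nm_nat R 1) ltxx.
Qed.

Lemma sum_geometric_unity Q x : (0 < Q)%N -> normc x < 1 ->
  \sum_(i < Q) (1 - x * unity R Q ^+ i)^-1 = Q%:R / (1 - x ^+ Q).
Proof.
move=> Q0 x1; have nz := one_sub_neq0.
have xi (i : 'I_Q) : normc (x * unity R Q ^+ i) < 1 by rewrite normcM nmX nm_unity expr1n mulr1.
have xQ : normc (x ^+ Q) < 1 by rewrite nmX exprn_ilt1 ?nm_ge0// -lt0n.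
apply: (mulIf (nz _ xQ)); rewrite divfK ?nz// mulr_suml.
transitivity (\sum_(i < Q) \sum_(k < Q) (x * unity R Q ^+ i) ^+ k).
  apply: eq_bigr => i _; have e : (x * unity R Q ^+ i) ^+ Q = x ^+ Q.
    by rewrite exprMn -exprM mulnC exprM (prim_expr_order (unity_prim _ Q0)) expr1n mulr1.
  rewrite -e; move: (xi i); move: (x * unity R Q ^+ i) => y y1.
  have -> : 1 - y ^+ Q = (1 - y) * \sum_(k < Q) y ^+ k by rewrite -[LHS]opprB subrX1 -mulNr opprB.
  by rewrite mulKf// nz.
rewrite (eq_bigr (fun i : 'I_Q => \sum_(k < Q) x ^+ k * (unity R Q ^+ i) ^+ k)) => [|i _]; last first.
  by apply: eq_bigr => k _; rewrite exprMn.
rewrite exchange_big /= (bigD1 (Ordinal Q0))//= [X in _ + X]big1 ?addr0.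
  by rewrite -mulr_sumr unity_sum// dvdn0 expr0 mul1r.
move=> k k0; have kp : (0 < k)%N.
  by rewrite lt0n; apply: contraNneq k0 => k00; apply/eqP/val_inj.
by rewrite -mulr_sumr unity_sum// gtnNdvd// mulr0.
Qed.

(** The squared inverse distances are values of a Poisson kernel, that is, of
    the real part of a geometric series, and the latter is summed exactly over
    the roots of unity. *)
Lemma poisson_sum Q x : (0 < Q)%N -> normc x < 1 -> normc x ^+ Q <= 1 / 3 ->
  \sum_(i < Q) (normc (1 - x * unity R Q ^+ i) ^+ 2)^-1 <= 2 * Q%:R / (1 - normc x ^+ 2).
Proof.
move=> Q0 x1 xQ; have nz := one_sub_neq0.
have sub1K (y : R[i]) : 1 - (1 - y) = y by ring.
have ni i : normc (x * unity R Q ^+ i) = normc x by rewrite normcM nmX nm_unity expr1n mulr1.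
have x2 : 0 < 1 - normc x ^+ 2 by rewrite subr_gt0 exprn_ilt1 ?nm_ge0.
rewrite ler_pdivlMr// mulr_suml.
have X1 : normc (x ^+ Q) < 1 by rewrite nmX; lra.
rewrite (eq_bigr (fun i : 'I_Q => 2 * Rp (1 - x * unity R Q ^+ i)^-1 - 1)) => [|i _]; last first.
  by rewrite Re_inv_disc ?nz ?ni// sub1K ni mulrC.
rewrite sumrB -mulr_sumr -Re_sum sum_geometric_unity// sumr_const card_ord.
have -> : Rp (Q%:R / (1 - x ^+ Q)) = Q%:R * Rp (1 - x ^+ Q)^-1.
  by rewrite -(rmorph_nat (real_complex R)) Re_scale.
have -> : 2 * (Q%:R * Rp (1 - x ^+ Q)^-1) - 1 *+ Q = Q%:R * (2 * Rp (1 - x ^+ Q)^-1 - 1) by ring.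
rewrite Re_inv_disc ?nz// sub1K [leRHS]mulrC.
apply: ler_wpM2l => //; set q := normc (x ^+ Q) in X1 *.
have q0 : 0 <= q by exact: nm_ge0.
have q3 : q <= 1 / 3 by rewrite /q nmX.
have hq : 1 - q <= normc (1 - x ^+ Q) by have := nm_leB 1 (x ^+ Q); rewrite (@nm_nat R 1).
have n0 : 0 < normc (1 - x ^+ Q) by lra.
rewrite ler_pdivrMr ?exprn_gt0//.
have : (1 - q) ^+ 2 <= normc (1 - x ^+ Q) ^+ 2 by rewrite lerXn2r ?nnegrE//; lra.
have : 0 <= (1 - q) * (1 - 3 * q) by apply: mulr_ge0; lra.
by rewrite !expr2; lra.
Qed.

(** The squares are handled by the Poisson kernel, after an inversion when tt
    lies inside the circle; the first powers follow by the inequality between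
    arithmetic and geometric means. *)
Lemma mean_inv_dist rho zeta tt : 0 < rho -> normc zeta = rho -> normc tt != rho ->
  exists Q0 : nat, forall Q, (Q0 <= Q)%N -> (0 < Q)%N ->
    \sum_(i < Q) (normc (zeta * unity R Q ^+ i - tt))^-1 <=
      Q%:R * Num.sqrt (2 / `|rho ^+ 2 - normc tt ^+ 2|).
Proof.
move=> r0 zr tr; set a := Num.sqrt _.
have t0 := nm_ge0 tt.
have d0 : 0 < `|rho ^+ 2 - normc tt ^+ 2|.
  rewrite normr_gt0 subr_eq0 eq_sym eqrXn2 ?(ltW r0)//.
have a0 : 0 < a by rewrite sqrtr_gt0 divr_gt0.
have a2 : a ^+ 2 = 2 / `|rho ^+ 2 - normc tt ^+ 2| by rewrite sqr_sqrtr// divr_ge0.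
have zeta0 : zeta != 0 by rewrite -nm_gt0 zr.
suff [Q0 h] : exists Q0 : nat, forall Q, (Q0 <= Q)%N -> (0 < Q)%N ->
    (forall i, 0 < normc (zeta * unity R Q ^+ i - tt)) /\
    \sum_(i < Q) (normc (zeta * unity R Q ^+ i - tt) ^+ 2)^-1 <= Q%:R * a ^+ 2.
  exists Q0 => Q hQ Qp; have [hp hs] := h Q hQ Qp.
  (* 1/d <= (a + 1/(a d^2))/2 *)
  apply: (@le_trans _ _ (\sum_(i < Q) (a / 2 + (2 * a)^-1 * (normc (zeta * unity R Q ^+ i - tt) ^+ 2)^-1))).
    apply: ler_sum => i _; have := hp i; move: (normc _) => d dd.
    rewrite -subr_ge0 [leRHS](_ : _ = (a - d^-1) ^+ 2 / (2 * a)).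
      by rewrite divr_ge0 ?sqr_ge0//; lra.
    by field; rewrite !gt_eqF.
  rewrite big_split /= sumr_const card_ord -mulr_sumr -[_ *+ Q]mulr_natl.
  apply: (@le_trans _ _ (Q%:R * (a / 2) + (2 * a)^-1 * (Q%:R * a ^+ 2))).
    by rewrite lerD2l ler_wpM2l// invr_ge0; lra.
  by rewrite le_eqVlt; apply/orP; left; apply/eqP; field; rewrite gt_eqF.
have red x k : 0 < k -> normc x < 1 -> (forall Q i, normc (zeta * unity R Q ^+ i - tt) =
    k * normc (1 - x * unity R Q ^+ i)) -> k ^+ 2 * (1 - normc x ^+ 2) = `|rho ^+ 2 - normc tt ^+ 2| ->
    exists Q0 : nat, forall Q, (Q0 <= Q)%N -> (0 < Q)%N ->
    (forall i, 0 < normc (zeta * unity R Q ^+ i - tt)) /\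
    \sum_(i < Q) (normc (zeta * unity R Q ^+ i - tt) ^+ 2)^-1 <= Q%:R * a ^+ 2.
  move=> k0 x1 E kE; have x01 : 0 <= normc x < 1 by rewrite nm_ge0.
  have e3 : 0 < (1 / 3 : R) by lra.
  have [Q0 hQ0] := small_power x01 e3; exists Q0 => Q hQ Qp; split.
    move=> i; rewrite E mulr_gt0//; have := nm_leB 1 (x * unity R Q ^+ i).
    by rewrite (@nm_nat R 1) normcM nmX nm_unity expr1n mulr1; lra.
  under eq_bigr do rewrite E exprMn invfM.
  rewrite -mulr_sumr a2 -kE.
  have xQ : normc x ^+ Q <= 1 / 3.
    by apply: le_trans hQ0; apply: ler_wiXn2l => //; rewrite ?nm_ge0 ?(ltW x1).
  have x2 : 0 < 1 - normc x ^+ 2 by rewrite subr_gt0 exprn_ilt1 ?nm_ge0.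
  apply: le_trans (ler_wpM2l _ (poisson_sum Qp x1 xQ)) _.
    by rewrite invr_ge0 exprn_ge0// ltW.
  by rewrite le_eqVlt; apply/orP; left; apply/eqP; field; rewrite !gt_eqF.
have [lt|lt|/eqP] := ltgtP (normc tt) rho; last by rewrite (negbTE tr).
- apply: (red (conjc (tt / zeta)) rho) => //.
  + by rewrite nm_conj nm_div zr ltr_pdivrMr// mul1r.
  + move=> Q i; set u := unity R Q ^+ i.
    have u1 : u * conjc u = 1.
      by rewrite /u unityX conj_cis -cisD subrr cis0.
    have nu : normc u = 1 by rewrite /u nmX nm_unity expr1n.
    have -> : zeta * u - tt = (zeta * u) * conjc (1 - conjc (tt / zeta) * u).
      rewrite rmorphB rmorph1 rmorphM [X in 1 - X * _](_ : _ = tt / zeta); last exact: conjcK.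
      rewrite mulrBr mulr1; congr (_ - _).
      rewrite (_ : zeta * u * (tt / zeta * conjc u) = (zeta / zeta) * tt * (u * conjc u)).
        by rewrite u1 divff// mul1r mulr1.
      by ring.
    by rewrite normcM nm_conj normcM nu zr mulr1.
  + rewrite nm_conj nm_div zr ger0_norm.
      by field; rewrite gt_eqF.
    by rewrite subr_ge0 lerXn2r ?nnegrE// ltW.
- have tp : 0 < normc tt by lra.
  have tt0 : tt != 0 by rewrite -nm_gt0.
  apply: (red (zeta / tt) (normc tt)) => //.
  + by rewrite nm_div zr ltr_pdivrMr// mul1r.
  + move=> Q i; rewrite nmB -normcM; congr normc; field; exact: tt0.
  + rewrite nm_div zr distrC ger0_norm.
      by field; rewrite gt_eqF.
    by rewrite subr_ge0 lerXn2r ?nnegrE// ltW.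
Qed.

Lemma nat_average_le (F : nat -> R) a m B : (0 < m)%N ->
  \sum_(a <= i < a + m) F i <= m%:R * B -> exists i, [/\ (a <= i)%N, (i < a + m)%N & F i <= B].
Proof.
case: m => // m _; rewrite -{1}[a]add0n big_addn addKn big_mkord => /ord_average_le[k hk].
by exists (k + a)%N; split=> //; rewrite ?leq_addl// addnC ltn_add2l.
Qed.
End Arcs.

Lemma arc_const_eq (R : realType) (s k K p r : R) : 0 < K -> 0 < p -> 0 < r ->
  3 * (2 * (s * k * K / (48 * p * r ^+ 2)) * (r * 2 * p / K)) = s * k / (2 * r) / 2.
Proof. by move=> K0 p0 r0; field; rewrite !gt_eqF. Qed.

Lemma arc_const_half (R : realType) (s k K p r : R) : 0 < p -> 0 < r ->
  s * k * K / (96 * p * r ^+ 2) = s * k * K / (48 * p * r ^+ 2) / 2.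
Proof. by move=> p0 r0; field; rewrite !gt_eqF. Qed.

(** * Orders of growth *)

Section GrowthOrders.
Variable R : realType.
Implicit Types (h : R -> R) (a b : R).

Lemma growth_order_lt h b : (growth_order h < b%:E)%E ->
  exists a, forall r, a < r -> ln (h r) / ln r < b.
Proof.
move=> /ereal_inf_lt[_ [V [M [_ hM]] <-]] hV; exists M => r Mr.
rewrite -lte_fin; apply: le_lt_trans hV; apply: ereal_sup_ubound.
by exists r => //; exact: hM.
Qed.

Lemma growth_order_le h a b : (forall r, a < r -> ln (h r) / ln r <= b) ->
  (growth_order h <= b%:E)%E.
Proof.
move=> hb; apply: (@le_trans _ _ (ereal_sup ((fun r => (ln (h r) / ln r)%:E) @` [set r | a < r]))).
  apply: ereal_inf_lbound; exists [set r | a < r] => //.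
  by exists a; split => //; rewrite num_real.
by apply: ge_ereal_sup => _ [r ar <-]; rewrite lee_fin; exact: hb.
Qed.

Lemma growth_order_gt h a b : (b%:E < growth_order h)%E ->
  exists2 r, a < r & b < ln (h r) / ln r.
Proof.
move=> bh; apply: contrapT => no; move: bh; rewrite ltNge => /negP[].
apply: (@growth_order_le h a b) => r ar; rewrite leNgt; apply/negP => br.
by apply: no; exists r.
Qed.

Lemma lee_of_upper_bounds (x y : \bar R) :
  (forall b : R, (y < b%:E)%E -> (x <= b%:E)%E) -> (x <= y)%E.
Proof.
case: y => [y| |] h; last 2 first.
- by rewrite leey.
- case: x h => [x| |] h //; first by exfalso; have := h (x - 1)%R (ltNyr _); rewrite lee_fin; lra.
  by have := h 0%R (ltNyr _).
by apply/lee_addgt0Pr => e e0; rewrite -EFinD; apply: h; rewrite lte_fin ltrDl.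
Qed.

(** A constant factor and a dilation change ln h by a bounded amount in the
    limit of ln h / ln r. *)
Lemma growth_order_dilate h1 h2 (C k a : R) : 1 <= C -> 1 <= k -> 1 <= a ->
  (forall r, a < r -> 1 <= h2 r /\ h1 r <= C * h2 (k * r)) ->
  (growth_order h1 <= growth_order h2)%E.
Proof.
move=> C1 k1 a1 h12; apply: lee_of_upper_bounds => b /growth_order_lt[a' hb].
apply/lee_addgt0Pr => e e0; rewrite -EFinD.
have lC0 : 0 <= ln C by exact: ln_ge0.
have lk0 : 0 <= ln k by exact: ln_ge0.
(* Beyond expR A the constants are absorbed by e ln r. *)
pose A := (ln C + b * ln k) / e.
have eA := expR_gt0 A.
apply: (@growth_order_le _ (a + `|a'| + expR A)) => r hr.
have aa := ler_norm a'; have na := normr_ge0 a'.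
have r1 : 1 < r by lra.
have lr : 0 < ln r by rewrite ln_gt0.
rewrite ler_pdivrMr//.
have hA : A <= ln r by rewrite -[leLHS]expRK ler_ln ?posrE//; lra.
have {hA} : ln C + b * ln k <= e * ln r by rewrite [leRHS]mulrC -ler_pdivrMr.
have ar : a < r by lra.
have rk : r <= k * r by rewrite ler_peMl//; lra.
have ark : a < k * r by lra.
have a'rk : a' < k * r by lra.
have [h2r _] := h12 _ ark; have [_ h1r] := h12 _ ar.
have lkr : ln (k * r) = ln k + ln r by rewrite lnM ?posrE//; lra.
have := hb _ a'rk; rewrite ltr_pdivrMr ?lkr; last by lra.
have := ln_ge0 h2r => l2.
have [h0|h0] := ltP 0 (h1 r); last first.
  by move=> ? ?; rewrite [ln (h1 r)]ln0//; lra.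
have : ln (h1 r) <= ln (C * h2 (k * r)) by rewrite ler_ln ?posrE//; apply: lt_le_trans h1r.
by rewrite lnM ?posrE; lra.
Qed.

(** Otherwise N would be multiplied by a large factor at each dilation and
    outgrow the given power of the radius. *)
Lemma regular_scale (N : R -> R) (L c2 q mu y : R) : 0 <= L -> 0 <= mu -> 1 < q -> 0 < y ->
  (forall r, y <= r -> 1 <= N r /\ ln (N r) <= c2 + L * ln r) -> mu * ln y <= ln (N y) ->
  exists x, [/\ y <= x, ln (N (q * x)) <= (L + mu) * ln q + 1 + ln (N x) & mu * ln x <= ln (N x)].
Proof.
move=> L0 mu0 q1 y0 hN hy; apply: contrapT => no.
pose D := (L + mu) * ln q + 1.
have q0 : 0 < q by lra.
have lq : 0 < ln q by rewrite ln_gt0.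
have Lq : 0 <= L * ln q by rewrite mulr_ge0// ltW.
have muq : 0 <= mu * ln q by rewrite mulr_ge0// ltW.
have xk k : y <= q ^+ k * y by rewrite ler_peMl ?(ltW y0)// exprn_ege1// ltW.
have lx k : ln (q ^+ k * y) = k%:R * ln q + ln y.
  by rewrite lnM ?posrE ?exprn_gt0// lnXn// mulr_natl.
have grow k : k%:R * D + ln (N y) <= ln (N (q ^+ k * y)).
  elim: k => [|k IH]; first by rewrite expr0 mul0r mul1r add0r.
  have mk : mu * ln (q ^+ k * y) <= ln (N (q ^+ k * y)).
    apply: le_trans IH; rewrite lx.
    have : k%:R * (mu * ln q) <= k%:R * D by rewrite ler_wpM2l// /D; lra.
    by lra.
  rewrite exprS -mulrA -natr1 mulrDl mul1r.
  have : D + ln (N (q ^+ k * y)) < ln (N (q * (q ^+ k * y))).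
    by rewrite ltNge; apply/negP => h; apply: no; exists (q ^+ k * y).
  by lra.
(* The lower bound by k D and the upper bound by c2 + L ln (q^k y) are
   incompatible once k exceeds |A|. *)
pose A := c2 + L * ln y - ln (N y).
have [k hk] : exists k : nat, `|A| < k%:R by exists (Num.bound `|A|); exact: archi_boundP.
have [_] := hN _ (xk k); rewrite lx; have := grow k; rewrite /D.
have kmu : 0 <= k%:R * (mu * ln q) by rewrite mulr_ge0.
by have := ler_norm A; rewrite /A in hk *; lra.
Qed.
End GrowthOrders.

(** * Factorization of the partial fraction series *)

Section PartialFractionSeries.
Variables (R : realType) (t c : nat -> R[i]) (f : R[i] -> R[i]).
Hypothesis t_inj : injective t.
Hypothesis t_neq0 : forall n, t n != 0.
Hypothesis t_inf : forall r : R, exists N, forall n, (N <= n)%N -> r < normc (t n).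
Hypothesis c_neq0 : forall n, c n != 0.
Hypothesis c_sum : cvgn (series (fun n => normc (c n))).
Hypothesis f_lim : forall z, (forall n, z != t n) -> forall e : R, 0 < e ->
  exists N, forall m, (N <= m)%N -> normc (\sum_(0 <= n < m) c n / (z - t n) ^+ 2 - f z) <= e.

Lemma poles_in (r : R) : exists2 P : seq nat, uniq P & forall n, (n \in P) = (normc (t n) <= r).
Proof.
have [N hN] := t_inf r.
exists [seq n <- iota 0 N | normc (t n) <= r]; first by rewrite filter_uniq// iota_uniq.
move=> n; rewrite mem_filter mem_iota /= add0n; case: leP => //= tr.
by rewrite ltnNge; apply/negP => /hN; rewrite ltNge tr.
Qed.

(** Away from the poles the terms are bounded by multiples of |c n|, so that the
    series converges uniformly. *)
Lemma regular_part (P : seq nat) (r1 r2 : R) : r1 < r2 ->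
  (forall n, n \notin P -> r2 < normc (t n)) ->
  exists2 h : R[i] -> R[i], poly_approx r1 h & forall z, normc z <= r1 ->
    forall e : R, 0 < e -> exists N, forall m, (N <= m)%N ->
      normc (\sum_(0 <= n < m | n \notin P) c n / (z - t n) ^+ 2 - h z) <= e.
Proof.
move=> r12 hP; have d0 : 0 < r2 - r1 by rewrite subr_gt0.
have bnd z n : normc z <= r1 -> n \notin P ->
    normc (c n / (z - t n) ^+ 2) <= normc (c n) / (r2 - r1) ^+ 2.
  move=> zr /hP h; rewrite nm_div nmX ler_wpM2l ?nm_ge0//.
  have h1 : r2 - r1 <= normc (z - t n).
    by rewrite nmB; apply: le_trans (nm_leB _ _); lra.
  by rewrite lef_pV2 ?posrE ?exprn_gt0 ?(lt_le_trans d0 h1)// lerXn2r ?nnegrE ?nm_ge0 ?(ltW d0).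
have bsum z N m : normc z <= r1 -> normc (\sum_(N <= n < m | n \notin P) c n / (z - t n) ^+ 2) <=
    (\sum_(N <= n < m) normc (c n)) / (r2 - r1) ^+ 2.
  move=> zr; apply: le_trans (nm_sum _ _ _) _; rewrite mulr_suml big_mkcond /=.
  apply: ler_sum => n _; case: ifP => [nP|_]; first exact: bnd.
  by rewrite divr_ge0 ?nm_ge0// exprn_ge0// ltW.
have tail (e : R) : 0 < e -> exists N, forall z, normc z <= r1 -> forall m, (N <= m)%N ->
    normc (\sum_(0 <= n < m | n \notin P) c n / (z - t n) ^+ 2
         - \sum_(0 <= n < N | n \notin P) c n / (z - t n) ^+ 2) <= e.
  move=> e0; have e1 : 0 < e * (r2 - r1) ^+ 2 by rewrite mulr_gt0// exprn_gt0.
  have [N hN] := cvg_series_tail (fun n => nm_ge0 (c n)) c_sum e1.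
  exists N => z zr m Nm; rewrite (@big_cat_nat _ _ _ N)//= addrAC subrr add0r.
  by apply: le_trans (bsum _ _ _ zr) _; rewrite ler_pdivrMr ?exprn_gt0.
have lim z : exists l, normc z <= r1 -> forall e : R, 0 < e -> exists N, forall m, (N <= m)%N ->
      normc (\sum_(0 <= n < m | n \notin P) c n / (z - t n) ^+ 2 - l) <= e.
  have [zr|zr] := boolP (normc z <= r1); last by exists 0.
  have [e e0|l hl] := @nm_cauchy R (fun m => \sum_(0 <= n < m | n \notin P) c n / (z - t n) ^+ 2).
    have e2 : 0 < e / 2 by rewrite divr_gt0.
    have [N hN] := tail _ e2; exists N => m m' /(hN z zr) h1 /(hN z zr) h2.
    move: h1 h2; move: (\sum_(0 <= n < m | _) _) (\sum_(0 <= n < m' | _) _) (\sum_(0 <= n < N | _) _).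
    move=> X Y A h1 h2; have -> : X - Y = (X - A) - (Y - A) by ring.
    by apply: le_trans (nm_leB2 _ _) _; rewrite [e]splitr lerD.
  by exists l.
have /choice[h hh] := lim; exists h => // .
apply: poly_approx_lim => e e0; have e2 : 0 < e / 2 by rewrite divr_gt0.
have [N hN] := tail _ e2.
exists (fun z => \sum_(n <- index_iota 0 N) (if n \notin P then c n / (z - t n) ^+ 2 else 0)).
  apply: (@poly_approx_sum _ _ nat _ (fun n z => if n \notin P then c n / (z - t n) ^+ 2 else 0)) => n /=.
  case nP : (n \notin P); last exact: poly_approx_cst.
  have rt : r1 < normc (t n) by apply: lt_trans (hP _ nP).
  apply: poly_approxM; first exact: poly_approx_cst.
  apply: eq_poly_approx (poly_approxM (poly_approx_inv rt) (poly_approx_inv rt)) => z _.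
  by rewrite expr2 invfM.
move=> z zr; rewrite -big_mkcond /=; apply/ler_addgt0Pr => d dd0.
have d2 : 0 < d by [].
have [N' hN'] := hh z zr d dd0.
have h1 := hN z zr _ (leq_maxl N N'); have h2 := hN' _ (leq_maxr N N').
move: h1 h2; move: (\sum_(0 <= n < N | _) _) (\sum_(0 <= n < maxn _ _ | _) _) => A X h1 h2.
have -> : A - h z = - (X - A) + (X - h z) by ring.
apply: le_trans (le_normcD _ _) _; rewrite normcN lerD//.
by apply: le_trans h1 _; rewrite ler_pdivrMr// ler_pMr// ler1n.
Qed.

Lemma poly_approx_prod_sqr (r : R) (P : seq nat) (Q : pred nat) :
  poly_approx r (fun z => \prod_(n <- P | Q n) (z - t n) ^+ 2).
Proof.
apply: eq_poly_approx (poly_approx_horner r (\prod_(n <- P | Q n) ('X - (t n)%:P) ^+ 2)) => z _.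
by rewrite horner_prod; apply: eq_bigr => n _; rewrite horner_exp hornerXsubC.
Qed.

(** Clearing the denominators: H = f * prod (z - t n)^2 is holomorphic on the
    disc and does not vanish at the poles. *)
Lemma numerator (P : seq nat) (r1 r2 : R) : r1 < r2 -> uniq P ->
  (forall n, (n \in P) = (normc (t n) <= r2)) ->
  exists H, [/\ poly_approx r1 H,
    (forall z, normc z <= r1 -> (forall n, z != t n) ->
       H z = f z * \prod_(n <- P) (z - t n) ^+ 2) &
    forall n, n \in P -> H (t n) != 0].
Proof.
move=> r12 uP hP.
have hP' n : n \notin P -> r2 < normc (t n) by rewrite hP -ltNge.
have [h ph hh] := regular_part r12 hP'.
pose H z := \sum_(n <- P) c n * \prod_(k <- P | k != n) (z - t k) ^+ 2
   + \prod_(n <- P) (z - t n) ^+ 2 * h z.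
exists H; split.
- apply: poly_approxD.
    apply: poly_approx_sum => n; apply: poly_approxM; first exact: poly_approx_cst.
    exact: poly_approx_prod_sqr.
  by apply: poly_approxM => //; exact: poly_approx_prod_sqr.
- move=> z zr zt.
  have fE : f z = \sum_(n <- P) c n / (z - t n) ^+ 2 + h z.
    apply: (@nm_limit_unique R (fun m => \sum_(0 <= n < m) c n / (z - t n) ^+ 2)).
      exact: f_lim.
    move=> e e0; have [N hN] := hh z zr e e0.
    pose N1 := (\max_(n <- P) n).+1.
    exists (maxn N N1) => m; rewrite geq_max => /andP[/hN h1 Nm].
    rewrite (bigID (mem P)) /= opprD addrACA.
    have -> : \sum_(0 <= n < m | n \in P) c n / (z - t n) ^+ 2 = \sum_(n <- P) c n / (z - t n) ^+ 2.
      rewrite -big_filter; apply: perm_big; apply: uniq_perm => //.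
        by rewrite filter_uniq// iota_uniq.
      move=> n; rewrite mem_filter mem_index_iota /=; case nP : (n \in P) => //=.
      by apply: leq_trans Nm; rewrite /N1 ltnS (bigD1_seq n)//= leq_maxl.
    by rewrite subrr add0r.
  rewrite /H fE mulrDl [h z * _]mulrC; congr (_ + _).
  rewrite mulr_suml; apply: eq_big_seq => n nP.
  rewrite [in RHS](bigD1_seq n)//=; field.
  by rewrite subr_eq0 zt.
- move=> n nP; rewrite /H [X in _ + X * _](bigD1_seq n)//= subrr expr0n /= !mul0r addr0.
  rewrite (bigD1_seq n)//= [X in _ + X]big1_seq ?addr0.
    rewrite mulf_neq0// prodf_seq_neq0; apply/allP => k _; apply/implyP => kn.
    by rewrite expf_neq0// subr_eq0 (inj_eq t_inj) eq_sym.
  move=> k /andP[kn kP]; rewrite (big_rem n nP) eq_sym kn subrr expr0n /= mul0r mulr0.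
  by [].
Qed.

Definition double_poles (P : seq nat) : seq R[i] := map t P ++ map t P.

(** The poles t n with |t n| <= R2 are all divided out, whereas Z contains the
    zeros of the smaller disc |z| <= R0 only: dividing these out leaves a bound
    for G on |z| <= R1 by the maximum principle, which improves with each zero. *)
Definition disc_factorization (R0 R1 R2 : R) (P : seq nat) (Z : seq R[i]) (G : R[i] -> R[i]) :=
  [/\ uniq P /\ (forall n, (n \in P) = (normc (t n) <= R2)),
      forall a, a \in Z -> normc a <= R0 /\ forall n, a != t n,
      poly_approx R1 G, forall z, normc z <= R0 -> G z != 0 &
      forall z, normc z <= R1 -> (forall n, z != t n) ->
        f z = \prod_(a <- Z) (z - a) * G z / \prod_(b <- double_poles P) (z - b)].

Lemma disc_factorization_exists R0 R1 R2 : 0 < R0 -> normc (t 0) <= R0 -> 4 * R0 <= R1 ->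
  R1 < R2 -> exists P Z G, disc_factorization R0 R1 R2 P Z G.
Proof.
move=> R00 tR0 R01 R12; have [P uP hP] := poles_in R2.
have [H [pH HE Ht]] := numerator R12 uP hP.
have H0 : H (t 0%N) != 0 by apply: Ht; rewrite hP; lra.
have [Z [G [hZ pG E nz]]] := extract_zeros R00 R01 pH tR0 H0.
exists P, Z, G; split=> //.
- move=> a /hZ[ar Ha]; split=> // n; apply/negP => /eqP an.
  have : n \in P by rewrite hP -an; lra.
  by move/Ht; rewrite -an Ha eqxx.
- move=> z zr zt; rewrite -E// HE// /double_poles big_cat /= !big_map -big_split /=.
  under [X in _ / X]eq_bigr do rewrite -expr2.
  rewrite mulfK// prodf_seq_neq0; apply/allP => n _; apply/implyP => _.
  by rewrite expf_neq0// subr_eq0.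
Qed.

Lemma isolated_from (s : seq R[i]) z : exists2 d : R, 0 < d &
  forall b, b \in s -> b != z -> d <= normc (b - z).
Proof.
elim: s => [|b s [d d0 hd]]; first by exists 1.
have [->|bz] := eqVneq b z.
  by exists d => // x; rewrite inE => /orP[/eqP ->|/hd//]; rewrite eqxx.
exists (Num.min d (normc (b - z))); first by rewrite lt_min d0 nm_gt0 subr_eq0.
move=> x; rewrite inE => /orP[/eqP -> _|/hd h /h]; first by rewrite ge_min lexx orbT.
by move=> ?; rewrite ge_min; apply/orP; left.
Qed.

Definition generic (r : R) := forall z, normc z = r -> (forall n, z != t n) /\ f z != 0.

Section Consequences.
Variables (R0 R1 R2 : R) (P : seq nat) (Z : seq R[i]) (G : R[i] -> R[i]).
Hypotheses (R01 : R0 < R1) (R12 : R1 < R2).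
Hypothesis dF : disc_factorization R0 R1 R2 P Z G.

Lemma local_form_disc z : normc z <= R0 ->
  local_form f z (count_mem z Z) (count_mem z (double_poles P)).
Proof.
move: dF => [[_ hP] _ pG nz E] zr.
have [d d0 hd] := isolated_from (map t P) z.
have dd : 0 < Num.min d (R1 - normc z) by rewrite lt_min d0 subr_gt0 (le_lt_trans zr R01).
have zr1 : normc z < R1 := le_lt_trans zr R01.
apply: (@local_form_quotient R f Z (double_poles P) G z _ dd (poly_approx_holomorphic pG zr1) (nz z zr)).
move=> w wz; rewrite lt_min => /andP[wd wr].
have wr1 : normc w < R1 by have := nm_leB w z; lra.
apply: E => [|n]; first exact: ltW.
apply/negP => /eqP wt; have nP : n \in P by rewrite hP -wt ltW// (lt_trans wr1 R12).
have := hd w; rewrite wt map_f// -wt => /(_ isT wz); lra.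
Qed.

Lemma count_disc z : count_mem z Z = 0%N \/ count_mem z (double_poles P) = 0%N.
Proof.
move: dF => [_ hZ _ _ _]; have [zZ|zZ] := boolP (z \in Z); last by left; apply/count_memPn.
right; apply/count_memPn; rewrite mem_cat orbb; apply/mapP => -[n _ zt].
by have [_ /(_ n)] := hZ _ zZ; rewrite zt eqxx.
Qed.

Lemma integrated_count_poles r : 0 < r -> r <= R0 -> integrated_count r f =
  \sum_(b <- double_poles P) (ln (Num.max r (normc b)) - ln (normc b)).
Proof.
move=> r0 rR; apply: integrated_countE => // z zr.
apply: (pole_mult_local (local_form_disc _) (count_disc z)); lra.
Qed.

Lemma integrated_count_zeros r : 0 < r -> r <= R0 -> integrated_count r (recip f) =
  \sum_(a <- Z) (ln (Num.max r (normc a)) - ln (normc a)).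
Proof.
move=> r0 rR; apply: integrated_countE => // z zr.
have h : normc z <= R0 by lra.
apply: (pole_mult_local (local_form_recip (local_form_disc h))).
by case: (count_disc z); [right|left].
Qed.

Lemma ln_disc z : normc z <= R1 -> (forall n, z != t n) -> f z != 0 ->
  ln (normc (f z)) = \sum_(a <- Z) ln (normc (z - a)) + ln (normc (G z))
    - \sum_(b <- double_poles P) ln (normc (z - b)).
Proof.
move: dF => [_ _ _ _ E] zr zt; have -> := E z zr zt.
rewrite mulf_eq0 invr_eq0 mulf_eq0 !negb_or -andbA => /and3P[hZ hG hT].
have hs s : \prod_(a <- s) (z - a) != 0 -> forall a, a \in s -> z != a.
  move=> h a sa; apply: contraNneq h => za.
  by rewrite (big_rem a sa) /= za subrr mul0r.
rewrite nm_div normcM ln_div ?posrE ?mulr_gt0 ?nm_gt0// lnM ?posrE ?nm_gt0//.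
by rewrite (ln_nm_prod (hs _ hZ)) (ln_nm_prod (hs _ hT)).
Qed.

Lemma generic_disc r : 0 <= r -> r <= R0 ->
  (forall a, a \in Z -> normc a != r) -> (forall b, b \in double_poles P -> normc b != r) ->
  generic r.
Proof.
move: dF => [[_ hP] _ pG nz E] r0 rR hZ hT z zr.
have zt n : z != t n.
  apply/negP => /eqP zt; have nP : n \in P.
    by rewrite hP -zt zr (le_trans rR)// ltW// (lt_trans R01 R12).
  by have := hT (t n); rewrite mem_cat map_f// -zt zr eqxx => /(_ isT).
have nonzero s : (forall a, a \in s -> normc a != r) -> \prod_(a <- s) (z - a) != 0.
  move=> h; rewrite prodf_seq_neq0; apply/allP => a /h; rewrite subr_eq0 -zr /=.
  by apply: contraNneq => ->.
split=> //; rewrite E ?zr ?(le_trans rR (ltW R01))//.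
by rewrite mulf_neq0 ?invr_eq0 ?mulf_neq0 ?nonzero ?nz ?zr.
Qed.

Lemma generic_zeros r a : r <= R0 -> generic r -> a \in Z -> normc a != r.
Proof.
move: dF => [_ _ _ _ E] rR gr aZ; apply/negP => /eqP ar; have [zt] := gr a ar.
rewrite E ?ar ?(le_trans rR (ltW R01))// (big_rem a aZ) /= subrr !mul0r.
by rewrite eqxx.
Qed.

Lemma generic_poles r b : generic r -> b \in double_poles P -> normc b != r.
Proof.
move=> gr; rewrite mem_cat orbb => /mapP[n _ ->]; apply/negP => /eqP tr.
by have [/(_ n)] := gr _ tr; rewrite eqxx.
Qed.

(** Each factor of f contributes the mean of its own logarithmic kernel, and the
    zero-free factor its value at the centre. *)
Lemma jensen_disc r : 0 < r -> r <= R0 -> generic r ->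
  continuous (fun x => ln (normc (f (r%:C * cis x)))) /\
  cmean (fun x => ln (normc (f (r%:C * cis x)))) =
    \sum_(a <- Z) ln (Num.max r (normc a)) + ln (normc (G 0))
    - \sum_(b <- double_poles P) ln (Num.max r (normc b)).
Proof.
move=> r0 rR gr; move: (dF) => [_ _ pG nz _].
have fx x : ln (normc (f (r%:C * cis x))) =
    \sum_(a <- Z) ln (normc (r%:C * cis x - a)) + (ln (normc (G (r%:C * cis x)))
    + -1 * \sum_(b <- double_poles P) ln (normc (r%:C * cis x - b))).
  have zr : normc (r%:C * cis x) = r by rewrite nm_circle// ltW.
  have [zt fz] := gr _ zr; rewrite ln_disc//; first by rewrite mulN1r addrA.
  by rewrite zr (le_trans rR (ltW R01)).
have sumc (s : seq R[i]) : (forall a, a \in s -> normc a != r) ->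
    continuous (fun x => \sum_(a <- s) ln (normc (r%:C * cis x - a))) /\
    cmean (fun x => \sum_(a <- s) ln (normc (r%:C * cis x - a))) = \sum_(a <- s) ln (Num.max r (normc a)).
  move=> h; have h' a : a \in s -> continuous (fun x => ln (normc (r%:C * cis x - a))).
    by move=> /h ha; have [] := cmean_ln_factor r0 ha.
  split; first exact: (@continuous_sum_fun _ _ s (fun a x => ln (normc (r%:C * cis x - a)))).
  rewrite (@cmean_sum _ _ s (fun a x => ln (normc (r%:C * cis x - a))) h').
  by apply: eq_big_seq => a /h ha; have [] := cmean_ln_factor r0 ha.
have [cZ mZ] := sumc Z (fun a aZ => generic_zeros rR gr aZ).
have [cT mT] := sumc (double_poles P) (fun b bT => generic_poles gr bT).
have rr : 0 <= R0 < R1 by rewrite R01 (le_trans (ltW r0) rR).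
have rr' : 0 <= r <= R0 by rewrite rR ltW.
have [cG mG] := re_approx_circle rr' (re_approx_ln rr pG nz).
have cT' := @continuousZ_fun _ (-1) _ cT.
have cGT := @continuousD_fun _ _ _ cG cT'.
split.
  by under eq_fun do rewrite fx; exact: (@continuousD_fun _ _ _ cZ cGT).
under eq_fun do rewrite fx.
rewrite (@cmeanD _ _ _ cZ cGT) (@cmeanD _ _ _ cG cT') (@cmeanZ _ _ _ cT) mZ mG mT.
by rewrite mulN1r addrA.
Qed.

(** The logarithm of the modulus of the leading Laurent coefficient of f at 0,
    as ln 0 = 0. *)
Definition jensen_const : R := \sum_(a <- Z) ln (normc a) + ln (normc (G 0))
    - \sum_(b <- double_poles P) ln (normc b).

Lemma jensen_disc_const r : 0 < r -> r <= R0 -> generic r ->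
  proximity r f - proximity r (recip f) =
  integrated_count r (recip f) - integrated_count r f + jensen_const.
Proof.
move=> r0 rR gr; have [cf mf] := jensen_disc r0 rR gr.
rewrite proximity_diff//; last exact: ltW.
rewrite mf integrated_count_poles// integrated_count_zeros// !sumrB /jensen_const.
by ring.
Qed.

End Consequences.

Lemma generic_radius_in (x h : R) : 0 < x -> 0 < h ->
  exists2 r, x <= r <= x + h & generic r.
Proof.
move=> x0 h0; pose R0 := Num.max (x + h) (normc (t 0)).
have R00 : 0 < R0 by rewrite lt_max addr_gt0.
have R01 : R0 < 4 * R0 by lra.
have R12 : 4 * R0 < 5 * R0 by lra.
have tR : normc (t 0) <= R0 by rewrite le_max lexx orbT.
have xR : x + h <= R0 by rewrite le_max lexx.
have [P [Z [G dF]]] := disc_factorization_exists R00 tR (lexx _) R12.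
pose s := [seq (normc b, 1 : R) | b <- Z ++ double_poles P].
have v0 i : i \in s -> 0 <= i.2 by move=> /mapP[b _ ->].
have [r [hr hne _]] := @good_radius R _ s fst snd x _ h0 v0.
have hb b : b \in Z ++ double_poles P -> normc b != r by move=> bs; exact: (hne _ (map_f _ bs)).
have /andP[r1 r2] := hr; exists r => //.
by apply: (generic_disc R01 R12 dF); [lra|lra| |]; move=> b hbs; apply: hb; rewrite mem_cat hbs ?orbT.
Qed.

Lemma small_generic_radius : t 0 != 0 -> exists r, [/\ 0 < r, r <= normc (t 0) & generic r].
Proof.
move=> t0; have h0 : 0 < normc (t 0) / 2 by rewrite divr_gt0 ?nm_gt0.
have [r /andP[r1 r2] gr] := generic_radius_in h0 h0.
by exists r; split=> //; lra.
Qed.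

(** The constant is intrinsic: it is read off on one small circle, whatever the
    disc used for the factorization. *)
Lemma jensen : t 0 != 0 -> exists Lam : R,
  (forall R0 R1 R2 P Z G, R0 < R1 -> R1 < R2 -> normc (t 0) <= R0 ->
     disc_factorization R0 R1 R2 P Z G -> jensen_const P Z G = Lam) /\
  (forall r, 0 < r -> generic r -> proximity r f - proximity r (recip f) =
     integrated_count r (recip f) - integrated_count r f + Lam).
Proof.
move=> t0; have [r1 [r10 r1t gr1]] := small_generic_radius t0.
pose Lam := proximity r1 f - proximity r1 (recip f) -
  (integrated_count r1 (recip f) - integrated_count r1 f).
have const R0 R1 R2 P Z G : R0 < R1 -> R1 < R2 -> normc (t 0) <= R0 ->
     disc_factorization R0 R1 R2 P Z G -> jensen_const P Z G = Lam.
  move=> R01 R12 tR dF; rewrite /Lam (jensen_disc_const R01 R12 dF r10 _ gr1); first by ring.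
  exact: le_trans tR.
exists Lam; split=> // r r0 gr.
pose R0 := Num.max r (normc (t 0)).
have R00 : 0 < R0 by rewrite lt_max r0.
have R01 : R0 < 4 * R0 by lra.
have R12 : 4 * R0 < 5 * R0 by lra.
have tR : normc (t 0) <= R0 by rewrite le_max lexx orbT.
have rR : r <= R0 by rewrite le_max lexx.
have [P [Z [G dF]]] := disc_factorization_exists R00 tR (lexx _) R12.
by rewrite (jensen_disc_const R01 R12 dF r0 rR gr) (const _ _ _ _ _ _ R01 R12 tR dF).
Qed.

(** * Bounds by the counting function of the poles *)

Lemma sum_double_poles (P : seq nat) (F : R[i] -> R) :
  \sum_(b <- double_poles P) F b = \sum_(n <- P) 2 * F (t n).
Proof.
by rewrite big_cat /= !big_map -big_split /=; apply: eq_bigr => n _; rewrite mulrDl mul1r.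
Qed.

Lemma size_double_poles (P : seq nat) : size (double_poles P) = (2 * size P)%N.
Proof. by rewrite size_cat !size_map; lia. Qed.

Lemma t_gt0 n : 0 < normc (t n). Proof. by rewrite nm_gt0. Qed.

Lemma integrated_countf (r R0 : R) : 0 < r -> r <= R0 -> normc (t 0) <= R0 ->
  exists P, [/\ uniq P, forall n, (n \in P) = (normc (t n) <= 5 * R0) &
    forall r', 0 < r' -> r' <= R0 -> integrated_count r' f =
      \sum_(n <- P) 2 * (ln (Num.max r' (normc (t n))) - ln (normc (t n)))].
Proof.
move=> r0 rR tR; have R00 : 0 < R0 by lra.
have R01 : R0 < 4 * R0 by lra.
have R12 : 4 * R0 < 5 * R0 by lra.
have [P [Z [G dF]]] := disc_factorization_exists R00 tR (lexx _) R12.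
have [[uP hP] _ _ _ _] := dF.
exists P; split=> // r' r'0 r'R.
by rewrite (integrated_count_poles R01 R12 dF)// sum_double_poles.
Qed.

(** Each double pole inside the circle contributes 2 ln (r / |t n|). *)
Lemma integrated_count_ge (P : seq nat) r : 0 < r -> uniq P ->
  (forall n, n \in P -> normc (t n) <= r) ->
  \sum_(n <- P) 2 * (ln r - ln (normc (t n))) <= integrated_count r f.
Proof.
move=> r0 uP hP; have rR : r <= Num.max r (normc (t 0)) by rewrite le_max lexx.
have tR : normc (t 0) <= Num.max r (normc (t 0)) by rewrite le_max lexx orbT.
have [P' [uP' hP' ->//]] := integrated_countf r0 rR tR.
have R0 : 0 < Num.max r (normc (t 0)) by lra.
have F0 n : 0 <= 2 * (ln (Num.max r (normc (t n))) - ln (normc (t n))).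
  rewrite mulr_ge0// subr_ge0 ler_ln ?posrE ?lt_max ?r0 ?t_gt0//.
  by rewrite le_max lexx orbT.
apply: le_trans (sub_sum_le uP uP' _ F0).
  rewrite big_seq [leRHS]big_seq; apply: ler_sum => n nP.
  by rewrite max_l// hP.
by move=> n nP; rewrite hP'; have := hP n nP; lra.
Qed.

Lemma integrated_count_ge0 r : 0 < r -> 0 <= integrated_count r f.
Proof. by move=> r0; have := @integrated_count_ge [::] r r0 isT; rewrite big_nil; apply. Qed.

Lemma integrated_count_mono r r' : 0 < r -> r <= r' ->
  integrated_count r f <= integrated_count r' f.
Proof.
move=> r0 rr'; have r'0 : 0 < r' by lra.
have rR : r' <= Num.max r' (normc (t 0)) by rewrite le_max lexx.
have tR : normc (t 0) <= Num.max r' (normc (t 0)) by rewrite le_max lexx orbT.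
have [P [_ _ E]] := integrated_countf r'0 rR tR.
rewrite !E//; last by lra.
apply: ler_sum => n _; rewrite ler_wpM2l// lerD2r ler_ln ?posrE ?lt_max ?r0 ?r'0//.
by rewrite ge_max !le_max rr' lexx orbT.
Qed.

(** There are infinitely many poles, so the counting function beats every
    multiple of the logarithm. *)
Lemma integrated_count_log (m : nat) : exists2 r0 : R, 1 <= r0 &
  forall r, r0 <= r -> m%:R * ln r <= integrated_count r f.
Proof.
have S0 : 0 <= \sum_(n <- iota 0 m) (normc (t n) + normc (t n) ^+ 2).
  by apply: sumr_ge0 => n _; rewrite addr_ge0 ?exprn_ge0 ?nm_ge0.
exists (1 + \sum_(n <- iota 0 m) (normc (t n) + normc (t n) ^+ 2)); first by rewrite lerDl.
move=> r hr; have r0 : 0 < r by lra.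
have tr n : n \in iota 0 m -> normc (t n) <= r /\ normc (t n) ^+ 2 <= r.
  move=> nm; move: hr; rewrite (big_rem n nm) /=.
  have : 0 <= \sum_(y <- rem n (iota 0 m)) (normc (t y) + normc (t y) ^+ 2).
    by apply: sumr_ge0 => k _; rewrite addr_ge0 ?exprn_ge0 ?nm_ge0.
  by have := nm_ge0 (t n); have := sqr_ge0 (normc (t n)); split; lra.
have h n : n \in iota 0 m -> normc (t n) <= r by move=> /tr[].
apply: le_trans (integrated_count_ge r0 (iota_uniq 0 m) h).
rewrite -[X in X%:R * _](size_iota 0 m); apply: sum_ge_size => n nm.
have [t1 t2] := tr n nm.
have : ln (normc (t n) ^+ 2) <= ln r by rewrite ler_ln ?posrE ?exprn_gt0 ?t_gt0.
by rewrite lnXn ?t_gt0// mulr2n; lra.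
Qed.

(** A pole with |t n| <= 6 r contributes at least 2 ln (11 / 6) > 10 / 11. *)
Lemma integrated_count_card (P : seq nat) r : 0 < r -> uniq P ->
  (forall n, n \in P -> normc (t n) <= 6 * r) -> (size P)%:R <= 2 * integrated_count (11 * r) f.
Proof.
move=> r0 uP hP; have r11 : 0 < 11 * r by lra.
have h n : n \in P -> normc (t n) <= 11 * r by move=> /hP; lra.
have r6 : 0 < 6 * r by lra.
have l116 : ln (6 * r) - ln (11 * r) <= - (5 / 11).
  apply: le_trans (ln_le_diff r6 r11) _; rewrite le_eqVlt; apply/orP; left; apply/eqP.
  by field; rewrite gt_eqF.
have : (size P)%:R * (10 / 11) <= \sum_(n <- P) 2 * (ln (11 * r) - ln (normc (t n))).
  apply: sum_ge_size => n nP.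
  have : ln (normc (t n)) <= ln (6 * r) by rewrite ler_ln ?posrE ?t_gt0 ?hP.
  by lra.
have := integrated_count_ge r11 uP h; have : 0 <= (size P)%:R :> R by [].
by lra.
Qed.

(** On this circle every term of the series is bounded by |c n| L^2: either the
    circle keeps away from t n, or t n is far outside. *)
Lemma f_bound_circle (P : seq nat) S L r R1 z : 1 <= r -> R1 <= 5 * r -> 1 <= L ->
  (forall m, \sum_(0 <= n < m) normc (c n) <= S) ->
  (forall n, (n \in P) = (normc (t n) <= 6 * r)) ->
  (forall n, n \in P -> normc (t n) != R1 /\ r / `|normc (t n) - R1| <= L) ->
  normc z = R1 -> normc (f z) <= S * L ^+ 2.
Proof.
move=> r1 R15 L1 hS hP hL zR.
have key n : 0 < `|normc (t n) - R1| /\ (`|normc (t n) - R1|)^-1 <= L.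
  have [nP|nP] := boolP (n \in P).
    have [tR h] := hL n nP; rewrite normr_gt0 subr_eq0 tR; split=> //.
    apply: le_trans h; rewrite ler_peMl// invr_ge0//.
  have h : 1 <= `|normc (t n) - R1|.
    move: nP; rewrite hP -ltNge => tn; have := ler_norm (normc (t n) - R1); lra.
  have h0 : 0 < `|normc (t n) - R1| by lra.
  by split=> //; apply: le_trans L1; rewrite invf_le1.
have zt n : z != t n.
  apply/negP => /eqP zt; have [] := key n; by rewrite -zt zR subrr normr0 ltxx.
have dn n : `|normc (t n) - R1| <= normc (z - t n).
  by rewrite -zR distrC; exact: nm_dist.
apply/ler_addgt0Pr => e e0; have [N hN] := f_lim zt e0.
have := hN N (leqnn N); set X := \sum_(0 <= n < N) _ => h.
have -> : f z = X - (X - f z) by ring.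
apply: le_trans (nm_leB2 _ _) _; rewrite lerD//.
apply: le_trans (nm_sum _ _ _) _; apply: (@le_trans _ _ (\sum_(0 <= n < N) normc (c n) * L ^+ 2)).
  apply: ler_sum => n _; rewrite nm_div nmX ler_wpM2l ?nm_ge0//.
  have [d0 dL] := key n; rewrite -exprVn lerXn2r ?nnegrE ?invr_ge0 ?nm_ge0//; first by lra.
  apply: le_trans dL; rewrite lef_pV2 ?posrE//; exact: lt_le_trans (dn n).
by rewrite -mulr_suml ler_wpM2r// exprn_ge0//; lra.
Qed.

Lemma sum_double_ln (P : seq nat) (A : R) :
  \sum_(n <- P) 2 * (A - ln (normc (t n))) =
  2 * (size P)%:R * A - \sum_(b <- double_poles P) ln (normc b).
Proof.
rewrite sum_double_poles (eq_bigr (fun n => 2 * A - 2 * ln (normc (t n)))) => [|n _]; last by rewrite mulrBr.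
by rewrite sumrB sum_cst_size; congr (_ - _); ring.
Qed.

(** A bound for the sum of the inverse square roots of the distances bounds each
    distance from below. *)
Lemma radius_off_poles (P : seq nat) (R0 : R) : 0 < R0 -> exists R1, 
  [/\ 4 * R0 <= R1, R1 <= 5 * R0 & forall n, n \in P ->
    normc (t n) != R1 /\ R0 / `|normc (t n) - R1| <= (8 * (size P)%:R + 1) ^+ 2].
Proof.
move=> R00; pose s := [seq (normc (t n), 1 : R) | n <- P].
have v0 i : i \in s -> 0 <= i.2 by move=> /mapP[n _ ->].
have [R1 [/andP[h1 h2] hne hs]] := @good_radius R _ s fst snd (4 * R0) R0 R00 v0.
exists R1; split; [lra|lra|] => n nP.
have ns : (normc (t n), 1) \in s by apply: (map_f (fun n => (normc (t n), 1 : R))).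
have ne := hne _ ns; split; first exact: ne.
have d0 : 0 < `|normc (t n) - R1| by rewrite normr_gt0 subr_eq0; exact: ne.
have sq : Num.sqrt (R0 / `|normc (t n) - R1|) <= 8 * (size P)%:R + 1.
  move: hs; rewrite !big_map sum_cst_size /= mulr1 => /(le_trans _); apply.
  rewrite (big_rem n nP) /= mul1r lerDl; apply: sumr_ge0 => k _.
  by rewrite mul1r sqrtr_ge0.
rewrite -[leLHS]sqr_sqrtr ?divr_ge0 ?(ltW R00)//.
by rewrite lerXn2r ?nnegrE ?sqrtr_ge0// addr_ge0.
Qed.

Lemma expR_log_bound (S p : R) : 0 <= p -> S * ((8 * p + 1) ^+ 2) ^+ 2 <= expR (S + 32 * p).
Proof.
move=> p0; rewrite expRD; have h1 : S <= expR S by have := expR_ge1Dx S; lra.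
have h2 : 8 * p + 1 <= expR (8 * p) by rewrite addrC expR_ge1Dx.
have h3 : (8 * p + 1) ^+ 4 <= expR (8 * p) ^+ 4.
  by rewrite lerXn2r// nnegrE ?expR_ge0//; lra.
have e : expR (32 * p) = expR (8 * p) ^+ 4.
  by rewrite -expRM_natl; congr expR; ring.
rewrite -exprM e; apply: le_trans (ler_wpM2r _ h1) _; first by apply: exprn_ge0; lra.
by rewrite ler_wpM2l// expR_ge0.
Qed.

(** The logarithm of the bound on |f|, plus that of an upper bound for the
    product over the poles, minus that of a lower bound for the product over the
    zeros, all on a circle of radius between 4 R0 and 5 R0. *)
Definition zero_free_bound (S R0 : R) (p z : nat) : R :=
  S + 32 * p%:R + 2 * p%:R * ln (11 * R0) - z%:R * ln (3 * R0).

(** On the circle |z| = R1 each |z - a| is at least 3 R0 and each |z - b| at most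
    11 R0; the maximum principle does the rest. *)
Lemma zero_free_factor_bound S R0 R1 P Z G : 1 <= R0 -> 4 * R0 <= R1 -> R1 <= 5 * R0 ->
  (forall m, \sum_(0 <= n < m) normc (c n) <= S) ->
  (forall n, n \in P -> normc (t n) != R1 /\
     R0 / `|normc (t n) - R1| <= (8 * (size P)%:R + 1) ^+ 2) ->
  disc_factorization R0 R1 (6 * R0) P Z G ->
  forall z, normc z <= R1 -> normc (G z) <= expR (zero_free_bound S R0 (size P) (size Z)).
Proof.
move=> R01 R14 R15 hS hP [[uP memP] hZ pG nz E]; set M := zero_free_bound _ _ _ _.
have circ z : normc z = R1 -> normc (G z) <= expR M; last by move=> z zr; exact: (poly_approx_max pG circ zr).
move=> zr; have zt n : z != t n.
  apply/negP => /eqP zt; have nP : n \in P by rewrite memP -zt zr; lra.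
  by have [] := hP n nP; rewrite -zt zr eqxx.
have L1 : 1 <= (8 * (size P)%:R + 1) ^+ 2 :> R.
  by rewrite exprn_ege1// lerDr mulr_ge0.
have fb := f_bound_circle R01 R15 L1 hS memP hP zr.
have {}fb := le_trans fb (expR_log_bound S (ler0n _ (size P))).
have lowZ : (3 * R0) ^+ size Z <= normc (\prod_(a <- Z) (z - a)).
  apply: nm_prod_ge; first by lra.
  by move=> a /hZ[ar _]; apply: le_trans (nm_leB _ _); rewrite zr; lra.
have upT : normc (\prod_(b <- double_poles P) (z - b)) <= (11 * R0) ^+ (2 * size P).
  rewrite -size_double_poles; apply: nm_prod_le => b; rewrite mem_cat orbb => /mapP[n nP ->].
  by apply: le_trans (nm_leB2 _ _) _; move: nP; rewrite memP zr; lra.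
have T0 : \prod_(b <- double_poles P) (z - b) != 0.
  rewrite prodf_seq_neq0; apply/allP => b; rewrite mem_cat orbb => /mapP[n nP ->].
  by rewrite subr_eq0 zt.
have e1 : normc (\prod_(a <- Z) (z - a)) * normc (G z) =
    normc (f z) * normc (\prod_(b <- double_poles P) (z - b)).
  by rewrite -!normcM E ?zr// divfK.
have r3 : 0 < (3 * R0) ^+ size Z by apply: exprn_gt0; lra.
have eM : expR M * (3 * R0) ^+ size Z =
    expR (S + 32 * (size P)%:R) * (11 * R0) ^+ (2 * size P).
  have -> : (3 * R0) ^+ size Z = expR ((size Z)%:R * ln (3 * R0)).
    by rewrite expRM_natl lnK// posrE; lra.
  have -> : (11 * R0) ^+ (2 * size P) = expR (2 * (size P)%:R * ln (11 * R0)).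
    by rewrite -natrM expRM_natl lnK// posrE; lra.
  by rewrite -!expRD; congr expR; rewrite /M /zero_free_bound; ring.
rewrite -(ler_pM2r r3) eM.
apply: (@le_trans _ _ (normc (\prod_(a <- Z) (z - a)) * normc (G z))).
  by rewrite mulrC ler_wpM2r ?nm_ge0.
by rewrite e1 ler_pM ?nm_ge0.
Qed.

(** On |z| = R0 the zeros now act in the right direction, since |z - a| <= 2 R0 < 3 R0,
    and the logarithmic kernels of the poles have means counted by N(11 R0, f).
    The circle may contain poles. *)
Lemma proximity_bound S R0 R1 P Z G : 1 <= R0 -> 4 * R0 <= R1 -> R1 <= 5 * R0 -> 0 <= S ->
  disc_factorization R0 R1 (6 * R0) P Z G ->
  (forall z, normc z <= R1 -> normc (G z) <= expR (zero_free_bound S R0 (size P) (size Z))) ->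
  proximity R0 f <= S + 32 * (size P)%:R + integrated_count (11 * R0) f.
Proof.
move=> R01 R14 R15 S0 dF hG; have [[uP memP] hZ pG nz E] := dF.
have R12 : R1 < 6 * R0 by lra.
have R00 : 0 < R0 by lra.
have p0 : 0 <= (size P)%:R :> R by [].
have TP b : b \in double_poles P -> exists2 n, n \in P & b = t n.
  by rewrite mem_cat orbb => /mapP.
have Tb b : b \in double_poles P -> normc b <= 6 * R0.
  by move=> /TP[n nP ->]; rewrite -memP.
rewrite proximityE; apply: (@le_trans _ _ (S + 32 * (size P)%:R +
  \sum_(b <- double_poles P) (ln (11 * R0) - ln (Num.max R0 (normc b))))).
  apply: cmean_le_log => //.
  - by lra.
  - by move=> x; rewrite /logp le_max lexx orbT.
  - by move=> b /Tb; lra.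
  move=> x hx; set z := R0%:C * cis x in hx *.
  have zr : normc z = R0 by rewrite nm_circle// ltW.
  have zt n : z != t n.
    have [nP|nP] := boolP (n \in P); first by apply: hx; rewrite mem_cat map_f.
    apply: contra nP => /eqP zt; rewrite memP -zt zr; lra.
  have T0 : 0 <= \sum_(b <- double_poles P) ln (11 * R0 / normc (z - b)).
    rewrite big_seq; apply: sumr_ge0 => b bT; apply: ln_ge0.
    have zb0 : 0 < normc (z - b) by rewrite nm_gt0 subr_eq0 hx.
    rewrite ler_pdivlMr// mul1r; apply: le_trans (nm_leB2 _ _) _; rewrite zr.
    by have := Tb b bT; lra.
  rewrite /logp ge_max; apply/andP; split; last by lra.
  have [fz|fz] := eqVneq (f z) 0.
    by rewrite fz (@nm_nat R 0) ln0//; lra.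
  have R0R1 : R0 < R1 by lra.
  rewrite (ln_disc dF _ zt fz); last by rewrite zr; lra.
  have -> : \sum_(b <- double_poles P) ln (11 * R0 / normc (z - b)) =
      2 * (size P)%:R * ln (11 * R0) - \sum_(b <- double_poles P) ln (normc (z - b)).
    rewrite -[2 * _]natrM -size_double_poles -sum_cst_size -sumrB; apply: eq_big_seq => b bT.
    by rewrite ln_div ?posrE ?nm_gt0 ?subr_eq0 ?hx//; lra.
  have hG' : ln (normc (G z)) <= zero_free_bound S R0 (size P) (size Z).
    by rewrite -[leRHS]expRK ler_ln ?posrE ?expR_gt0 ?nm_gt0 ?nz ?zr//; apply: hG; rewrite zr; lra.
  have hZ' : \sum_(a <- Z) ln (normc (z - a)) <= (size Z)%:R * ln (3 * R0).
    rewrite -sum_cst_size big_seq [leRHS]big_seq; apply: ler_sum => a aZ.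
    have [ar _] := hZ a aZ; have h : normc (z - a) <= 3 * R0.
      by apply: le_trans (nm_leB2 _ _) _; rewrite zr; lra.
    have [->|za] := eqVneq (normc (z - a)) 0; first by rewrite ln0// ln_ge0//; lra.
    by rewrite ler_ln ?posrE// ?lt_neqAle ?nm_ge0 ?andbT 1?eq_sym//; lra.
  by move: hG'; rewrite /zero_free_bound; lra.
rewrite lerD2l.
have r11 : 0 < 11 * R0 by lra.
have P11 n : n \in P -> normc (t n) <= 11 * R0 by rewrite memP; lra.
apply: le_trans (integrated_count_ge r11 uP P11).
rewrite sum_double_poles; apply: ler_sum => n _; rewrite ler_wpM2l// lerD2l lerN2.
by rewrite ler_ln ?posrE ?lt_max ?R00 ?t_gt0// le_max lexx orbT.
Qed.

Lemma recip_count_ge0 R0 R1 R2 P Z G r : R0 < R1 -> R1 < R2 ->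
  disc_factorization R0 R1 R2 P Z G -> 1 <= r -> r <= R0 ->
  0 <= integrated_count r (recip f).
Proof.
move=> R01 R12 dF r1 rR; rewrite (integrated_count_zeros R01 R12 dF)//; last by lra.
apply: sumr_ge0 => a _; rewrite subr_ge0.
have [a0|a0] := leP (normc a) 0; first by rewrite [leLHS]ln0// ln_ge0// le_max r1.
by rewrite ler_ln ?posrE ?lt_max ?a0 ?orbT// le_max lexx orbT.
Qed.

(** By the Jensen formula, M - ln |G 0| plus N(R0, 1/f) plus a multiple of the
    number of zeros equals a quantity bounded by a multiple of N(11 R0, f). All the
    terms are nonnegative, so each of them is bounded. *)
Lemma controlled_factorization : exists C r0 : R, [/\ 1 <= C, 1 <= r0, normc (t 0) <= r0 &
  forall R0, r0 <= R0 -> exists R1 P Z G M, let N := integrated_count (11 * R0) f in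
  [/\ 4 * R0 <= R1 /\ R1 < 6 * R0, disc_factorization R0 R1 (6 * R0) P Z G,
    forall z, normc z <= R0 -> ln (normc (G z)) <= M,
    [/\ 1 <= N, 0 <= M - ln (normc (G 0)) <= C * N, (size Z)%:R <= C * N & (size P)%:R <= C * N] &
    0 <= integrated_count R0 (recip f) <= C * N /\ proximity R0 f <= C * N]].
Proof.
have [S S0 hS] := cvg_series_bound (fun n => nm_ge0 (c n)) c_sum.
have [Lam [hLam _]] := jensen (t_neq0 0%N).
have [r1 r11 hr1] := integrated_count_log 1.
pose r0 := r1 + normc (t 0) + expR 1.
have e1 : 0 < expR 1 :> R := expR_gt0 _.
have t00 := nm_ge0 (t 0); have LamN := ler_norm (- Lam); rewrite normrN in LamN.
have Lam0 := normr_ge0 Lam.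
exists (2 * (S + 65 + `|Lam|)), r0; split; [lra|rewrite /r0; lra|rewrite /r0; lra|].
move=> R0 hR; rewrite /r0 in hR; set N := integrated_count _ _.
have R01 : 1 <= R0 by lra.
have R00 : 0 < R0 by lra.
have N1 : 1 <= N.
  have := hr1 (11 * R0); rewrite mul1r -/N => /(_ ltac:(lra)); apply: le_trans.
  by rewrite -[leLHS]expRK ler_ln ?posrE//; lra.
have [P0 uP0 mP0] := poles_in (6 * R0).
have [R1 [R14 R15 hR1]] := radius_off_poles P0 R00.
have tR : normc (t 0) <= R0 by lra.
have R12 : R1 < 6 * R0 by lra.
have [P [Z [G dF]]] := disc_factorization_exists R00 tR R14 R12.
have [[uP mP] hZ pG nz E] := dF.
have PP : perm_eq P P0 by apply: uniq_perm => // n; rewrite mP mP0.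
have hR1' n : n \in P -> normc (t n) != R1 /\ R0 / `|normc (t n) - R1| <= (8 * (size P)%:R + 1) ^+ 2.
  by rewrite (perm_size PP) (perm_mem PP); exact: hR1.
have hG := zero_free_factor_bound R01 R14 R15 hS hR1' dF.
set M := zero_free_bound S R0 (size P) (size Z) in hG.
have prox := proximity_bound R01 R14 R15 (ltW S0) dF hG; rewrite -/N in prox.
have hG' z : normc z <= R0 -> ln (normc (G z)) <= M.
  move=> zr; rewrite -[leRHS]expRK ler_ln ?posrE ?expR_gt0 ?nm_gt0 ?nz//.
  by apply: hG; lra.
have G0 : ln (normc (G 0)) <= M by apply: hG'; rewrite (@nm_nat R 0); lra.
have R0R1 : R0 < R1 by lra.
have rc0 := recip_count_ge0 R0R1 R12 dF R01 (lexx _).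
have := hLam _ _ _ _ _ _ R0R1 R12 tR dF; rewrite /jensen_const => Lam_eq.
have rcE : integrated_count R0 (recip f) = (size Z)%:R * ln R0 - \sum_(a <- Z) ln (normc a).
  rewrite (integrated_count_zeros R0R1 R12 dF R00 (lexx _)) sumrB -sum_cst_size; congr (_ - _).
  by apply: eq_big_seq => a /hZ[ar _]; rewrite max_l.
have r11' : 0 < 11 * R0 by lra.
have P11 n : n \in P -> normc (t n) <= 11 * R0 by rewrite mP; lra.
have := integrated_count_ge r11' uP P11; rewrite sum_double_ln -/N => hN.
have cP : (size P)%:R <= 2 * N by apply: integrated_count_card => // n; rewrite mP.
have l3 : 1 / 2 <= ln 3 :> R.
  have := @ln_le_diff R 1 3 ltr01 ltac:(lra); rewrite ln1; lra.
have lM : ln (3 * R0) = ln 3 + ln R0 by rewrite lnM ?posrE.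
have z0 : 0 <= (size Z)%:R :> R by [].
have p0 : 0 <= (size P)%:R :> R by [].
have z3 : (size Z)%:R * (1 / 2) <= (size Z)%:R * ln 3 :> R by exact: ler_wpM2l.
have SN : S <= S * N by rewrite ler_peMr// ltW.
have LN : `|Lam| <= `|Lam| * N by rewrite ler_peMr.
(* The Jensen formula on the disc of radius R0. *)
have key : M - ln (normc (G 0)) + (size Z)%:R * ln 3 + integrated_count R0 (recip f) <=
    (S + 65 + `|Lam|) * N.
  by rewrite rcE /M /zero_free_bound lM; lra.
exists R1, P, Z, G, M; split=> //.
- split=> //; [apply/andP; split| | ]; lra.
- split; [apply/andP; split|]; lra.
Qed.

(** * Lower bounds on arcs *)

Section ArcLemma.
Variables (rho : R) (K : nat).
Hypothesis rho0 : 0 < rho.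
Hypothesis K8 : (8 <= K)%N.
Hypothesis t_off : forall n, normc (t n) != rho.

Let fsum N z := \sum_(0 <= n < N) c n / (z - t n) ^+ 2.
Let Fsum N z := \sum_(0 <= n < N) c n / (z - t n).
Let kappa : R := 2 * sin (pi / K%:R).

(** This bounds the mean over roots of unity of |z| times the n-th term of the
    moment. *)
Definition arc_weight n : R :=
  normc (c n) * normc (t n) * Num.sqrt (2 / `|rho ^+ 2 - normc (t n) ^+ 2|).

Lemma K_gt0 : 0 < K%:R :> R. Proof. by rewrite ltr0n (leq_trans _ K8). Qed.

Lemma angle_small : 3 * (pi / K%:R) < pi / 2 :> R.
Proof.
have p0 := pi_gt0 R; have K0 := K_gt0.
have K8' : 8 <= K%:R :> R by rewrite (ler_nat _ 8).
rewrite mulrA ltr_pdivrMr//; nra.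
Qed.

Lemma sin_angle_ge (a : R) : pi / K%:R <= a <= 3 * (pi / K%:R) -> sin (pi / K%:R) <= sin a.
Proof.
have s := angle_small; have p0 := pi_gt0 R; have K0 := K_gt0.
have k0 : 0 < pi / K%:R :> R by rewrite divr_gt0.
move=> /andP[a1 a2]; rewrite leNgt ltr_sin ?in_itv/= -?leNgt//; apply/andP; split; lra.
Qed.

Lemma kappa_gt0 : 0 < kappa.
Proof.
have s := angle_small; have p0 := pi_gt0 R; have K0 := K_gt0.
have k0 : 0 < pi / K%:R :> R by rewrite divr_gt0.
by rewrite mulr_gt0// sin_gt0_pi// k0 /=; lra.
Qed.

Lemma off_circle z n : normc z = rho -> 0 < normc (z - t n).
Proof.
move=> zr; rewrite nm_gt0 subr_eq0; apply: contraNneq (t_off n) => <-.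
by rewrite zr.
Qed.

Lemma dist_circle z n : normc z = rho -> 0 < `|normc (t n) - rho| <= normc (z - t n).
Proof.
by move=> zr; rewrite normr_gt0 subr_eq0 t_off /= -zr distrC nm_dist.
Qed.

Definition chord_const N : R := \sum_(0 <= n < N) normc (c n) / `|normc (t n) - rho| ^+ 3.

(** Second order Taylor expansion of 1 / (z - t n). *)
Lemma Fsum_increment N z w : normc z = rho -> normc w = rho ->
  normc (Fsum N w - Fsum N z) <= normc (fsum N z) * normc (w - z) +
    chord_const N * normc (w - z) ^+ 2.
Proof.
move=> zr wr; have -> : Fsum N w - Fsum N z = - (fsum N z * (w - z)) +
    \sum_(0 <= n < N) c n / ((z - t n) ^+ 2 * (w - t n)) * (w - z) ^+ 2.
  rewrite /Fsum /fsum mulr_suml -!sumrB -sumrN -big_split /=; apply: eq_bigr => n _.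
  have := off_circle n zr; have := off_circle n wr; rewrite !nm_gt0 => h1 h2.
  by field; rewrite h1 h2.
apply: le_trans (le_normcD _ _) _; rewrite normcN normcM lerD2l.
apply: le_trans (nm_sum _ _ _) _; rewrite /chord_const mulr_suml; apply: ler_sum => n _.
rewrite normcM nm_div nmX [normc (_ * _)]normcM nmX; apply: ler_wpM2r; first exact: sqr_ge0.
apply: ler_wpM2l; first exact: nm_ge0.
have /andP[d0 d1] := dist_circle n zr; have /andP[_ d2] := dist_circle n wr.
have z0 := off_circle n zr; have w0 := off_circle n wr.
rewrite lef_pV2 ?posrE ?mulr_gt0 ?exprn_gt0// exprSr ler_pM ?exprn_ge0 ?(ltW d0)//.
by rewrite lerXn2r ?nnegrE ?(ltW d0) ?(ltW z0).
Qed.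

(** The remainder F(z) - s / z of the expansion of F at infinity. *)
Definition moment N z : R[i] := \sum_(0 <= n < N) c n * t n / (z * (z - t n)).

Lemma Fsum_moment N z : normc z = rho ->
  Fsum N z = (\sum_(0 <= n < N) c n) / z + moment N z.
Proof.
move=> zr; have z0 : z != 0 by rewrite -nm_gt0 zr.
rewrite /Fsum /moment mulr_suml -big_split /=; apply: eq_bigr => n _.
have := off_circle n zr; rewrite nm_gt0 => h1.
by field; rewrite h1 z0.
Qed.

Lemma mean_moment N zeta W : normc zeta = rho -> \sum_(0 <= n < N) arc_weight n <= W ->
  exists Q0 : nat, forall Q, (Q0 <= Q)%N -> (0 < Q)%N ->
    \sum_(0 <= i < Q) normc (moment N (zeta * unity R Q ^+ i)) <= Q%:R * (W / rho).
Proof.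
move=> zr hW; have /choice[Q0 hQ0] := fun n => mean_inv_dist rho0 zr (t_off n).
exists (\max_(0 <= n < N) Q0 n)%N => Q hQ Qp.
have zi i : normc (zeta * unity R Q ^+ i) = rho by rewrite normcM nmX nm_unity expr1n mulr1.
apply: (@le_trans _ _ (\sum_(0 <= i < Q) \sum_(0 <= n < N)
   normc (c n) * normc (t n) / rho * (normc (zeta * unity R Q ^+ i - t n))^-1)).
  apply: ler_sum => i _; apply: le_trans (nm_sum _ _ _) _; apply: ler_sum => n _.
  by rewrite nm_div [normc (c n * _)]normcM [normc (_ * (_ - _))]normcM zi invfM mulrA.
rewrite exchange_big /=.
apply: (@le_trans _ _ (\sum_(0 <= n < N) Q%:R * (arc_weight n / rho))).
  rewrite big_seq [leRHS]big_seq; apply: ler_sum => n; rewrite mem_index_iota => nN.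
  rewrite -mulr_sumr big_mkord.
  have hn : (Q0 n <= Q)%N.
    by apply: leq_trans hQ; rewrite (big_rem n) ?mem_index_iota//= leq_maxl.
  apply: le_trans (ler_wpM2l _ (hQ0 n Q hn Qp)) _; first by rewrite divr_ge0 ?mulr_ge0 ?nm_ge0// ltW.
  by rewrite /arc_weight le_eqVlt; apply/orP; left; apply/eqP; ring.
by rewrite -mulr_sumr -mulr_suml ler_wpM2l// ler_wpM2r// invr_ge0 ltW.
Qed.

Lemma leq_add_block m : (2 * m + m <= 8 * m)%N.
Proof. by lia. Qed.

Lemma block_indices m i1 i2 : (i1 < 0 + m)%N -> (2 * m <= i2)%N -> (i2 < 2 * m + m)%N ->
  [/\ (i1 <= i2)%N, (m <= i2 - i1)%N, (i2 - i1 <= 3 * m)%N & forall i, (i < i2)%N -> (i < 3 * m)%N].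
Proof. by move=> *; split=> [|||i]; lia. Qed.

(** On two separated blocks of an arc the moment is small at some point, while
    1/z has changed by a definite amount; so the primitive varies between the
    two points, and its derivative cannot be small all along the arc. *)
Lemma arc_partial N theta W sigma : \sum_(0 <= n < N) arc_weight n <= W -> 0 < sigma ->
  sigma <= normc (\sum_(0 <= n < N) c n) -> 4 * K%:R * W <= sigma * kappa ->
  exists z, [/\ normc z = rho, normc (z - rho%:C * cis theta) <= 6 * pi * rho / K%:R &
    sigma * kappa * K%:R / (48 * pi * rho ^+ 2) <= normc (fsum N z)].
Proof.
move=> hW s0 hs hK; set eta := sigma * kappa * K%:R / _.
have p0 := pi_gt0 R; have K0 := K_gt0; have ka0 := kappa_gt0.
have eta0 : 0 < eta.
  by apply: divr_gt0; [apply: mulr_gt0 => //; exact: mulr_gt0|apply: mulr_gt0; [exact: mulr_gt0|exact: exprn_gt0]].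
have A0 : 0 <= chord_const N by apply: sumr_ge0 => n _; rewrite divr_ge0 ?nm_ge0 ?exprn_ge0.
have zr : normc (rho%:C * cis theta) = rho by rewrite nm_circle// ltW.
set zeta := rho%:C * cis theta in zr *.
have [Q0 hQ0] := mean_moment zr hW.
have [m1 hm1] : exists m1 : nat, 2 * pi * rho * chord_const N / eta <= m1%:R.
  exists (Num.bound (2 * pi * rho * chord_const N / eta)); apply/ltW/archi_boundP.
  apply: divr_ge0; [|exact: ltW]; apply: mulr_ge0 => //.
  by apply: mulr_ge0; [apply: mulr_ge0 => //|]; exact: ltW.
(* Q0 makes the averages accurate, and m1 makes the quadratic error of a step
   at most eta times its length. *)
pose m := (Q0 + m1).+1; pose Q := (K * m)%N.
have Kn : (0 < K)%N by apply: leq_trans K8.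
have mQ : (m <= Q)%N by rewrite /Q leq_pmull.
have Qp : (0 < Q)%N by apply: leq_trans mQ.
have Q0Q : (Q0 <= Q)%N by apply: leq_trans mQ; rewrite /m -addnS leq_addr.
have QR : Q%:R = K%:R * m%:R :> R by rewrite natrM.
have m0 : 0 < m%:R :> R by rewrite ltr0n.
have Q0R : 0 < Q%:R :> R by rewrite ltr0n.
have Q8 : (8 * m <= Q)%N by rewrite /Q leq_mul2r K8 orbT.
have m1m : (m1 <= m)%N by rewrite /m -addSn leq_addl.
have mp : (0 < m)%N by [].
have tot := hQ0 Q Q0Q Qp.
clearbody Q; clearbody m.
pose z i := zeta * unity R Q ^+ i.
have zi i : normc (z i) = rho by rewrite normcM nmX nm_unity expr1n mulr1.
have zdist i j : normc (z (i + j)%N - z i) = rho * normc (cis (2 * pi / Q%:R * j%:R) - 1).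
  have -> : z (i + j)%N - z i = z i * (unity R Q ^+ j - 1) by rewrite /z exprD; ring.
  by rewrite normcM zi unityX.
have ang j : 2 * pi / Q%:R * j%:R = 2 * (pi / K%:R * (j%:R / m%:R)) :> R.
  by rewrite QR; field; rewrite !gt_eqF.
have p2 : 0 <= 2 * pi :> R by rewrite mulr_ge0// ltW.
have zdist_le i j : normc (z (i + j)%N - z i) <= rho * (2 * pi / Q%:R * j%:R).
  rewrite zdist ler_wpM2l ?(ltW rho0)// nm_cisB1_le// mulr_ge0// divr_ge0//.
have block a : (a + m <= Q)%N -> exists i, [/\ (a <= i)%N, (i < a + m)%N &
    normc (moment N (z i)) <= K%:R * W / rho].
  move=> aQ; apply: nat_average_le => //; apply: le_trans (_ : Q%:R * (W / rho) <= _).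
    apply: le_trans tot; rewrite [leRHS](@big_cat_nat _ _ _ (a + m))//=.
    rewrite [X in _ <= X + _](@big_cat_nat _ _ _ a)//= ?leq_addr//.
    have h1 : 0 <= \sum_(0 <= i < a) normc (moment N (z i)) by apply: sumr_ge0 => i _; exact: nm_ge0.
    have h2 : 0 <= \sum_(a + m <= i < Q) normc (moment N (z i)) by apply: sumr_ge0 => i _; exact: nm_ge0.
    by rewrite -/z; lra.
  by rewrite QR le_eqVlt; apply/orP; left; apply/eqP; ring.
(* The mean over a block is at most K times the mean over the circle. *)
have [i1 [_ i1m hi1]] := block 0%N mQ.
have [i2 [i2a i2m hi2]] := block (2 * m)%N (leq_trans (leq_add_block m) Q8).
have [i12 jm j3 i2lt] := block_indices i1m i2a i2m.
have i2E : i2 = (i1 + (i2 - i1))%N by rewrite subnKC.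
set j := (i2 - i1)%N in jm j3 i2E.
have z12 : normc (z i1 - z i2) = rho * normc (cis (2 * pi / Q%:R * j%:R) - 1).
  by rewrite nmB; have := zdist i1 j; rewrite -i2E => ->.
have jm' : m%:R <= j%:R :> R by rewrite ler_nat.
have j3' : j%:R <= 3 * m%:R :> R by rewrite -(natrM _ 3) ler_nat.
have kap : kappa <= normc (cis (2 * pi / Q%:R * j%:R) - 1).
  rewrite nm_cisB1 ler_wpM2l//; apply: le_trans (ler_norm _); rewrite ang [_ / 2]mulrAC mulfV ?mul1r//.
  have k0 : 0 < pi / K%:R :> R by rewrite divr_gt0.
  apply: sin_angle_ge; apply/andP; split.
    by rewrite ler_peMr ?(ltW k0)// ler_pdivlMr// mul1r.
  by rewrite [leRHS]mulrC ler_wpM2l ?(ltW k0)// ler_pdivrMr.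
apply: contrapT => no.
have small i : (i < 3 * m)%N -> normc (fsum N (z i)) < eta.
  move=> im; rewrite ltNge; apply/negP => h; apply: no; exists (z i); split=> //.
  have := zdist_le 0%N i; rewrite add0n {2}/z expr0 mulr1 => /le_trans; apply.
  have im' : i%:R <= 3 * m%:R :> R by rewrite -(natrM _ 3) ler_nat ltnW.
  rewrite ang; have -> : 6 * pi * rho / K%:R = rho * (2 * (pi / K%:R * 3)) by ring.
  rewrite ler_pM2l// ler_pM2l// ler_pM2l ?divr_gt0// ler_pdivrMr//.
(* the primitive changes by a definite amount *)
have big : sigma * kappa / (2 * rho) <= normc (Fsum N (z i2) - Fsum N (z i1)).
  rewrite !Fsum_moment//; set s := \sum_(0 <= n < N) c n in hs *.
  have z1 : z i1 != 0 by rewrite -nm_gt0 zi.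
  have z2 : z i2 != 0 by rewrite -nm_gt0 zi.
  have -> : s / z i2 + moment N (z i2) - (s / z i1 + moment N (z i1)) =
      s * (z i1 - z i2) / (z i2 * z i1) - (moment N (z i1) - moment N (z i2)).
    by field; rewrite z1 z2.
  apply: le_trans (nm_leB _ _); have h := nm_leB2 (moment N (z i1)) (moment N (z i2)).
  have : sigma * kappa / rho <= normc (s * (z i1 - z i2) / (z i2 * z i1)).
    rewrite nm_div [normc (z i2 * _)]normcM !zi normcM z12.
    rewrite [leRHS](_ : _ = normc s * normc (cis (2 * pi / Q%:R * j%:R) - 1) / rho).
      by rewrite ler_pM2r ?invr_gt0// ler_pM ?(ltW s0) ?(ltW ka0).
    by field; rewrite gt_eqF.
  have : 4 * (K%:R * W / rho) <= sigma * kappa / rho.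
    by rewrite mulrA (mulrA 4) ler_pM2r// invr_gt0.
  have -> : sigma * kappa / (2 * rho) = (sigma * kappa / rho) / 2 by field; rewrite gt_eqF.
  by lra.
pose del := rho * (2 * pi / Q%:R).
have del0 : 0 <= del by rewrite mulr_ge0 ?divr_ge0// ltW.
have Adel : chord_const N * del <= eta.
  have m1Q : m1%:R <= Q%:R :> R by rewrite ler_nat (leq_trans m1m mQ).
  have := le_trans hm1 m1Q; rewrite ler_pdivrMr// => h.
  rewrite /del [leLHS](_ : _ = 2 * pi * rho * chord_const N / Q%:R); last by ring.
  by rewrite ler_pdivrMr// [leRHS]mulrC.
have step i : (i < 3 * m)%N -> normc (Fsum N (z i.+1) - Fsum N (z i)) <= 2 * eta * del.
  move=> im; apply: le_trans (Fsum_increment N (zi i) (zi i.+1)) _.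
  have := zdist_le i 1%N; rewrite addn1 mulr1 -/del => d1; have d0 := nm_ge0 (z i.+1 - z i).
  have f1 := ltW (small i im); have f0 := nm_ge0 (fsum N (z i)).
  apply: (@le_trans _ _ (eta * del + chord_const N * del ^+ 2)).
    apply: lerD; first exact: ler_pM.
    by rewrite ler_wpM2l// lerXn2r ?nnegrE.
  have : chord_const N * del * del <= eta * del by rewrite ler_wpM2r.
  by rewrite expr2 mulrA; lra.
have chain : normc (Fsum N (z i2) - Fsum N (z i1)) <= (i2 - i1)%:R * (2 * eta * del).
  rewrite -(@telescope_sumr _ i1 i2 (fun i => Fsum N (z i)))//.
  apply: le_trans (nm_sum _ _ _) _.
  apply: (@le_trans _ _ (\sum_(i1 <= i < i2) 2 * eta * del)).
    rewrite big_seq [leRHS]big_seq; apply: ler_sum => i; rewrite mem_index_iota => hi.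
    by apply: step; apply: i2lt; case/andP: hi.
  by rewrite sumr_const_nat [leRHS]mulr_natl.
have ed0 : 0 < 2 * eta * (rho * 2 * pi / K%:R) by apply: mulr_gt0; [exact: mulr_gt0|apply: divr_gt0 => //; do 2!apply: mulr_gt0 => //].
have : (i2 - i1)%:R * (2 * eta * del) <= 3 * (2 * eta * (rho * 2 * pi / K%:R)).
  rewrite -/j [leLHS](_ : _ = j%:R / m%:R * (2 * eta * (rho * 2 * pi / K%:R))).
    by rewrite ler_wpM2r ?(ltW ed0)// ler_pdivrMr.
  by rewrite /del QR; field; rewrite !gt_eqF.
have := arc_const_eq sigma kappa K0 p0 rho0; rewrite -/eta => e.
have : 0 < sigma * kappa / (2 * rho) by apply: divr_gt0; exact: mulr_gt0.
by rewrite e; lra.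
Qed.
End ArcLemma.

(** The partial sums converge uniformly on the circle, so the bound for a
    partial sum passes to f. *)
Lemma arc_lower_bound (rho : R) (K : nat) theta W sigma N0 : 0 < rho -> (8 <= K)%N ->
  (forall n, normc (t n) != rho) ->
  (forall N, \sum_(0 <= n < N) arc_weight rho n <= W) -> 0 < sigma ->
  (forall N, (N0 <= N)%N -> sigma <= normc (\sum_(0 <= n < N) c n)) ->
  4 * K%:R * W <= sigma * (2 * sin (pi / K%:R)) ->
  exists z, [/\ normc z = rho, normc (z - rho%:C * cis theta) <= 6 * pi * rho / K%:R &
    sigma * (2 * sin (pi / K%:R)) * K%:R / (96 * pi * rho ^+ 2) <= normc (f z)].
Proof.
move=> rho0 K8 t_off hW s0 hs hK; have ka0 := kappa_gt0 K8.
set eta := sigma * (2 * sin (pi / K%:R)) * K%:R / (48 * pi * rho ^+ 2).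
have p0 := pi_gt0 R; have K0 := K_gt0 K8.
have eta0 : 0 < eta.
  apply: divr_gt0; first by apply: mulr_gt0 => //; exact: mulr_gt0.
  by apply: mulr_gt0; [exact: mulr_gt0|exact: exprn_gt0].
have [N1 hN1] := t_inf (rho + 1).
have eta4 : 0 < eta / 4 by rewrite divr_gt0.
have [N2 hN2] := cvg_series_tail (fun n => nm_ge0 (c n)) c_sum eta4.
pose N := maxn N0 (maxn N1 N2).
have NN0 : (N0 <= N)%N by rewrite leq_maxl.
have NN1 : (N1 <= N)%N by rewrite /N !leq_max leqnn orbT.
have NN2 : (N2 <= N)%N by rewrite /N !leq_max leqnn !orbT.
have [z [zr zth hz]] := arc_partial rho0 K8 t_off theta (hW N) s0 (hs N NN0) hK.
exists z; split=> //; rewrite -/eta in hz.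
have zt n : z != t n by apply: contraNneq (t_off n) => <-; rewrite zr.
have [M hM] := f_lim zt eta4.
have := hM (maxn M N) (leq_maxl _ _); rewrite (@big_cat_nat _ _ _ N)//= ?leq_maxr//.
set X := \sum_(0 <= n < N) c n / (z - t n) ^+ 2 in hz *.
set Y := \sum_(N <= n < maxn M N) _ => h1.
have h2 : normc Y <= eta / 4.
  apply: le_trans (nm_sum _ _ _) _; apply: le_trans (hN2 (maxn M N)).
  rewrite (@big_cat_nat _ _ _ N N2 (maxn M N))//= ?leq_maxr//.
  apply: le_trans (_ : _ <= \sum_(N <= n < maxn M N) normc (c n)) _; last first.
    by rewrite lerDr sumr_ge0// => n _; exact: nm_ge0.
  rewrite big_seq [leRHS]big_seq; apply: ler_sum => n; rewrite mem_index_iota => /andP[Nn _].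
  have d1 : 1 <= normc (z - t n).
    rewrite nmB; apply: le_trans (nm_leB _ _); rewrite zr.
    by have := hN1 n (leq_trans NN1 Nn); lra.
  by rewrite nm_div nmX ler_pdivrMr ?exprn_gt0 ?(lt_le_trans ltr01 d1)// ler_peMr ?nm_ge0// exprn_ege1.
have h3 : normc X <= normc (f z) + normc (X + Y - f z) + normc Y.
  have {1}-> : X = f z + (X + Y - f z) - Y by ring.
  by apply: le_trans (nm_leB2 _ _) _; rewrite lerD2r le_normcD.
have -> : sigma * (2 * sin (pi / K%:R)) * K%:R / (96 * pi * rho ^+ 2) = eta / 2.
  exact: arc_const_half.
by lra.
Qed.

Lemma arc_weight_le (rho : R) n : 0 < rho -> normc (t n) != rho ->
  arc_weight rho n <= 2 * normc (c n) * Num.sqrt (normc (t n) / `|normc (t n) - rho|).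
Proof.
move=> r0 tr; rewrite /arc_weight; have T0 := t_gt0 n; set T := normc (t n) in T0 tr *.
have d0 : 0 < `|T - rho| by rewrite normr_gt0 subr_eq0.
have -> : `|rho ^+ 2 - T ^+ 2| = `|T - rho| * (T + rho).
  by rewrite -[T + rho]gtr0_norm ?addr_gt0// -normrM distrC; congr `|_|; ring.
rewrite -[leLHS]mulrA [2 * normc (c n)]mulrC -[leRHS]mulrA; apply: ler_wpM2l; first exact: nm_ge0.
move: d0; set d := `|_| => d0.
rewrite -(ler_pXn2r (n:=2)) ?nnegrE ?mulr_ge0 ?sqrtr_ge0 ?(ltW T0)//.
rewrite !exprMn !sqr_sqrtr ?divr_ge0 ?mulr_ge0 ?addr_ge0 ?(ltW T0) ?(ltW d0) ?(ltW r0)//.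
rewrite [leRHS](_ : _ = 4 * T * (T + rho) / (d * (T + rho))); last first.
  by field; rewrite !gt_eqF// addr_gt0.
rewrite mulrA ler_pM2r ?invr_gt0 ?mulr_gt0 ?addr_gt0//.
by have := mulr_ge0 (ltW T0) (ltW r0); rewrite expr2; have := mulr_ge0 (ltW T0) (ltW T0); lra.
Qed.

Lemma max_prefix n0 : exists2 B : R, 0 < B & forall n, (n < n0)%N -> normc (t n) <= B.
Proof.
exists (1 + \sum_(n <- iota 0 n0) normc (t n)).
  by rewrite ltr_wpDr// sumr_ge0// => n _; exact: nm_ge0.
move=> n nn; have ni : n \in iota 0 n0 by rewrite mem_iota.
rewrite (big_rem n ni) /=.
have : 0 <= \sum_(y <- rem n (iota 0 n0)) normc (t y) by apply: sumr_ge0 => k _; exact: nm_ge0.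
by lra.
Qed.

(** Both conditions are met by averaging over the radii. The total weight is
    small because |c n| is summable: all terms but finitely many have a small
    sum, and the exceptional poles are far inside a large circle. *)
Lemma good_arc_radius (K : nat) (delta : R) : (8 <= K)%N -> 0 < delta -> exists2 r0 : R, 1 <= r0 &
  forall r P, r0 <= r -> uniq P -> (forall n, (n \in P) = (normc (t n) <= 48 * r)) ->
  (0 < size P)%N -> exists rho,
  [/\ r <= rho <= r + r / K%:R, forall n, normc (t n) != rho,
    forall N, \sum_(0 <= n < N) arc_weight rho n <= delta &
    \sum_(n <- P) Num.sqrt (r / K%:R / `|normc (t n) - rho|) <= 17 * (size P)%:R].
Proof.
move=> K8 d0; have K0 := K_gt0 K8.
have K8' : 8 <= K%:R :> R by rewrite (ler_nat _ 8).
have [S S0 hS] := cvg_series_bound (fun n => nm_ge0 (c n)) c_sum.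
(* For |t n| <= 48 r the weight is at most L |c n| times the square root
   averaged by good_radius; tau bounds the tail of the series of |c n|, and tau'
   the square root of |t n| / d for the first n0 poles. *)
pose L := 2 * Num.sqrt (48 * K%:R) : R.
have L0 : 0 <= L by rewrite mulr_ge0 ?sqrtr_ge0.
pose tau := delta / (2 * (4 + 17 * L)).
have tau0 : 0 < tau by rewrite divr_gt0//; lra.
pose tau' := delta / (4 * S); have tau'0 : 0 < tau' by rewrite divr_gt0//; lra.
have B4 : (4 + 17 * L) * tau = delta / 2.
  by rewrite /tau; field; rewrite gt_eqF//; lra.
have tS : tau' * S = delta / 4 by rewrite /tau'; field; rewrite gt_eqF.
clearbody tau tau'.
have [n0 hn0] := cvg_series_tail (fun n => nm_ge0 (c n)) c_sum tau0.
have [B B0 hB] := max_prefix n0.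
have Bt0 : 0 <= 2 * B / tau' ^+ 2 by apply: divr_ge0; [apply: mulr_ge0 => //; exact: ltW|exact: sqr_ge0].
exists (1 + 2 * B + 2 * B / tau' ^+ 2); first by lra.
move=> r P hr uP hP sP.
have r1 : 0 < r by lra.
have h0 : 0 < r / K%:R by rewrite divr_gt0.
have hr8 : r / K%:R <= r by rewrite ler_pdivrMr// ler_peMr ?(ltW r1)//; lra.
pose cc n := if (n0 <= n)%N then normc (c n) else 0.
have cc0 n : 0 <= cc n by rewrite /cc; case: ifP => // _; exact: nm_ge0.
pose v n := cc n / tau + (size P)%:R^-1.
have sP0 : 0 < (size P)%:R :> R by rewrite ltr0n.
have v0 n : n \in P -> 0 <= v n by move=> _; apply: addr_ge0; [apply: divr_ge0 => //; exact: ltW|rewrite invr_ge0 ltW].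
have cP s : uniq s -> \sum_(n <- s) cc n <= tau.
  by move=> us; apply: tail_sum_le us hn0 => n; exact: nm_ge0.
have vP : \sum_(n <- P) v n <= 2.
  rewrite big_split /= -mulr_suml sum_cst_size divff ?gt_eqF//.
  have : (\sum_(n <- P) cc n) / tau <= 1 by rewrite ler_pdivrMr// mul1r cP.
  by lra.
have [rho [hrho hne hsum]] := @good_radius R _ P (fun n => normc (t n)) v r _ h0 v0.
have /andP[rho1 rho2] := hrho.
have rho0 : 0 < rho by lra.
have t_off n : normc (t n) != rho.
  have [/hne//|] := boolP (n \in P); rewrite hP -ltNge => tn.
  by apply/negP => /eqP tr; lra.
pose q n := Num.sqrt (r / K%:R / `|normc (t n) - rho|).
have q0 n : 0 <= q n by exact: sqrtr_ge0.
have hv : \sum_(n <- P) v n * q n <= 17 by apply: le_trans hsum _; lra.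
have hv' : (\sum_(n <- P) cc n * q n) / tau + (\sum_(n <- P) q n) / (size P)%:R <= 17.
  apply: le_trans hv; rewrite !mulr_suml -big_split /= le_eqVlt; apply/orP; left; apply/eqP.
  by apply: eq_bigr => n _; rewrite /v; ring.
have A1 : 0 <= (\sum_(n <- P) cc n * q n) / tau.
  by rewrite divr_ge0 ?(ltW tau0)// sumr_ge0// => n _; rewrite mulr_ge0.
have A2 : 0 <= (\sum_(n <- P) q n) / (size P)%:R by rewrite divr_ge0 ?sumr_ge0.
have A3 : \sum_(n <- P) cc n * q n <= 17 * tau by rewrite -ler_pdivrMr//; lra.
exists rho; split=> //; last by rewrite -ler_pdivrMr//; rewrite -/(q _); lra.
move=> N.
have ptw n : arc_weight rho n <= 2 * tau' * normc (c n) + 4 * cc n +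
    (if n \in P then L * (cc n * q n) else 0).
  apply: le_trans (arc_weight_le rho0 (t_off n)) _.
  have T0 := t_gt0 n; have cn := nm_ge0 (c n).
  have d0' : 0 < `|normc (t n) - rho| by rewrite normr_gt0 subr_eq0 t_off.
  have e1 : 0 <= 2 * tau' * normc (c n) by rewrite !mulr_ge0// ltW.
  have e2 : 0 <= (if n \in P then L * (cc n * q n) else 0).
    by case: ifP => // _; rewrite !mulr_ge0.
  have [nn|nn] := ltnP n n0.
    have tB := hB n nn.
    suff : Num.sqrt (normc (t n) / `|normc (t n) - rho|) <= tau'.
      move=> h; have := ler_wpM2l cn h; have := cc0 n; lra.
    have d1 : r / 2 <= `|normc (t n) - rho|.
      by rewrite distrC; apply: le_trans (ler_norm _); lra.
    have {1}-> : tau' = Num.sqrt (tau' ^+ 2) by rewrite sqrtr_sqr ger0_norm// ltW.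
    apply: ler_wsqrtr.
    rewrite ler_pdivrMr//; apply: le_trans tB _.
    have : 2 * B / tau' ^+ 2 <= r by lra.
    rewrite ler_pdivrMr ?exprn_gt0// => h.
    have := ler_wpM2l (sqr_ge0 tau') d1; lra.
  have ccE : cc n = normc (c n) by rewrite /cc nn.
  have [nP|nP] := boolP (n \in P); last first.
    have tn : 48 * r < normc (t n) by rewrite ltNge -hP.
    suff : Num.sqrt (normc (t n) / `|normc (t n) - rho|) <= 2.
      move=> h; have := ler_wpM2l cn h; rewrite ccE; lra.
    have -> : 2 = Num.sqrt (2 ^+ 2) :> R by rewrite sqrtr_sqr ger0_norm.
    apply: ler_wsqrtr; rewrite ler_pdivrMr//.
    by have := ler_norm (normc (t n) - rho); lra.
  have tn : normc (t n) <= 48 * r by rewrite -hP.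
  have qle : Num.sqrt (normc (t n) / `|normc (t n) - rho|) <= Num.sqrt (48 * K%:R) * q n.
    rewrite /q -sqrtrM ?mulr_ge0// ?(ltW K0)//; apply: ler_wsqrtr.
    rewrite !mulrA ler_pM2r ?invr_gt0// [leRHS](_ : _ = 48 * r)//.
    by field; rewrite gt_eqF.
  have := ler_wpM2l cn qle; rewrite ccE /L.
  by have := cc0 n; rewrite ccE; lra.
apply: le_trans (ler_sum _ (fun n _ => ptw n)) _.
rewrite !big_split /= -!mulr_sumr.
have B1 : \sum_(0 <= n < N) (if n \in P then L * (cc n * q n) else 0) <= L * (17 * tau).
  apply: le_trans (ler_wpM2l L0 A3); rewrite -big_mkcond /= -mulr_sumr ler_wpM2l// -[leLHS]big_filter.
  apply: sub_sum_le => //; first by rewrite filter_uniq ?iota_uniq.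
    by move=> n; rewrite mem_filter => /andP[].
  by move=> n; exact: mulr_ge0.
have B2 : \sum_(0 <= n < N) cc n <= tau by apply: cP; exact: iota_uniq.
have B3 : tau' * \sum_(0 <= n < N) normc (c n) <= delta / 4.
  apply: le_trans (ler_wpM2l (ltW tau'0) (hS N)) _.
  by rewrite tS.
by lra.
Qed.

(** * The proximity function of the reciprocal *)

Hypothesis c_total : exists2 sigma : R, 0 < sigma & exists N0, forall N, (N0 <= N)%N ->
  sigma <= normc (\sum_(0 <= n < N) c n).

Section OneCircle.
Variables (R0 R1 R2 : R) (P : seq nat) (Z : seq R[i]) (G : R[i] -> R[i]).
Hypotheses (R01 : R0 < R1) (R12 : R1 < R2).
Hypothesis dF : disc_factorization R0 R1 R2 P Z G.

Lemma off_zeros z : normc z <= R1 -> (forall n, z != t n) -> f z != 0 ->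
  forall a, a \in Z -> 0 < normc (z - a).
Proof.
move: dF => [_ _ _ _ E] zr zt fz a aZ; rewrite nm_gt0; apply: contraNneq fz => za.
by rewrite E// (big_rem a aZ) /= za !mul0r.
Qed.

(** Both logarithms are expanded by the factorization; the zero-free factor is
    compared by the Harnack inequality. *)
Lemma ln_recip_le z z0 rho D M U : 0 < D -> 0 < R0 ->
  (forall n, normc (t n) != rho) -> normc z = rho -> normc (z - z0) <= D ->
  normc z <= R0 / 2 -> normc z0 <= R0 / 2 -> f z != 0 -> f z0 != 0 -> (forall n, z0 != t n) ->
  (forall w, normc w <= R0 -> ln (normc (G w)) <= M) -> M - ln (normc (G 0)) <= U ->
  - ln (normc (f z0)) <= - ln (normc (f z)) + 8 * U * D / R0
    + \sum_(a <- Z) ln (1 + D / normc (z0 - a))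
    + \sum_(b <- double_poles P)
        (1 + 4 * Num.sqrt (D / `|normc b - rho|)) * ln (1 + 2 * D / normc (z0 - b)).
Proof.
move=> D0 R00 t_off zr zD z2 z02 fz fz0 zt0 hM hU.
have zt n : z != t n by apply: contraNneq (t_off n) => <-; rewrite zr.
have R0R1 : R0 < R1 by [].
have zR1 : normc z <= R1 by lra.
have z0R1 : normc z0 <= R1 by lra.
have [_ _ pG nz _] := dF.
have rr : 0 <= R0 < R1 by rewrite R01 ltW.
have har := Harnack R00 (re_approx_ln rr pG nz) hM z2 z02.
have {}har : ln (normc (G z)) - ln (normc (G z0)) <= 8 * U * D / R0.
  apply: le_trans (ler_norm _) _; apply: le_trans har _.
  rewrite ler_pM2r ?invr_gt0//; apply: ler_pM; rewrite ?nm_ge0// ?mulr_ge0//.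
    by rewrite subr_ge0 hM// (@nm_nat R 0) ltW.
  by rewrite ler_wpM2l.
have hZ : \sum_(a <- Z) ln (normc (z - a)) <=
    \sum_(a <- Z) ln (normc (z0 - a)) + \sum_(a <- Z) ln (1 + D / normc (z0 - a)).
  rewrite -big_split /= big_seq [leRHS]big_seq; apply: ler_sum => a aZ.
  apply: ln_le_shift; [exact: off_zeros aZ|exact: off_zeros aZ|].
  have -> : z - a = (z0 - a) + (z - z0) by ring.
  by apply: le_trans (le_normcD _ _) _; rewrite lerD2l.
have hT : \sum_(b <- double_poles P) ln (normc (z0 - b)) <=
    \sum_(b <- double_poles P) ln (normc (z - b)) + \sum_(b <- double_poles P)
        (1 + 4 * Num.sqrt (D / `|normc b - rho|)) * ln (1 + 2 * D / normc (z0 - b)).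
  rewrite -big_split /= big_seq [leRHS]big_seq; apply: ler_sum => b.
  rewrite mem_cat orbb => /mapP[n _ ->].
  have zb : 0 < normc (z - t n) by rewrite nm_gt0 subr_eq0.
  have z0b : 0 < normc (z0 - t n) by rewrite nm_gt0 subr_eq0.
  have shift : normc (z0 - t n) <= normc (z - t n) + D.
    have -> : z0 - t n = (z - t n) - (z - z0) by ring.
    by apply: le_trans (nm_leB2 _ _) _; rewrite lerD2l.
  apply: le_trans (ln_le_shift z0b zb shift) _; rewrite lerD2l.
  have d0 : 0 < `|normc (t n) - rho| by rewrite normr_gt0 subr_eq0.
  have dz : `|normc (t n) - rho| <= normc (z - t n) by rewrite -zr distrC nm_dist.
  exact: ln1D_transfer.
have e1 := ln_disc dF zR1 zt fz; have e0 := ln_disc dF z0R1 zt0 fz0.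
by rewrite e1 e0; lra.
Qed.

(** Average the pointwise bound over the circle. *)
Lemma proximity_recip_le r rho k M U A B : 0 < r -> 0 < k -> 2 * k <= 1 -> 2 * r <= R0 ->
  2 * rho <= R0 -> generic r -> (forall n, normc (t n) != rho) ->
  (forall w, normc w <= R0 -> ln (normc (G w)) <= M) -> M - ln (normc (G 0)) <= U -> 0 <= A -> 0 <= U ->
  (forall theta, exists z, [/\ normc z = rho, normc (z - r%:C * cis theta) <= k * r,
     f z != 0 & - ln (normc (f z)) <= A]) ->
  \sum_(b <- double_poles P) (1 + 4 * Num.sqrt (k * r / `|normc b - rho|)) <= B ->
  proximity r (recip f) <= A + 8 * U * (k * r) / R0 + (size Z)%:R * (5 * Num.sqrt k)
    + B * (5 * Num.sqrt (2 * k)).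
Proof.
move=> r0 k0 k1 rR rhoR gr t_off hM hU A0 U0 harc hB.
have R00 : 0 < R0 by lra.
have rR0 : r <= R0 by lra.
have kr0 : 0 < k * r by rewrite mulr_gt0.
have [cu _] := jensen_disc R01 dF r0 rR0 gr.
pose W b := 1 + 4 * Num.sqrt (k * r / `|normc b - rho|).
have W0 b : 0 <= W b by rewrite addr_ge0// mulr_ge0// sqrtr_ge0.
pose FZ a x := ln (1 + k * r / normc (r%:C * cis x - a)).
pose FT b x := W b * ln (1 + 2 * k * r / normc (r%:C * cis x - b)).
have k1' : k <= 1 by lra.
have k2 : 0 < 2 * k by lra.
have cZ a : a \in Z -> continuous (FZ a) /\ cmean (FZ a) <= 5 * Num.sqrt k.
  by move=> aZ; exact: (cmean_ln1D r0 k0 k1' (generic_zeros R01 dF rR0 gr aZ)).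
have cT b : b \in double_poles P -> continuous (FT b) /\ cmean (FT b) <= W b * (5 * Num.sqrt (2 * k)).
  move=> bT; have [c1 m1] := cmean_ln1D r0 k2 k1 (generic_poles gr bT).
  split; first exact: (@continuousZ_fun _ (W b) _ c1).
  by rewrite /FT (@cmeanZ _ (W b) _ c1); exact: ler_wpM2l.
have cZs := @continuous_sum_fun _ _ Z FZ (fun a aZ => (cZ a aZ).1).
have cTs := @continuous_sum_fun _ _ (double_poles P) FT (fun b bT => (cT b bT).1).
have cA : continuous (fun _ : R => A + 8 * U * (k * r) / R0) by move=> x; exact: cst_continuous.
have cAZ := @continuousD_fun _ _ _ cA cZs.
have cAZT := @continuousD_fun _ _ _ cAZ cTs.
have cv := continuous_max0 (@continuousZ_fun _ (-1) _ cu).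
have circ x : normc (r%:C * cis x) = r by rewrite nm_circle// ltW.
rewrite proximityE.
have -> : (fun x => logp (normc (recip f (r%:C * cis x)))) =
    (fun x => Num.max (-1 * ln (normc (f (r%:C * cis x)))) 0).
  apply/funext => x; have [_ fx] := gr _ (circ x).
  by rewrite /recip normcV logp_inv ?nm_gt0// mulN1r.
apply: le_trans (@cmean_le _ _ _ cv cAZT _) _.
  move=> x; rewrite ge_max; apply/andP; split; last first.
    apply: addr_ge0; first apply: addr_ge0.
    - by rewrite addr_ge0// divr_ge0 ?(ltW R00)// !mulr_ge0// ltW.
    - by apply: sumr_ge0 => a _; apply: ln_ge0; rewrite lerDl divr_ge0 ?nm_ge0// ltW.
    - apply: sumr_ge0 => b _; apply: mulr_ge0 => //; apply: ln_ge0.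
      by rewrite lerDl divr_ge0 ?nm_ge0// -mulrA mulr_ge0// ltW.
  have [z [zr zD fz hz]] := harc x; have [xt fx] := gr _ (circ x).
  have z2 : normc z <= R0 / 2 by rewrite zr; lra.
  have x2 : normc (r%:C * cis x) <= R0 / 2 by rewrite circ; lra.
  have := ln_recip_le kr0 R00 t_off zr zD z2 x2 fz fx xt hM hU.
  rewrite mulN1r /FT /W; under [X in _ <= _ + X -> _]eq_bigr do rewrite mulrA.
  by rewrite /FZ; lra.
rewrite (@cmeanD _ _ _ cAZ cTs) (@cmeanD _ _ _ cA cZs) cmean_cst.
rewrite (@cmean_sum _ _ Z FZ (fun a aZ => (cZ a aZ).1)).
rewrite (@cmean_sum _ _ (double_poles P) FT (fun b bT => (cT b bT).1)).
apply: lerD; first rewrite lerD2l.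
  rewrite -sum_cst_size big_seq [leRHS]big_seq; apply: ler_sum => a aZ.
  exact: (cZ a aZ).2.
apply: (@le_trans _ _ (\sum_(b <- double_poles P) W b * (5 * Num.sqrt (2 * k)))).
  by rewrite big_seq [leRHS]big_seq; apply: ler_sum => b bT; exact: (cT b bT).2.
by rewrite -mulr_suml ler_wpM2r// mulr_ge0// sqrtr_ge0.
Qed.
End OneCircle.

Lemma fine_subdivision (xi : R) : 0 < xi -> exists K : nat, let k := 40 / K%:R in
  [/\ (8 <= K)%N, 2 * k <= 1, k <= xi, Num.sqrt k <= xi & Num.sqrt (2 * k) <= xi].
Proof.
move=> xi0'; pose x := Num.min 1 xi.
have x0 : 0 < x by rewrite lt_min ltr01.
have x1 : x <= 1 by rewrite ge_min lexx.
have xxi : x <= xi by rewrite ge_min lexx orbT.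
clearbody x; pose K := (8 + Num.bound (80 / x ^+ 2))%N.
have K8 : (8 <= K)%N by rewrite /K leq_addr.
have K0 := K_gt0 K8.
have Kx : 80 / K%:R <= x ^+ 2.
  rewrite ler_pdivrMr// -ler_pdivrMl ?exprn_gt0// mulrC.
  apply: (@le_trans _ _ (Num.bound (80 / x ^+ 2))%:R); last by rewrite ler_nat /K leq_addl.
  by apply/ltW/archi_boundP; rewrite divr_ge0 ?exprn_ge0// ltW.
clearbody K.
have k0 : 0 < 40 / K%:R :> R by rewrite divr_gt0.
have k80 : 2 * (40 / K%:R) = 80 / K%:R :> R by field; rewrite gt_eqF.
have x2 : x ^+ 2 <= x by rewrite expr2 ler_piMl// ltW.
have sk2 : Num.sqrt (2 * (40 / K%:R)) <= x.
  have -> : x = Num.sqrt (x ^+ 2) by rewrite sqrtr_sqr ger0_norm// ltW.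
  by rewrite k80; exact: ler_wsqrtr.
have sk : Num.sqrt (40 / K%:R) <= Num.sqrt (2 * (40 / K%:R)) :> R.
  by move: k0; move: (40 / K%:R) => k k0; apply: ler_wsqrtr; lra.
by exists K; split=> //; lra.
Qed.

Lemma good_point_near (K : nat) (r rho q theta : R) z : (8 <= K)%N -> 0 < r -> 0 < q ->
  r <= rho -> rho <= r + r / K%:R -> normc z = rho ->
  normc (z - rho%:C * cis theta) <= 6 * pi * rho / K%:R -> q / rho ^+ 2 <= normc (f z) ->
  [/\ normc (z - r%:C * cis theta) <= 40 / K%:R * r, f z != 0 &
    - ln (normc (f z)) <= `|ln q| + 2 * ln (2 * r)].
Proof.
move=> K8 r0 q0 rho1 rho2 zr zd fz; have K0 := K_gt0 K8; have p0 := pi_gt0 R.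
have K8' : 8 <= K%:R :> R by rewrite (ler_nat _ 8).
have hr8 : r / K%:R <= r / 8 by rewrite ler_pM2l// lef_pV2 ?posrE.
have rK0 : 0 < r / K%:R by rewrite divr_gt0.
have rhop : 0 < rho by apply: lt_le_trans rho1.
have q20 : 0 < q / rho ^+ 2 by rewrite divr_gt0// exprn_gt0.
have fz0 : 0 < normc (f z) by exact: lt_le_trans fz.
split.
- have -> : z - r%:C * cis theta = (z - rho%:C * cis theta) + (rho - r)%:C * cis theta.
    by rewrite rmorphB /=; ring.
  apply: le_trans (le_normcD _ _) _.
  rewrite [normc (_ * cis theta)]normcM nm_real nm_cis mulr1 ger0_norm ?subr_ge0//.
  have pi4 : pi <= 4 :> R by have := pihalf_lt2 R; lra.
  have h1 : pi * rho <= 4 * (9 / 8 * r) by apply: ler_pM => //; lra.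
  have h2 : 6 * pi * rho / K%:R <= 27 * r / K%:R.
    by rewrite ler_pM2r ?invr_gt0//; lra.
  have -> : 40 / K%:R * r = 40 * (r / K%:R) by ring.
  have h3 : 27 * r / K%:R = 27 * (r / K%:R) by ring.
  by rewrite h3 in h2; lra.
- by rewrite -nm_gt0.
have : ln (q / rho ^+ 2) <= ln (normc (f z)) by rewrite ler_ln ?posrE.
rewrite ln_div ?posrE ?exprn_gt0// lnXn// mulr2n.
have : ln rho <= ln (2 * r) by rewrite ler_ln ?posrE ?mulr_gt0//; lra.
by have := ler_norm (- ln q); rewrite normrN; lra.
Qed.

Lemma pole_weight_sum (P : seq nat) (K : nat) (r rho : R) : 0 < r ->
  \sum_(n <- P) Num.sqrt (r / K%:R / `|normc (t n) - rho|) <= 17 * (size P)%:R ->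
  \sum_(b <- double_poles P) (1 + 4 * Num.sqrt (40 / K%:R * r / `|normc b - rho|))
    <= 954 * (size P)%:R.
Proof.
move=> r0 hq; rewrite sum_double_poles.
apply: (@le_trans _ _ (\sum_(n <- P) (2 + 56 * Num.sqrt (r / K%:R / `|normc (t n) - rho|)))).
  apply: ler_sum => n _.
  have : Num.sqrt (40 / K%:R * r / `|normc (t n) - rho|) <= 7 * Num.sqrt (r / K%:R / `|normc (t n) - rho|).
    have {1}-> : 7 = Num.sqrt (7 ^+ 2) :> R by rewrite sqrtr_sqr ger0_norm.
    rewrite -sqrtrM ?sqr_ge0//; apply: ler_wsqrtr.
    have h0 : 0 <= r / K%:R / `|normc (t n) - rho| by rewrite !divr_ge0// ltW.
    have -> : 40 / K%:R * r / `|normc (t n) - rho| = 40 * (r / K%:R / `|normc (t n) - rho|) by ring.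
    by apply: ler_wpM2r => //; lra.
  by lra.
by rewrite big_split /= sum_cst_size -mulr_sumr; lra.
Qed.

Lemma integrated_count_beats (eps A : R) : 0 < eps -> exists2 r0 : R, 1 <= r0 &
  forall r, r0 <= r -> A + 2 * ln (2 * r) <= eps * integrated_count (88 * r) f.
Proof.
move=> eps0; have [m hm] : exists m : nat, 3 / eps <= m%:R.
  by exists (Num.bound (3 / eps)); apply/ltW/archi_boundP; rewrite divr_ge0// ltW.
have [r2 r21 hr2] := integrated_count_log m.
have eA := expR_gt0 A.
exists (r2 + expR A) => [|r hr]; first by lra.
have r0 : 0 < r by lra.
have r88 : r2 <= 88 * r by lra.
have := hr2 _ r88 => hmN.
have l1 : ln (2 * r) <= ln (88 * r) by rewrite ler_ln ?posrE; lra.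
have l2 : A <= ln (88 * r) by rewrite -[leLHS]expRK ler_ln ?posrE//; lra.
have l0 : 0 <= ln (88 * r) by apply: ln_ge0; lra.
have h := le_trans (ler_wpM2r l0 hm) hmN.
have : eps * (3 / eps * ln (88 * r)) <= eps * integrated_count (88 * r) f by rewrite ler_pM2l.
have -> : eps * (3 / eps * ln (88 * r)) = 3 * ln (88 * r) by field; rewrite gt_eqF.
by lra.
Qed.

(** The mean of log+ |1/f| over a large circle is negligible. *)
Lemma proximity_recip_small (eps : R) : 0 < eps -> exists2 r0 : R, 1 <= r0 &
  forall r, r0 <= r -> generic r ->
    proximity r (recip f) <= eps * integrated_count (88 * r) f.
Proof.
move=> eps0; have [sigma sig0 [N0 hN0]] := c_total.
have [C [rho0 [C1 rho01 trho hctl]]] :=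
  controlled_factorization.
have C0 : 0 < C := lt_le_trans ltr01 C1.
(* A collects the constants of sum_of_small_terms. *)
have [A A0] : exists2 A : R, 0 < A & A = 1 + 5 + 954 * 5 by exists (1 + 5 + 954 * 5); [lra|reflexivity].
move=> AE; pose xi := eps / 2 / (A * C).
have AC : 0 < A * C by rewrite mulr_gt0.
have e2 : 0 < eps / 2 by rewrite divr_gt0.
have xi0 : 0 < xi by rewrite divr_gt0.
have xiC : A * C * xi = eps / 2 by rewrite /xi mulrC divfK// gt_eqF.
have [K [K8 k1 kxi skxi sk2xi]] := fine_subdivision xi0.
have K0 := K_gt0 K8; have kap0 := kappa_gt0 K8; have p0 := pi_gt0 R.
pose delta := sigma * (2 * sin (pi / K%:R)) / (4 * K%:R).
have delta0 : 0 < delta by apply: divr_gt0; exact: mulr_gt0.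
have hdelta : 4 * K%:R * delta <= sigma * (2 * sin (pi / K%:R)).
  by rewrite /delta mulrC divfK// gt_eqF// mulr_gt0.
have [r1 r11 hr1] := good_arc_radius K8 delta0.
pose q := sigma * (2 * sin (pi / K%:R)) * K%:R / (96 * pi).
have q0 : 0 < q by apply: divr_gt0; [apply: mulr_gt0 => //; exact: mulr_gt0|exact: mulr_gt0].
have [r2 r21 hr2] := integrated_count_beats `|ln q| e2.
exists (rho0 + r1 + r2) => [|r hr gr]; first by lra.
have [r0 r8 r1r r2r] : [/\ 1 <= r, rho0 <= 8 * r, r1 <= r & r2 <= r].
  by split; lra.
have {}hr2 := hr2 r r2r.
have rp : 0 < r := lt_le_trans ltr01 r0.
have [R1 [P [Z [G [M [[R1a R1b] dF hM [N1 /andP[U0 UC] hZ hP] _]]]]]] := hctl _ r8.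
have N88 : 11 * (8 * r) = 88 * r by ring.
rewrite N88 in N1 UC hZ hP; set N := integrated_count (88 * r) f in N1 UC hZ hP hr2 *.
have R01 : 8 * r < R1 by lra.
have [[uP memP] _ _ _ _] := dF.
have P48 n : (n \in P) = (normc (t n) <= 48 * r) by rewrite memP; congr (_ <= _); ring.
have sP : (0 < size P)%N.
  have : 0%N \in P by rewrite P48; lra.
  by case: (P).
have [rho [/andP[rho1 rho2] t_off hW hq]] := hr1 r P r1r uP P48 sP.
have rhop : 0 < rho := lt_le_trans rp rho1.
have rho2r : 2 * rho <= 8 * r.
  have : r / K%:R <= r by rewrite ler_pdivrMr// ler_peMr ?(ltW rp)// ler1n (leq_trans _ K8).
  by lra.
have divdiv (x y w : R) : x / y / w = x / (y * w) by rewrite invfM mulrA.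
have harc theta : exists z, [/\ normc z = rho, normc (z - r%:C * cis theta) <= 40 / K%:R * r,
    f z != 0 & - ln (normc (f z)) <= `|ln q| + 2 * ln (2 * r)].
  have [z [zr zd fz]] := arc_lower_bound theta rhop K8 t_off hW sig0 hN0 hdelta.
  have fz' : q / rho ^+ 2 <= normc (f z) by rewrite /q divdiv.
  by have [h1 h2 h3] := good_point_near K8 rp q0 rho1 rho2 zr zd fz'; exists z.
have hB := pole_weight_sum rp hq.
have lr0 : 0 <= ln (2 * r) by apply: ln_ge0; lra.
have A0' : 0 <= `|ln q| + 2 * ln (2 * r) by rewrite addr_ge0 ?mulr_ge0.
have CN0 : 0 <= C * N := le_trans U0 UC.
have r28 : 2 * r <= 8 * r by lra.
have k0 : 0 < 40 / K%:R :> R by rewrite divr_gt0.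
have key := proximity_recip_le R01 dF rp k0 k1 r28 rho2r gr t_off hM UC A0' CN0 harc hB.
apply: le_trans key _.
have e1 : 8 * (C * N) * (40 / K%:R * r) / (8 * r) = C * N * (40 / K%:R).
  by field; rewrite !gt_eqF.
rewrite e1.
have := sum_of_small_terms CN0 kxi skxi sk2xi (sqrtr_ge0 _) (sqrtr_ge0 _) (ler0n _ _) (ler0n _ _) hZ hP.
rewrite -AE (_ : A * (C * N * xi) = A * C * xi * N); last by ring.
rewrite xiC; lra.
Qed.

(** * Regular radii and orders of growth *)

Section FiniteOrder.
Variable L : R.
Hypothesis L0 : 0 < L.
Hypothesis t_exp : cvgn (series (fun n => normc (t n) `^ (- L))).

Let N r := integrated_count r f.
Let N1 r := integrated_count r (recip f).

Lemma count_mono r r' : 0 < r -> r <= r' -> N r <= N r'.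
Proof. exact: (integrated_count_mono). Qed.

Lemma count_large (A : R) : exists2 a, 1 <= a & forall r, a <= r -> A <= N r.
Proof.
have [a a1 ha] := integrated_count_log 1.
exists (a + expR A) => [|r hr]; first by have := expR_gt0 A; lra.
have eA := expR_gt0 A; have ar : a <= r by lra.
have := ha r ar; rewrite mul1r; apply: le_trans.
by rewrite -[leLHS]expRK ler_ln ?posrE//; lra.
Qed.

(** Each pole contributes ln (r / |t n|) <= (r / |t n|)^L / L. *)
Lemma finite_order : exists c2 a : R, 1 <= a /\
  forall r, a <= r -> 1 <= N r /\ ln (N r) <= c2 + L * ln r.
Proof.
have tL0 n : 0 <= normc (t n) `^ (- L) by exact: powR_ge0.
have [S S0 hS] := cvg_series_bound tL0 t_exp.
have [a a1 ha] := count_large 1.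
exists (ln (2 / L * S)), a; split=> // r ar; have N1r := ha r ar; split=> //.
have r0 : 0 < r by lra.
have bound : N r <= 2 / L * S * (r `^ L).
  have rR : r <= Num.max r (normc (t 0)) by rewrite le_max lexx.
  have tR : normc (t 0) <= Num.max r (normc (t 0)) by rewrite le_max lexx orbT.
  have [P [uP _ E]] := integrated_countf r0 rR tR.
  rewrite /N E//.
  apply: (@le_trans _ _ (\sum_(n <- P) 2 / L * (r `^ L) * (normc (t n) `^ (- L)))).
    apply: ler_sum => n _; have T0 := t_gt0 n; set T := normc (t n) in T0 *.
    rewrite -!mulrA; apply: ler_wpM2l => //.
    have p0 : 0 < r `^ L * T `^ (- L) by rewrite mulr_gt0// powR_gt0.
    rewrite ler_pdivlMl//.
    have [rT|Tr] := leP r T.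
      by rewrite subrr mulr0 ltW.
    have := ln_le_diff p0 ltr01; rewrite ln1 subr0 divr1.
    by rewrite lnM ?posrE ?powR_gt0// !ln_powR; lra.
  rewrite -mulr_sumr -[leRHS]mulrA [S * _]mulrC [leRHS]mulrA ler_wpM2l//.
    by rewrite mulr_ge0 ?powR_ge0 ?divr_ge0 ?(ltW L0).
  exact: (@tail_sum_le R (fun n => normc (t n) `^ (- L)) 0%N S P tL0 uP hS).
have SL : 0 < 2 / L * S by rewrite mulr_gt0// divr_gt0.
apply: (@le_trans _ _ (ln (2 / L * S * (r `^ L)))).
  have Nr0 : 0 < N r by apply: lt_le_trans N1r.
  by rewrite ler_ln ?posrE// mulr_gt0// powR_gt0.
by rewrite lnM ?posrE ?powR_gt0// ln_powR.
Qed.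

(** The dilation by 176 = 2 * 88 leaves room for a generic radius between x and
    2 x. The Jensen formula turns the bound on m(r, 1/f) into a lower bound on
    the number of zeros. *)
Lemma regular_radius (mu eps : R) : 0 <= mu -> 0 < eps -> exists2 a, 1 <= a &
  forall y, a <= y -> mu * ln y <= ln (N y) -> exists r, [/\ y <= r,
    proximity r (recip f) <= eps * N r, N r / 4 <= N1 r & mu * (ln r - ln 2) <= ln (N r)].
Proof.
move=> mu0 eps0; have [c2 [a0 [a01 hord]]] := finite_order.
have [Lam [_ jen]] := jensen (t_neq0 0%N).
have [q [q1 qE]] : exists q : R, 1 < q /\ forall x, 88 * (x + x) = q * x.
  by exists (88 * 2); split; [lra|move=> x; ring].
pose C3 := expR ((L + mu) * ln q + 1); have C30 : 0 < C3 := expR_gt0 _.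
pose e1 := Num.min eps (1 / 4) / C3.
have m0 : 0 < Num.min eps (1 / 4) by rewrite lt_min eps0//; lra.
have e10 : 0 < e1 by rewrite divr_gt0.
have [a2 a21 hprox] := proximity_recip_small e10.
have [a3 a31 hlarge] := count_large (2 * `|Lam| + 1).
exists (a0 + a2 + a3) => [|y hy hmu]; first by lra.
have y0 : 0 < y by lra.
have hord' r : y <= r -> 1 <= N r /\ ln (N r) <= c2 + L * ln r by move=> yr; apply: hord; lra.
have [x [yx hx mux]] := regular_scale (ltW L0) mu0 q1 y0 hord' hmu.
have x0 : 0 < x by lra.
have [r /andP[xr rx] gr] := generic_radius_in x0 x0.
have r0 : 0 < r by lra.
have [Nx _] := hord' x yx.
have yr : y <= r by lra.
have [Nr _] := hord' r yr.
have NxNr : N x <= N r by exact: count_mono.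
have N88 : N (88 * r) <= C3 * N r.
  apply: (@le_trans _ _ (N (q * x))).
    by apply: count_mono; [|rewrite -qE]; lra.
  have Nq : 1 <= N (q * x).
    by have [] := hord' (q * x); first by apply: (le_trans yx); exact: ler_peMl (ltW x0) (ltW q1).
  apply: (@le_trans _ _ (C3 * N x)); last by rewrite ler_pM2l.
  have CN : 0 < C3 * N x by rewrite mulr_gt0//; lra.
  rewrite -ler_ln ?posrE//; last by lra.
  by rewrite lnM ?posrE//; [rewrite /C3 expRK|lra].
have a2r : a2 <= r by lra.
have prox : proximity r (recip f) <= Num.min eps (1 / 4) * N r.
  apply: le_trans (hprox r a2r gr) _.
  have := ler_wpM2l (ltW e10) N88; rewrite -/(N _) /e1 => /le_trans; apply.
  by rewrite mulrA divfK// gt_eqF.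
exists r; split=> //.
- by apply: le_trans prox _; rewrite ler_wpM2r ?ge_min ?lexx//; lra.
- have : Num.min eps (1 / 4) * N r <= 1 / 4 * N r.
    by rewrite ler_wpM2r ?ge_min ?lexx ?orbT//; lra.
  have a3r : a3 <= r by lra.
  have := hlarge r a3r; have := jen r r0 gr; rewrite -/(N r) -/(N1 r).
  have := proximity_ge0 r f; have := ler_norm Lam.
  by lra.
apply: (@le_trans _ _ (mu * ln x)).
  apply: ler_wpM2l => //; rewrite -ln_div ?posrE// ler_ln ?posrE ?divr_gt0//.
  by rewrite ler_pdivrMr//; lra.
by apply: le_trans mux _; rewrite ler_ln ?posrE; lra.
Qed.

Lemma characteristic_ge_count r : N r <= characteristic r f.
Proof. by rewrite /characteristic lerDl proximity_ge0. Qed.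

Lemma defect_zero : defect0 f = 0%E.
Proof.
apply/eqP; rewrite eq_le; apply/andP; split; rewrite /defect0 limf_einfE.
  apply: ge_ereal_sup => _ [V [M [_ hV]] <-].
  apply/lee_addgt0Pr => e e0; rewrite add0e.
  have [a a1 ha] := regular_radius (lexx 0) e0.
  have [b b1 hb] := count_large 1.
  have My := ler_norm M; have nM := normr_ge0 M.
  have [|r [yr hr _ _]] := ha (a + b + `|M| + 1) ltac:(lra).
    by rewrite mul0r ln_ge0// hb//; lra.
  apply: (@le_trans _ _ (proximity r (recip f) / characteristic r f)%:E).
    by apply: ereal_inf_lbound; exists r => //; apply: hV; lra.
  have br : b <= r by lra.
  have N1r := hb r br; have T := characteristic_ge_count r.
  rewrite lee_fin ler_pdivrMr; last by lra.
  by apply: le_trans hr _; rewrite ler_wpM2l// ltW.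
apply: (@le_trans _ _ (ereal_inf ((fun r => (proximity r (recip f) / characteristic r f)%:E) @` [set r | 1 < r]))).
  apply: le_ereal_inf_tmp => _ [r r1 <-]; rewrite lee_fin.
  have r0 : 0 < r by apply: lt_trans r1.
  apply: divr_ge0; first exact: proximity_ge0.
  apply: le_trans (characteristic_ge_count r).
  exact: (integrated_count_ge0).
apply: ereal_sup_ubound; exists [set r | 1 < r] => //.
by exists 1; split => //; rewrite num_real.
Qed.

Lemma order_zeros_le : (growth_order N1 <= growth_order N)%E.
Proof.
have [C [r0 [C1 r01 _ hctl]]] := controlled_factorization.
have [b b1 hb] := count_large 1.
apply: (@growth_order_dilate R N1 N C 11 (r0 + b)) => //; [lra|lra|].
move=> r hr; split; first by apply: hb; lra.
have [|R1 [P [Z [G [M [_ _ _ _ [/andP[_ h] _]]]]]]] := hctl r; first by lra.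
exact: h.
Qed.

Lemma order_characteristic_le : (growth_order (fun r => characteristic r f) <= growth_order N)%E.
Proof.
have [C [r0 [C1 r01 _ hctl]]] := controlled_factorization.
have [b b1 hb] := count_large 1.
apply: (@growth_order_dilate R _ N (1 + C) 11 (r0 + b)) => //; [lra|lra|lra|].
move=> r hr; split; first by apply: hb; lra.
have r0' : 0 < r by lra.
have [|R1 [P [Z [G [M [_ _ _ _ [_ h]]]]]]] := hctl r; first by lra.
rewrite /characteristic mulrDl mul1r lerD//; apply: count_mono => //; lra.
Qed.

Lemma order_le_characteristic : (growth_order N <= growth_order (fun r => characteristic r f))%E.
Proof.
have [b b1 hb] := count_large 1.
apply: (@growth_order_dilate R N _ 1 1 b) => // r br.
have h := characteristic_ge_count r; have Nb := hb r (ltW br).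
by rewrite !mul1r; split => //; lra.
Qed.

(** Along regular radii a quarter of N(r, f) is matched by zeros, and these radii
    capture the order: from y on, N gains at least as much as the power mu of the
    radius. *)
Lemma order_le_zeros : (growth_order N <= growth_order N1)%E.
Proof.
apply: lee_of_upper_bounds => b /growth_order_lt[a hb].
have na := normr_ge0 a; have aa := ler_norm a.
have [c1 c11 hc1] := count_large 4.
have bounded_below (mu : R) : 0 <= mu -> (forall A, exists2 y, A < y & mu * ln y <= ln (N y)) -> b < mu -> False.
  move=> mu0 hmu bmu; have [d d1 hd] := regular_radius mu0 ltr01.
  pose A := (mu * ln 2 + ln 4) / (mu - b); have eA := expR_gt0 A.
  have [y hy hNy] := hmu (`|a| + c1 + d + expR A).
  have [|r [yr _ hN1 hN]] := hd y _ hNy; first by lra.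
  have ar : a < r by lra.
  have := hb r ar; have r1 : 1 < r by lra.
  have lr : 0 < ln r by rewrite ln_gt0.
  rewrite ltr_pdivrMr//.
  have Nr : 4 <= N r by apply: hc1; lra.
  have : ln (N r / 4) <= ln (N1 r) by rewrite ler_ln ?posrE//; lra.
  rewrite ln_div ?posrE//; last by lra.
  have hA : A <= ln r by rewrite -[leLHS]expRK ler_ln ?posrE//; lra.
  have : mu * ln 2 + ln 4 <= (mu - b) * ln r.
    by rewrite [leRHS]mulrC -ler_pdivrMr// subr_gt0.
  by lra.
(* A negative b is excluded by mu = 0, as N is eventually at least 1. *)
have [b0|b0] := ltP b 0.
  exfalso; apply: (bounded_below 0) => // A.
  exists (`|A| + c1 + 1); first by have := ler_norm A; lra.
  rewrite mul0r ln_ge0//; have := hc1 (`|A| + c1 + 1).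
  by have := normr_ge0 A => h /(_ ltac:(lra)); lra.
rewrite leNgt; apply/negP => bN.
have [mu bmu muN] : exists2 mu : R, b < mu & (mu%:E < growth_order N)%E.
  move: bN; case E : (growth_order N) => [al| |] // bN.
    exists ((b + al) / 2); rewrite ?lte_fin; move: bN; rewrite lte_fin; lra.
  by exists (b + 1); [lra|rewrite ltry].
apply: (bounded_below mu) => //; first by lra.
move=> A; have [y hy hmu] := growth_order_gt (`|A| + 1) muN.
have nA := normr_ge0 A; have AA := ler_norm A.
exists y; first by lra.
have ly : 0 < ln y by rewrite ln_gt0//; lra.
by move: hmu; rewrite ltr_pdivlMr// => /ltW.
Qed.

End FiniteOrder.
End PartialFractionSeries.

(** * The theorem *)

Lemma growth_order_eq (R : realType) (h1 h2 : R -> R) :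
  (growth_order h1 <= growth_order h2)%E -> (growth_order h2 <= growth_order h1)%E ->
  growth_order h1 = growth_order h2.
Proof. by move=> h12 h21; apply/eqP; rewrite eq_le h12 h21. Qed.

Section Hypotheses.
Variables (R : realType) (t c : nat -> R[i]^o).
Hypothesis t_inf : forall r : R, exists N, forall n, (N <= n)%N -> r < normc (t n).
Hypothesis c_sum : cvgn (series (fun n => normc (c n))).

Lemma series_terms_summable (z : R[i]) : (forall n, z != t n) ->
  cvgn (series (fun n => normc (c n / (z - t n) ^+ 2))).
Proof.
move=> zt; have [N hN] := t_inf (normc z + 1).
pose B := 1 + \sum_(n <- iota 0 N) (normc (z - t n) ^+ 2)^-1.
have S0 s : 0 <= \sum_(n <- s) (normc (z - t n) ^+ 2)^-1.
  by apply: sumr_ge0 => n _; rewrite invr_ge0 exprn_ge0 ?nm_ge0.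
have hB n : (normc (z - t n) ^+ 2)^-1 <= B.
  have [nN|Nn] := ltnP n N.
    have ni : n \in iota 0 N by rewrite mem_iota.
    rewrite /B (big_rem n ni) /=; have := S0 (rem n (iota 0 N)).
    by lra.
  have d1 : 1 <= normc (z - t n).
    by rewrite nmB; apply: le_trans (nm_leB _ _); have := hN n Nn; lra.
  have d2 : 1 <= normc (z - t n) ^+ 2 by rewrite exprn_ege1.
  apply: (@le_trans _ _ 1); first by rewrite invf_le1// (lt_le_trans ltr01 d2).
  by rewrite /B lerDl.
apply: (@series_le_cvg _ _ (fun n => B * normc (c n))).
- by move=> n; exact: nm_ge0.
- by move=> n; rewrite mulr_ge0 ?nm_ge0// /B addr_ge0.
- by move=> n; rewrite nm_div nmX mulrC ler_wpM2r ?nm_ge0.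
have -> : series (fun n => B * normc (c n)) = (fun m => B * series (fun n => normc (c n)) m).
  by apply/funext => m; rewrite /series /= mulr_sumr.
exact: (is_cvgM (is_cvg_cst _) c_sum).
Qed.

Lemma partial_sums_bounded_below : limn (series c) != 0 ->
  exists2 sigma : R, 0 < sigma & exists N0, forall N, (N0 <= N)%N ->
    sigma <= normc (\sum_(0 <= n < N) c n).
Proof.
set s := limn _ => s0; have s1 : 0 < normc s / 2 by rewrite divr_gt0// nm_gt0.
have [N0 hN0] := series_nm_lim c_sum s1.
exists (normc s / 2) => //; exists N0 => N /hN0; rewrite -/s => h.
by have := nm_leB s (\sum_(0 <= n < N) c n); rewrite nmB; lra.
Qed.
End Hypotheses.

Theorem theorem1p1 (R : realType) (t c : nat -> R[i]^o) (f : R[i]^o -> R[i]^o)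
    (t_inj : injective t)
    (t_neq0 : forall n, t n != 0)
    (t_infty : normc (t n) @[n --> \oo] --> +oo)
    (t_exponent : exists2 L : R, 0 < L &
       cvgn (series (fun n => normc (t n) `^ (- L))))
    (c_neq0 : forall n, c n != 0)
    (c_summable : cvgn (series (fun n => normc (c n))))
    (c_sum_neq0 : limn (series c) != 0)
    (fE : forall z : R[i]^o, (forall n, z != t n) ->
       f z = limn (series (fun n => c n / (z - t n) ^+ 2))) :
  defect0 f = 0%E /\
  growth_order (fun r => integrated_count r (recip f)) =
    growth_order (fun r => integrated_count r f) /\
  growth_order (fun r => integrated_count r f) =
    growth_order (fun r => characteristic r f).
Proof.
have t_inf (r : R) : exists N, forall n, (N <= n)%N -> r < normc (t n).
  by have /cvgryPgt/(_ r)[N _ hN] := t_infty; exists N => n; exact: hN.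
have f_lim (z : R[i]) : (forall n, z != t n) -> forall e : R, 0 < e ->
    exists N, forall m, (N <= m)%N -> normc (\sum_(0 <= n < m) c n / (z - t n) ^+ 2 - f z) <= e.
  move=> zt e e0; rewrite (fE z zt).
  exact: (series_nm_lim (series_terms_summable t_inf c_summable zt) e0).
have c_total := partial_sums_bounded_below c_summable c_sum_neq0.
have [L L0 t_exp] := t_exponent.
split; [|split].
- exact: (defect_zero t_inj t_neq0 t_inf c_neq0 c_summable f_lim c_total L0 t_exp).
- apply: growth_order_eq.
    exact: (order_zeros_le t_inj t_neq0 t_inf c_neq0 c_summable f_lim).
  exact: (order_le_zeros t_inj t_neq0 t_inf c_neq0 c_summable f_lim c_total L0 t_exp).
- apply: growth_order_eq.
    exact: (order_le_characteristic t_inj t_neq0 t_inf c_neq0 c_summable f_lim).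
  exact: (order_characteristic_le t_inj t_neq0 t_inf c_neq0 c_summable f_lim).
Qed.
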